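(* Assume that $(M,\omega,\varphi,\Psi)$ is admissible, $\nu\in\mathcal{P}_{\mathrm{ac}}(M,\omega)$, $\mathrm{Hess}\,H_\varphi\ge K$ for some $K>0$, and that $\|\sigma\|_\infty<\infty$. Fix arbitrary $\xi_0\ge\max\{1,\|\sigma\|_\infty\}$. (i) If $\theta_\varphi<1$ and $\delta_\varphi>0$, then for any $r>0$ $$\alpha(r)^{-1}\ge\left\{\frac{\delta_\varphi(1-\theta_\varphi)}{(1-\delta_\varphi)(2-\delta_\varphi)}\right\}^{1/(1-\delta_\varphi)}\cdot e_{2-\delta_\varphi}\!\left(\frac K4\xi_0^{\delta_\varphi-1}r^2\right).$$ (ii) If $\theta_\varphi\in(1,3/2)$, $\delta_\varphi>3(\theta_\varphi-1)$ and $\omega[M]<\infty$, then for any $r>0$ $$\alpha(r)\le\left\{\frac{(\theta_\varphi-1)(3-3\theta_\varphi+\delta_\varphi)}{2\theta_\varphi-\delta_\varphi-1}\right\}^{1/(1-2\theta_\varphi+\delta_\varphi)}\times e_{2(1-\theta_\varphi)+\delta_\varphi}\!\left(-\frac K2\,\frac{\theta_\varphi-1}{(2-\theta_\varphi)(3\theta_\varphi-\delta_\varphi-2)}\,\xi_0^{\delta_\varphi-\theta_\varphi}\,\omega[M]^{1-\theta_\varphi}\,r^2\right).$$ (iii) If $\theta_\varphi=1$ and $\delta_\varphi>1/2$, then for any $r>0$ $$\alpha(r)^{-1}\ge e_{3-2\delta_\varphi}\!\left(\frac{-2}{3-2\delta_\varphi}\right)\cdot e_{3-2\delta_\varphi}\!\left(\frac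 K4\xi_0^{\delta_\varphi-1}r^2\right).$$
   Context: Setting: $(M,g)$ is an $n$-dimensional complete connected Riemannian manifold without boundary, $n\ge 2$, with distance $d_g$; $\omega=e^{-f}\mathrm{vol}_g$ with $f\in C^\infty(M)$. Functions of $\varphi$: $\varphi:(0,\infty)\to(0,\infty)$ is non-decreasing, positive, continuous. $\ln_\varphi(t)=\int_1^t \varphi(s)^{-1}ds$, $l_\varphi=\inf_{t>0}\ln_\varphi(t)$, $L_\varphi=\sup_{t>0}\ln_\varphi(t)$; $\exp_\varphi(\tau)=0$ if $\tau\le l_\varphi$, $=\ln_\varphi^{-1}(\tau)$ if $l_\varphi<\tau<L_\varphi$, $=\infty$ if $\tau\ge L_\varphi$; $u_\varphi(r)=\int_0^r\ln_\varphi(t)\,dt$ for $r\ge0$; $\theta_\varphi$ and $\delta_\varphi$ are respectively the supremum and the infimum over $s>0$ of $\frac{s}{\varphi(s)}\limsup_{t\downarrow0}\frac{\varphi(s+t)-\varphi(s)}{t}$; $N_\varphi=(\theta_\varphi-1)^{-1}$ if $\theta_\varphi\ne1$ and $N_\varphi=\infty$ if $\theta_\varphi=1$. For $\varphi_m(s)=s^{2-m}$, $m\in(0,2]$: $L_m:=L_{\varphi_m}$, and $e_m:=\exp_{\varphi_m}$, i.e. $e_1=\exp$ and $e_m(\tau)=[1+(m-1)\tau]_+^{1/(m-1)}$ for $m\ne1$ ($[t]_+=\max\{t,0\}$, $0^a=\infty$ for $a<0$). Reference measure: $\Psi\in C(M)$, $\sigma:=\exp_\varphi(-\Psi)$, $\nu:=\sigma\omega$;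 $M^\Psi_\varphi:=\Psi^{-1}((-L_\varphi,-l_\varphi))$. Admissibility: $(M,\omega,\varphi,\Psi)$ is admissible if (1) $\varphi(1)=1$; (2) $N_\varphi\in(-\infty,-1]\cup[n,\infty]$ and $N_\varphi\ne2$ (equivalently $\theta_\varphi\in[0,(n+1)/n]$ and $\theta_\varphi<3/2$); (3) $\Psi>-L_{2-\theta_\varphi}$ on $M$ and $M^\Psi_\varphi\ne\emptyset$; (4) $h_\varphi(\sigma)\in L^1(M,\omega)$ and $\sigma\ln_\varphi(\sigma)\in L^1(M,\omega)$, where $h_\varphi(r):=u_\varphi(r)$ if $L_\varphi=\infty$ and $h_\varphi(r):=u_\varphi(r)-rL_\varphi$ if $L_\varphi<\infty$. $\varphi$-relative entropy: put $h'_\varphi(\infty)=\infty$ if $L_\varphi=\infty$ and $0$ if $L_\varphi<\infty$; on $M\setminus M^\Psi_\varphi$ put $h'_\varphi(\sigma):=l_\varphi$ if $L_\varphi=\infty$ and $h'_\varphi(\sigma):=l_\varphi-L_\varphi$ if $L_\varphi<\infty$. For a Borel probability measure $\mu=\rho\omega+\mu^s$ (Lebesgue decomposition with respect to $\omega$), $H_\varphi(\mu)=\int_M h_\varphi(\rho)\,d\omega-\int_M h'_\varphi(\sigma)\,d\mu+h'_\varphi(\infty)\mu^s[M]$ (with $\infty\cdot0=0$) if $h_\varphi(\rho)\in L^1(M,\omega)$ and $h'_\varphi(\sigma)\in L^1(M,\mu)$, and $H_\varphi(\mu)=\infty$ otherwise. $\mathrm{Hess}\,H_\varphi\ge K$ means: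 any $\mu_0,\mu_1\in\mathcal{P}^2(M)$ (Borel probability measures with finite second moment, with $L^2$-Wasserstein distance $W_2$) are joined by a minimal $W_2$-geodesic $(\mu_t)_{t\in[0,1]}$ with $H_\varphi(\mu_t)\le(1-t)H_\varphi(\mu_0)+tH_\varphi(\mu_1)-\frac K2(1-t)tW_2(\mu_0,\mu_1)^2$ for all $t\in[0,1]$. $\mathcal{P}_{\mathrm{ac}}(M,\omega)$ is the set of Borel probability measures absolutely continuous with respect to $\omega$. Concentration function: $\alpha(r)=\alpha_{(M,\nu)}(r):=\sup\{1-\nu[B(A,r)]\mid A\subset M\text{ measurable},\ \nu[A]\ge1/2\}$ for $r>0$, where $B(A,r)=\{y\in M\mid\inf_{x\in A}d_g(x,y)<r\}$; $\alpha(r)^{-1}=\infty$ if $\alpha(r)=0$. *)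

(* Defs.v *)
From mathcomp Require Import all_boot all_order all_algebra.
From mathcomp Require Import all_classical all_reals all_analysis.

Set Implicit Arguments.
Unset Strict Implicit.
Unset Printing Implicit Defensive.

Import Order.TTheory GRing.Theory Num.Theory.
Import numFieldNormedType.Exports.

Local Open Scope classical_set_scope.
Local Open Scope ring_scope.

(* Borel sigma-algebra.  Points are needed because measurable types are
   pointed in the library. *)
Definition borel (T : ptopologicalType) := g_sigma_algebraType (@open T).

Section RiemannianManifolds.
Context {R : realType}.

(* All iterated directional derivatives of [f] exist and are continuous at
   every point of [U]; for [U] open this is the class C^oo on [U]. *)
Definition smooth_on {V W : normedModType R} (U : set V) (f : V -> W) : Prop :=
  forall (vs : seq V) (p : V), U p ->
    let g := foldr (fun v (h : V -> W) => fun q => 'D_v h q) f vs in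
    {for p, continuous g} /\ forall v, derivable g p v.

(* A Riemannian metric on a (boundaryless) n-manifold, presented by a smooth
   atlas of charts onto open subsets of R^n and by the Gram matrices of the
   metric in the charts.  Vectors of R^n are row vectors, so that the metric in
   the chart [i] is (u, v) |-> u *m gram i p *m v^T, and the transition law
   reads J *m gram j *m J^T with J the (row convention) jacobian. *)
Record riemannianStructure (n : nat) (M : ptopologicalType) := {
  chart_index : Type ;
  dom : chart_index -> set M ;
  chart : chart_index -> M -> 'rV[R]_n ;
  chart_inv : chart_index -> 'rV[R]_n -> M ;
  chart_at : M -> chart_index ;
  gram : chart_index -> 'rV[R]_n -> 'M[R]_n ;
  chart_atP : forall x, dom (chart_at x) x ;
  open_dom : forall i, open (dom i) ;
  open_codom : forall i, open (chart i @` dom i) ;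
  chartK : forall i x, dom i x -> chart_inv i (chart i x) = x ;
  chart_continuous : forall i x, dom i x -> {for x, continuous (chart i)} ;
  chart_inv_continuous : forall i p, (chart i @` dom i) p ->
    {for p, continuous (chart_inv i)} ;
  transition_smooth : forall i j,
    smooth_on (chart i @` (dom i `&` dom j)) (chart j \o chart_inv i) ;
  gram_smooth : forall i, smooth_on (chart i @` dom i) (gram i) ;
  gram_sym : forall i p, (chart i @` dom i) p -> (gram i p)^T = gram i p ;
  gram_pos : forall i p, (chart i @` dom i) p ->
    forall v : 'rV[R]_n, v != 0 -> 0 < (v *m gram i p *m v^T) 0 0 ;
  gram_transition : forall i j x, dom i x -> dom j x ->
    let J := jacobian (chart j \o chart_inv i) (chart i x) in
    gram i (chart i x) = J *m gram j (chart j x) *m J^T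
}.

Context {n : nat} {M : ptopologicalType} (g : riemannianStructure n M).

Definition smooth_function (f : M -> R) : Prop :=
  forall i : chart_index g, smooth_on (chart i @` dom i) (f \o chart_inv i).

Definition C1_curve (c : R -> M) : Prop :=
  continuous c /\
  forall (t : R) (i : chart_index g), dom i (c t) ->
    derivable (chart i \o c) t 1 /\
    {for t, continuous (derive1 (chart i \o c))}.

Definition speed (c : R -> M) (t : R) : R :=
  let i := chart_at g (c t) in
  let v := derive1 (chart i \o c) t in
  Num.sqrt ((v *m gram i (chart i (c t)) *m v^T) 0 0).

(* A piecewise C^1 curve is a list of C^1 curves, each of them run on [0, 1],
   with matching end points.  Taking the pieces to be C^1 on all of R is no
   restriction: a C^1 curve on [0, 1] extends to R. *)
Fixpoint joins (x y : M) (cs : seq (R -> M)) : Prop :=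
  match cs with
  | [::] => x = y
  | c :: cs' => [/\ C1_curve c, c 0 = x & joins (c 1) y cs']
  end.

Local Open Scope ereal_scope.

Definition curve_length (cs : seq (R -> M)) : \bar R :=
  \sum_(c <- cs) \int[lebesgue_measure]_(t in `[0%R, 1%R]) (speed c t)%:E.

Definition dist (x y : M) : \bar R :=
  ereal_inf [set curve_length cs | cs in joins x y].

Definition riemannian_complete : Prop :=
  forall u : nat -> M,
    (forall e : R, (0 < e)%R -> exists N : nat, forall i j : nat,
        (N <= i)%N -> (N <= j)%N -> dist (u i) (u j) < e%:E) ->
    exists x : M, u @ \oo --> x.

Definition complete_connected_manifold : Prop :=
  [/\ hausdorff_space M, @second_countable M, connected [set: M]
    & riemannian_complete].

Definition is_lebesgue_measure
    (lam : {measure set (borel 'rV[R]_n) -> \bar R}) : Prop :=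
  forall a b : 'rV[R]_n, (forall i, a ord0 i <= b ord0 i)%R ->
    lam [set p | forall i, (a ord0 i <= p ord0 i <= b ord0 i)%R] =
    (\prod_(i < n) (b ord0 i - a ord0 i))%:E.

Definition is_riemannian_volume
    (vol : {measure set (borel M) -> \bar R}) : Prop :=
  exists2 lam : {measure set (borel 'rV[R]_n) -> \bar R},
    is_lebesgue_measure lam &
    forall (i : chart_index g) (A : set (borel M)),
      measurable A -> A `<=` dom i ->
      vol A = \int[lam]_(p in (chart i @` A : set (borel 'rV[R]_n)))
                 (Num.sqrt (\det (gram i p)))%:E.

(* nu = w mu *)
Definition has_density (mu nu : {measure set (borel M) -> \bar R})
    (w : M -> \bar R) : Prop :=
  forall A : set (borel M), measurable A -> nu A = \int[mu]_(x in A) w x.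

(* B(A, r) *)
Definition nbhd (A : set M) (r : R) : set M :=
  [set y | ereal_inf [set dist x y | x in A] < r%:E].

Definition concentration (nu : probability (borel M) R) (r : R) : \bar R :=
  ereal_sup [set 1 - nu (nbhd A r) |
             A in [set A : set (borel M) | measurable A /\ (2^-1)%:E <= nu A]].

Definition finite_second_moment (mu : probability (borel M) R) : Prop :=
  exists x0 : M, \int[mu]_x (dist x0 x ^+ 2) < +oo.

Definition coupling (mu0 mu1 : probability (borel M) R)
    (pi : probability (borel M * borel M)%type R) : Prop :=
  forall A : set (borel M), measurable A ->
    pi (A `*` setT) = mu0 A /\ pi (setT `*` A) = mu1 A.

Definition W2 (mu0 mu1 : probability (borel M) R) : \bar R :=
  sqrte (ereal_inf [set \int[pi]_z (dist z.1 z.2 ^+ 2) |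
                    pi in coupling mu0 mu1]).

(* Measures are compared on measurable sets only, their values on the other
   sets being meaningless. *)
Definition minimal_geodesic (mu0 mu1 : probability (borel M) R)
    (mu : R -> probability (borel M) R) : Prop :=
  [/\ forall A : set (borel M), measurable A -> mu 0%R A = mu0 A,
      forall A : set (borel M), measurable A -> mu 1%R A = mu1 A,
      forall t : R, (0 <= t <= 1)%R -> finite_second_moment (mu t) &
      forall s t : R, (0 <= s <= 1)%R -> (0 <= t <= 1)%R ->
        W2 (mu s) (mu t) = `|s - t|%:E * W2 mu0 mu1].

Definition Hess_ge (H : probability (borel M) R -> \bar R) (K : R) : Prop :=
  forall mu0 mu1 : probability (borel M) R,
    finite_second_moment mu0 -> finite_second_moment mu1 ->
    exists2 mu : R -> probability (borel M) R,
      minimal_geodesic mu0 mu1 mu &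
      forall t : R, (0 <= t <= 1)%R ->
        H (mu t) <= (1 - t)%:E * H mu0 + t%:E * H mu1
                    - (K / 2 * (1 - t) * t)%:E * W2 mu0 mu1 ^+ 2.

End RiemannianManifolds.

Section PhiFunctions.
Context {R : realType}.
Implicit Types (phi : R -> R) (m r s t tau : R).

(* Only the restriction of [phi] to (0, oo) is relevant. *)
Definition phi_function phi : Prop :=
  [/\ forall s, 0 < s -> 0 < phi s,
      forall s t, 0 < s -> s <= t -> phi s <= phi t &
      forall s, 0 < s -> {for s, continuous phi}].

Definition ln_phi phi t : R :=
  if 1 <= t then \int[lebesgue_measure]_(s in `[1, t]) (phi s)^-1
  else - \int[lebesgue_measure]_(s in `[t, 1]) (phi s)^-1.

Definition l_phi phi : \bar R :=
  ereal_inf [set (ln_phi phi t)%:E | t in `]0, +oo[].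

Definition L_phi phi : \bar R :=
  ereal_sup [set (ln_phi phi t)%:E | t in `]0, +oo[].

Definition exp_phi phi tau : \bar R :=
  if (tau%:E <= l_phi phi)%E then 0%E
  else if (tau%:E < L_phi phi)%E
       then ('pinv_(fun=> 1) `]0, +oo[ (ln_phi phi) tau)%:E
       else +oo%E.

(* The integral converges as soon as theta_phi < 2, hence in the admissible
   case; [u_phi] is only meaningful then. *)
Definition u_phi phi r : R :=
  \int[lebesgue_measure]_(t in `[0, r]) ln_phi phi t.

Definition dini_ratio phi s : \bar R :=
  ((s / phi s)%:E *
   limf_esup (fun t : R => ((phi (s + t) - phi s) / t)%:E) (0^'+))%E.

Definition theta_phi phi : \bar R :=
  ereal_sup [set dini_ratio phi s | s in `]0, +oo[].

Definition delta_phi phi : \bar R :=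
  ereal_inf [set dini_ratio phi s | s in `]0, +oo[].

Definition N_phi phi : \bar R :=
  if theta_phi phi == 1%E then +oo%E else ((theta_phi phi - 1)^-1)%E.

Definition phi_m m s : R := s `^ (2 - m).

Definition e_m m : R -> \bar R := exp_phi (phi_m m).

Definition h_phi phi r : R :=
  if L_phi phi == +oo%E then u_phi phi r
  else u_phi phi r - r * fine (L_phi phi).

(* h'_phi(oo) *)
Definition dh_phi_oo phi : \bar R := if L_phi phi == +oo%E then +oo%E else 0%E.

End PhiFunctions.

Section RelativeEntropy.
Context {R : realType} {M : ptopologicalType}.
Implicit Types (phi : R -> R) (Psi : M -> R) (x : M).
Implicit Types (omega : {measure set (borel M) -> \bar R})
  (mu : probability (borel M) R).

Local Open Scope ereal_scope.

(* sigma is finite everywhere when Psi > - L_phi, in particular in the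
   admissible case, so that [fine (sigma phi Psi x)] below loses nothing. *)
Definition sigma phi Psi x : \bar R := exp_phi phi (- Psi x)%R.

Definition Mpsi phi Psi : set M :=
  [set x | - L_phi phi < (Psi x)%:E < - l_phi phi].

Definition admissible (n : nat) omega phi Psi : Prop :=
  let sig x := fine (sigma phi Psi x) in
  [/\ phi 1%R = 1%R,
      [/\ -oo < N_phi phi <= (-1)%:E \/ n%:R%:E <= N_phi phi
        & N_phi phi != 2%:R%:E],
      (forall x, - L_phi (phi_m (2 - fine (theta_phi phi))) < (Psi x)%:E)
        /\ Mpsi phi Psi !=set0,
      omega.-integrable setT (fun x => (h_phi phi (sig x))%:E) &
      omega.-integrable setT (fun x => (sig x * ln_phi phi (sig x))%:E)].

(* h'_phi(sigma), with its conventional value outside M^Psi_phi *)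
Definition dh_sigma phi Psi x : \bar R :=
  if x \in Mpsi phi Psi then (derive1 (h_phi phi) (fine (sigma phi Psi x)))%:E
  else if L_phi phi == +oo then l_phi phi else l_phi phi - L_phi phi.

Definition lebesgue_decomposition omega mu (rho : M -> R)
    (mus : {measure set (borel M) -> \bar R}) : Prop :=
  [/\ measurable_fun setT (rho : borel M -> R),
      forall x, (0 <= rho x)%R,
      exists N : set (borel M),
        [/\ measurable N, omega N = 0 & mus (~` N) = 0] &
      forall A : set (borel M), measurable A ->
        mu A = \int[omega]_(x in A) (rho x)%:E + mus A].

(* The Lebesgue decomposition of [mu] is unique (up to omega-null sets), so the
   value selected by [xget] does not depend on the choice. *)
Definition relative_entropy omega phi Psi mu : \bar R :=
  xget +oo [set v | exists (rho : M -> R)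
                      (mus : {measure set (borel M) -> \bar R}),
    lebesgue_decomposition omega mu rho mus /\
    v = if `[< omega.-integrable setT (fun x => (h_phi phi (rho x))%:E) /\
               mu.-integrable setT (dh_sigma phi Psi) >]
        then \int[omega]_x (h_phi phi (rho x))%:E
             - \int[mu]_x dh_sigma phi Psi x
             + dh_phi_oo phi * mus setT
        else +oo].

End RelativeEntropy.

(* Main.v *)
(* Let A have nu-measure a >= 1/2, let B be the complement of its
   r-neighbourhood and b = nu B. The conditional measures nu_A and nu_B satisfy
   W_2(nu_A, nu_B) >= r, and nu minimises H_phi by Young's inequality for the
   convex function u_phi, so that convexity of H_phi at time 1/2 bounds
   K r^2 / 4 by the sum of the excess entropies of nu_A and nu_B (the sets being
   first cut down to large balls, for the second moments to be finite). The
   exponents theta and delta compare phi with powers; this bounds the excess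
   entropy of nu conditioned on E by a factor depending on nu E times integrals
   of sigma^2 / phi(sigma), which are controlled by xi0 and, when theta > 1, by
   omega[M]. What remains is an elementary inequality between r and b, in which
   the contribution of a is bounded. *)

Require Import Defs.
From mathcomp Require Import all_boot all_order all_algebra.
From mathcomp Require Import all_classical all_reals all_analysis.
From HB Require Import structures.
From mathcomp Require Import measurable_realfun ess_sup_inf ring lra.

Set Implicit Arguments.
Unset Strict Implicit.
Unset Printing Implicit Defensive.

Import Order.TTheory GRing.Theory Num.Theory.
Import numFieldNormedType.Exports.

Local Open Scope classical_set_scope.
Local Open Scope ring_scope.

(** * Curves in charts and the Riemannian distance *)

(** The midpoint of the Wasserstein geodesic is unknown and may be singular, so minimality of the
    entropy is established for every probability measure: a singular part either makes the entropy
    infinite or, when [L_phi] is finite, can only raise it, because h'_phi(sigma) <= 0. The shift by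
    [L_phi] cancels: a density rho has entropy the integral of u(rho) - rho ln sigma, where [l_phi],
    then finite, stands for ln sigma at the zeros of sigma. The split at theta = 1 comes from small
    sigma, where sigma^2 / phi(sigma) is at most sigma^(2 - theta). For theta <= 1 this is at most
    sigma, whose integral over E is nu E. For theta > 1 it is the concave power sigma^(1 - eps) with
    eps = theta - 1, and the passage to nu E costs omega[M]^eps. The geometry enters through open
    balls, the triangle inequality and finite distances; these rest on length bounds for straight
    segments in charts. *)

Lemma is_derive_line (R : realType) (V W : normedModType R) (f : V -> W) (q v : V) (s : R) :
  derivable f (q + s *: v) v ->
  is_derive s 1 (fun s : R => f (q + s *: v)) ('D_v f (q + s *: v)).
Proof.
move=> df.
have E : (fun h : R => h^-1 *: (((fun s : R => f (q + s *: v)) \o shift s) (h *: 1) - f (q + s *: v)))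
     = (fun h : R => h^-1 *: ((f \o shift (q + s *: v)) (h *: v) - f (q + s *: v))).
  apply/funext => h /=; congr (_ *: (f _ - _)).
  by rewrite scalerDl [h%:A]mulr1 addrCA.
split; first by rewrite /derivable E.
by rewrite /derive E.
Qed.

Lemma line_mvt (R : realType) (V : normedModType R) (f : V -> R) (q v : V) (t L e : R) :
  (forall s : R, `|s| <= `|t| -> derivable f (q + s *: v) v /\ `|'D_v f (q + s *: v) - L| <= e) ->
  `|f (q + t *: v) - f q - t * L| <= `|t| * e.
Proof.
move=> H.
set F := fun s : R => f (q + s *: v).
have dF (s : R) : `|s| <= `|t| -> is_derive s 1 F ('D_v f (q + s *: v)).
  by move=> /H[/is_derive_line].
have cF (s : R) : `|s| <= `|t| -> {for s, continuous F}.
  by move=> /dF ?; apply/differentiable_continuous/derivable1_diffP.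
have -> : f q = F 0 by rewrite /F scale0r addr0.
have [t0|t0] := leP 0 t.
  have [||c cI ->] := @MVT_segment R F (fun s => 'D_v f (q + s *: v)) 0 t t0.
  - by move=> x /[!in_itv]/= /andP[x0 xt]; apply: dF; rewrite !ger0_norm// ltW.
  - apply: continuous_in_subspaceT => x /[!inE]/= /[!in_itv]/= /andP[x0 xt].
    by apply: cF; rewrite !ger0_norm.
  rewrite subr0 mulrC -mulrBr normrM ler_wpM2l//.
  move: cI; rewrite in_itv/= => /andP[c0 ct].
  by apply: (H _ _).2; rewrite !ger0_norm.
have [||c cI E] := @MVT_segment R F (fun s => 'D_v f (q + s *: v)) t 0 (ltW t0).
- move=> x /[!in_itv]/= /andP[x0 xt]; apply: dF.
  by rewrite !ler0_norm ?lerN2// ltW.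
- apply: continuous_in_subspaceT => x /[!inE]/= /[!in_itv]/= /andP[x0 xt].
  by apply: cF; rewrite !ler0_norm ?lerN2// ltW.
have -> : F t - F 0 = 'D_v f (q + c *: v) * t.
  by rewrite -[LHS]opprB E sub0r mulrN opprK.
rewrite mulrC -mulrBr normrM ler_wpM2l//.
move: cI; rewrite in_itv/= => /andP[c0 ct].
by apply: (H _ _).2; rewrite !ler0_norm ?lerN2// ltW.
Qed.

Lemma mulmxr_continuous (R : realType) n m (J : 'M[R]_(n, m)) :
  continuous (fun h : 'rV[R]_n => h *m J).
Proof.
move=> h; apply/(@cvgrPdist_le _ _ _ (nbhs h) (nbhs_filter h)) => /= e e0.
pose S := \sum_(jl : 'I_n * 'I_m) `|J jl.1 jl.2|.
have S0 : 0 <= S by exact: sumr_ge0.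
near=> k.
have hk : `|h - k| <= e / (S + 1).
  near: k; have /cvgrPdist_le : (fun k : 'rV[R]_n => k) @ h --> h by exact: cvg_id.
  by apply; rewrite divr_gt0// ltr_wpDl.
rewrite -mulmxBl /Num.Def.normr/= mx_normrE; apply: bigmax_le; first exact: ltW.
move=> [i j] _ /=; rewrite ord1 mxE.
apply: le_trans (ler_norm_sum _ _ _) _.
apply: (@le_trans _ _ (\sum_(j0 < n) `|h - k| * `|J j0 j|)).
  apply: ler_sum => l _; rewrite normrM ler_wpM2r//.
  rewrite [leRHS]/Num.Def.normr/= mx_normrE.
  exact: (le_bigmax _ (fun i : 'I_1 * 'I_n => `|(h - k) i.1 i.2|) (0, l)).
rewrite -mulr_sumr.
apply: (@le_trans _ _ (`|h - k| * S)).
  rewrite ler_wpM2l// /S.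
  rewrite -(pair_bigA _ (fun i j => `|J i j|))/=.
  apply: ler_sum => l _; rewrite (bigD1 j)//= lerDl.
  exact: sumr_ge0.
apply: le_trans (ler_wpM2r S0 hk) _.
by rewrite mulrAC ler_pdivrMr ?ltr_wpDl// ler_wpM2l// ?ltW// ltrDl.
Unshelve. all: by end_near. Qed.

Lemma rV_norm_le (R : realType) n (h : 'rV[R]_n) (e : R) : 0 <= e ->
  (forall j, `|h ord0 j| <= e) -> `|h| <= e.
Proof.
move=> e0 H; rewrite /Num.Def.normr/= mx_normrE; apply: bigmax_le => //.
by move=> [i j] _ /=; rewrite ord1.
Qed.

Lemma mx_coord_le (R : realType) m n (A : 'M[R]_(m, n)) i j : `|A i j| <= `|A|.
Proof.
rewrite [leRHS]/Num.Def.normr/= mx_normrE.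
exact: (le_bigmax _ (fun i : 'I_m * 'I_n => `|A i.1 i.2|) (i, j)).
Qed.

Lemma rV_ballE (R : realType) n (p q : 'rV[R]_n) (e : R) : ball p e q = (`|p - q| < e) :> Prop.
Proof. by rewrite -ball_normE. Qed.

(* Telescoping along the coordinate axes reduces to the one-variable mean
   value theorem. *)
Lemma C1_differentiable (R : realType) n m (F : 'rV[R]_n -> 'rV[R]_m) (p : 'rV[R]_n) :
  (\forall q \near p, forall v, derivable F q v) ->
  (forall v, {for p, continuous ('D_v F)}) -> differentiable F p.
Proof.
move=> dF cF.
pose e_ (j : 'I_n) : 'rV[R]_n := delta_mx ord0 j.
pose J : 'M[R]_(n, m) := \matrix_(j, k) 'D_(e_ j) F p ord0 k.
pose df : {linear 'rV[R]_n -> 'rV[R]_m} := mulmxr J.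
have dfc : continuous df by exact: mulmxr_continuous.
suff E : F \o shift p = cst (F p) + df +o_ (0 : 'rV[R]_n) id.
  by apply: (diff_locallyP p F).2; rewrite (diff_unique dfc E).
apply/eqaddoP => _/posnumP[e].
(* Each of the [n] axis steps contributes at most e' |h|; dividing by [n.+1] keeps [e'] meaningful
   when [n = 0]. *)
pose e' : R := e%:num / n.+1%:R.
have e'0 : 0 < e' by rewrite divr_gt0.
have [d /= d0 Hd] : exists2 d : R, 0 < d & forall q, `|q - p| < d ->
    (forall v, derivable F q v) /\ forall j, `|'D_(e_ j) F q - 'D_(e_ j) F p| <= e'.
  have /nbhs_ballP[d /= d0 Hd] : \forall q \near p, (forall v, derivable F q v) /\
      forall j, `|'D_(e_ j) F q - 'D_(e_ j) F p| <= e'.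
    have cFj : \forall q \near p, forall j, `|'D_(e_ j) F q - 'D_(e_ j) F p| <= e'.
      apply: (@filter_forall _ _ (fun j q => `|'D_(e_ j) F q - 'D_(e_ j) F p| <= e') (nbhs p) _).
      move=> j; near=> q; rewrite distrC; near: q.
      have /(@cvgrPdist_le _ _ _ (nbhs p) (nbhs_filter p)) := cF (e_ j).
      by apply.
    by near=> q; split; near: q.
  exists d; first exact: d0.
  by move=> q qp; apply: Hd; rewrite rV_ballE distrC.
have nd : \forall h \near (0 : 'rV[R]_n), `|h| < d.
  apply/nbhs_ballP; exists d; first exact: d0.
  by move=> h; rewrite rV_ballE sub0r normrN.
near=> h => /=.
rewrite -[X in `|X|]/(F (h + p) - (F p + h *m J)).
have hd : `|h| < d by near: h.
pose tr k : 'rV[R]_n := \row_j (if (j < k)%N then h ord0 j else 0).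
have trS (k : 'I_n) : tr k.+1 = tr k + h ord0 k *: e_ k.
  apply/rowP => j; rewrite !mxE /=; have [->|jk] := eqVneq j k.
    by rewrite /= ltnn leqnn add0r mulr1.
  have -> : (j < k.+1)%N = (j < k)%N.
    by rewrite ltnS leq_eqVlt; case: eqP => // E; case/eqP: jk; exact: val_inj.
  by rewrite ?eqxx /= mulr0 addr0.
(* The norm is the maximum of the entries, so every point of the axis-parallel path from 0 to [h]
   has norm at most |h| and stays in the ball where the derivatives are controlled. *)
have trle k (s : R) i : `|s| <= `|h ord0 i| -> (k <= i)%N -> `|tr k + s *: e_ i| <= `|h|.
  move=> si ki; apply: rV_norm_le => // j; rewrite !mxE /=.
  case: ifPn => jk.
    rewrite -[j == i]val_eqE ltn_eqF ?mulr0 ?addr0 ?mx_coord_le//.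
    exact: leq_trans jk ki.
  rewrite add0r; case: eqVneq => _; last by rewrite mulr0 normr0.
  by rewrite mulr1 (le_trans si) ?mx_coord_le.
have step (k : 'I_n) : `|F (p + tr k.+1) - F (p + tr k) - h ord0 k *: 'D_(e_ k) F p|
    <= e' * `|h|.
  have H1 (s : R) : `|s| <= `|h ord0 k| -> `|tr k + s *: e_ k + p - p| < d.
    by move=> sk; rewrite addrK (le_lt_trans _ hd)// trle.
  apply: rV_norm_le => [|l]; first by rewrite mulr_ge0// ltW.
  rewrite !mxE.
  have := @line_mvt R _ (fun q => F q ord0 l) (p + tr k) (e_ k) (h ord0 k)
     ('D_(e_ k) F p ord0 l) e'.
  rewrite -(addrA p (tr k) (h ord0 k *: e_ k)) -trS => /(_ _)/le_trans; apply.
    move=> s sk; have := Hd _ (H1 _ sk).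
    rewrite (addrC _ p) addrA => -[D1 /(_ k) D2].
    split; first exact: (derivable_mxP _ _ _).1 (D1 (e_ k)) ord0 l.
    have := derive_mx (D1 (e_ k)) => /matrixP/(_ ord0 l); rewrite mxE => <-.
    apply: le_trans D2; apply: le_trans (mx_coord_le _ ord0 l); by rewrite !mxE.
  by rewrite mulrC ler_wpM2l ?(ltW e'0)// mx_coord_le.
have sumE : F (h + p) - F p - h *m J =
    \sum_(k < n) (F (p + tr k.+1) - F (p + tr k) - h ord0 k *: 'D_(e_ k) F p).
  rewrite sumrB; congr (_ - _).
    rewrite -(big_mkord xpredT (fun k => F (p + tr k.+1) - F (p + tr k))).
    rewrite (telescope_sumr (fun k => F (p + tr k)) (leq0n n)).
    have -> : tr n = h by apply/rowP => j; rewrite !mxE ltn_ord.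
    have -> : tr 0%N = 0 by apply/rowP => j; rewrite !mxE.
    by rewrite addr0 (addrC h p).
  apply/rowP => l; rewrite !mxE summxE; apply: eq_bigr => k _.
  by rewrite !mxE.
rewrite opprD addrA sumE (le_trans (ler_norm_sum _ _ _))//.
apply: (@le_trans _ _ (\sum_(k < n) (e' * `|h|))); first exact: ler_sum.
rewrite sumr_const card_ord -mulr_natr mulrAC ler_wpM2r// /e'.
by rewrite mulrAC ler_pdivrMr// ler_wpM2l// ler_nat.
Unshelve. all: by end_near. Qed.

Lemma is_derive_comp_vector (R : realType) (W : normedModType R) (G : R -> W) (f : R -> R)
    (x a : R) (b : W) :
  is_derive (f x) 1 G b -> is_derive x 1 f a -> is_derive x 1 (G \o f) (a *: b).
Proof.
move=> [dG eG] [df ef].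
have DG := (derivable1_diffP _ _).1 dG; have Df := (derivable1_diffP _ _).1 df.
have D : differentiable (G \o f) x by exact: differentiable_comp.
split; first exact/derivable1_diffP.
rewrite [LHS]deriveE// diff_comp//= -(deriveE _ Df) ef -[a]mulr1.
by rewrite [LHS]linearZ/= -(deriveE _ DG) eG mulr1.
Qed.

Section SegmentCurve.
Context {R : realType} {n : nat} {M : ptopologicalType}.
Variable g : riemannianStructure (R := R) n M.

Lemma chart_inv_dom (i : chart_index g) q : (chart i @` dom i) q ->
  dom i (chart_inv i q) /\ chart i (chart_inv i q) = q.
Proof. by move=> [x xi <-]; rewrite chartK. Qed.

Lemma chart_overlap_nbhs (i j : chart_index g) q : (chart i @` dom i) q ->
  dom j (chart_inv i q) -> nbhs q (chart i @` (dom i `&` dom j)).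
Proof.
move=> qi qj.
have N1 : nbhs q (chart i @` dom i).
  by apply: open_nbhs_nbhs; split=> //; exact: open_codom.
have N2 : nbhs q (chart_inv i @^-1` dom j).
  apply: (chart_inv_continuous qi); apply: open_nbhs_nbhs; split=> //; exact: open_dom.
apply: filterS (filterI N1 N2) => q' [/chart_inv_dom[q1 q2] q3].
by exists (chart_inv i q').
Qed.

(* Composing with [ramp], which maps R into [0, 1], turns a segment of a chart
   into a C^1 curve defined on R. *)
Definition ramp (t : R) : R := sin (pi / 2 * t) ^+ 2.

Definition dramp (t : R) : R := pi * (sin (pi / 2 * t) * cos (pi / 2 * t)).

Lemma ramp01 t : 0 <= ramp t <= 1.
Proof.
rewrite /ramp sqr_ge0 /=; have := cos2Dsin2 (pi / 2 * t).
by have := sqr_ge0 (cos (pi / 2 * t)); lra.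
Qed.

Lemma is_derive_ramp (t : R) : is_derive t 1 ramp (dramp t).
Proof.
apply: is_derive_eq; rewrite /dramp /=.
have -> : ((pi / 2)%:A : R) = pi / 2 by rewrite -[LHS]/(pi / 2 * 1) mulr1.
set s := sin _; set c := cos _.
by rewrite -[LHS]/(s * (c * (pi / 2)) + s * (c * (pi / 2))); field.
Qed.

Lemma dramp_continuous : continuous dramp.
Proof.
move=> t; apply: cvgMr; apply: cvgM; (apply: continuous_comp; first exact: mulrl_continuous).
  exact: continuous_sin.
exact: continuous_cos.
Qed.

Lemma dramp_le t : `|dramp t| <= pi.
Proof.
have ps := pi_ge0 R.
rewrite /dramp normrM (ger0_norm ps) ler_piMr// normrM.
by rewrite mulr_ile1// ler_norml ?sin_geN1 ?sin_le1 ?cos_geN1 ?cos_le1.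
Qed.

Definition segment_curve (i : chart_index g) (p v : 'rV[R]_n) (t : R) : M :=
  chart_inv i (p + ramp t *: v).

Lemma ramp_line_continuous (p v : 'rV[R]_n) : continuous (fun t => p + ramp t *: v).
Proof.
move=> t; apply: cvgD; first exact: cvg_cst.
apply: cvgZr_tmp; apply/differentiable_continuous/derivable1_diffP.
by case: (is_derive_ramp t).
Qed.

Lemma is_derive_ramp_line (F : 'rV[R]_n -> 'rV[R]_n) p v (t : R) :
  derivable F (p + ramp t *: v) v ->
  is_derive t 1 (fun t => F (p + ramp t *: v)) (dramp t *: 'D_v F (p + ramp t *: v)).
Proof.
move=> dF.
exact: (@is_derive_comp_vector R _ (fun s => F (p + s *: v)) ramp t _ _
  (is_derive_line dF) (is_derive_ramp t)).
Qed.

Section curve.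
Variables (i : chart_index g) (p v : 'rV[R]_n).
Hypothesis pO : forall s, 0 <= s <= 1 -> (chart i @` dom i) (p + s *: v).

Let pt t : (chart i @` dom i) (p + ramp t *: v).
Proof. exact/pO/ramp01. Qed.

Let curve_smooth t (j : chart_index g) (tj : dom j (segment_curve i p v t)) :
  nbhs (p + ramp t *: v) (chart i @` (dom i `&` dom j)).
Proof. exact: chart_overlap_nbhs. Qed.

Let derive_chart_curve (t : R) (j : chart_index g) (tj : dom j (segment_curve i p v t)) :
  is_derive t 1 (chart j \o segment_curve i p v)
    (dramp t *: 'D_v (chart j \o chart_inv i) (p + ramp t *: v)).
Proof.
apply: (@is_derive_ramp_line (chart j \o chart_inv i)).
have := @transition_smooth _ _ _ g i j [::] _ (nbhs_singleton (curve_smooth tj)).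
by case.
Qed.

Lemma segment_curve_continuous : continuous (segment_curve i p v).
Proof.
move=> t; apply: (@continuous_comp _ _ _ (fun t => p + ramp t *: v) (chart_inv i)).
  exact: ramp_line_continuous.
exact: chart_inv_continuous.
Qed.

Lemma segment_curve_C1 : C1_curve g (segment_curve i p v).
Proof.
split=> [|t j tj]; first exact: segment_curve_continuous.
split; first by case: (derive_chart_curve tj).
have nt : \forall s \near t, dom j (segment_curve i p v s).
  apply: (@segment_curve_continuous t).
  by apply: open_nbhs_nbhs; split=> //; exact: open_dom.
have E : \forall s \near t, (dramp s *: 'D_v (chart j \o chart_inv i) (p + ramp s *: v))
     = derive1 (chart j \o segment_curve i p v) s.
  near=> s; have sj : dom j (segment_curve i p v s) by near: s.
  by rewrite derive1E; case: (derive_chart_curve sj).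
have Et := nbhs_singleton E.
suff : derive1 (chart j \o segment_curve i p v) s @[s --> t] -->
    derive1 (chart j \o segment_curve i p v) t by [].
rewrite -Et; apply: cvg_trans (near_eq_cvg E) _.
apply: cvgZ; first exact: dramp_continuous.
apply: (@continuous_comp _ _ _ (fun t => p + ramp t *: v) ('D_v (chart j \o chart_inv i))).
  exact: ramp_line_continuous.
have := @transition_smooth _ _ _ g i j [:: v] _ (nbhs_singleton (curve_smooth tj)).
by case.
Unshelve. all: by end_near. Qed.

(** [speed] reads the velocity in the chart that [chart_at] selects at the current point, which may
    vary with [t]. The transition law of the Gram matrices brings it back to the fixed chart [i].
    This law involves the jacobian, so the transition map must be differentiable and not merely have
    directional derivatives: hence [C1_differentiable]. *)
Lemma segment_curve_speed t : speed g (segment_curve i p v) t =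
  Num.sqrt (dramp t ^+ 2 * (v *m gram i (p + ramp t *: v) *m v^T) ord0 ord0).
Proof.
rewrite /speed; set x := segment_curve i p v t; set j := chart_at g x.
have xj : dom j x := chart_atP g x.
have [xi xE] := chart_inv_dom (pt t).
set F := chart j \o chart_inv i.
have dF : differentiable F (p + ramp t *: v).
  apply: C1_differentiable.
    apply: filterS (curve_smooth xj) => q qU w.
    by have := @transition_smooth _ _ _ g i j [::] _ qU => -[].
  move=> w.
  by have := @transition_smooth _ _ _ g i j [:: w] _ (nbhs_singleton (curve_smooth xj)) => -[].
have -> : derive1 (chart j \o segment_curve i p v) t = dramp t *: (v *m jacobian F (p + ramp t *: v)).
  rewrite derive1E -deriveEjacobian//.
  by case: (derive_chart_curve xj).
congr Num.sqrt.
have := gram_transition xi xj; rewrite -/(segment_curve i p v t) -/x.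
rewrite [chart i x]xE => ->; rewrite -/F.
set J := jacobian _ _.
rewrite -scalemxAl -scalemxAl linearZ/= -scalemxAr scalerA -expr2 mxE; congr (_ * _).
by rewrite trmx_mul !mulmxA.
Qed.

End curve.
End SegmentCurve.

Section Distance.
Context {R : realType} {n : nat} {M : ptopologicalType}.
Variable g : riemannianStructure (R := R) n M.
Local Open Scope ereal_scope.

Lemma speed_ge0 (c : R -> M) t : (0 <= speed g c t)%R.
Proof. by rewrite /speed; exact: sqrtr_ge0. Qed.

Lemma curve_length_ge0 (cs : seq (R -> M)) : 0 <= curve_length g cs.
Proof.
rewrite /curve_length; apply: sume_ge0 => c _.
by apply: integral_ge0 => t _; rewrite lee_fin speed_ge0.
Qed.

Lemma dist_ge0 x y : 0 <= dist g x y.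
Proof. by apply: le_ereal_inf_tmp => _ [cs _ <-]; exact: curve_length_ge0. Qed.

Lemma dist_xx x : dist g x x = 0.
Proof.
apply/eqP; rewrite eq_le dist_ge0 andbT; apply: ereal_inf_lbound.
by exists [::] => //; rewrite /curve_length big_nil.
Qed.

Lemma joins_cat (x y z : M) cs ds :
  joins g x y cs -> joins g y z ds -> joins g x z (cs ++ ds).
Proof.
elim: cs x => [x /= ->//|c cs IH x /= [c1 c2 c3] yz].
by split => //; exact: IH yz.
Qed.

Lemma dist_triangle x y z : dist g x z <= dist g x y + dist g y z.
Proof.
have [->|xy] := eqVneq (dist g x y) +oo.
  by rewrite addye ?leey// gt_eqF// (lt_le_trans _ (dist_ge0 _ _)).
have [->|yz] := eqVneq (dist g y z) +oo.
  by rewrite addey ?leey// gt_eqF// (lt_le_trans _ (dist_ge0 _ _)).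
have xyf : dist g x y \is a fin_num by rewrite ge0_fin_numE ?dist_ge0// lt_neqAle xy leey.
have yzf : dist g y z \is a fin_num by rewrite ge0_fin_numE ?dist_ge0// lt_neqAle yz leey.
apply/lee_addgt0Pr => e e0.
have e2 : (0 < e / 2)%R by rewrite divr_gt0.
have [_ [cs jcs <-] lcs] := lb_ereal_inf_adherent e2 xyf.
have [_ [ds jds <-] lds] := lb_ereal_inf_adherent e2 yzf.
apply: (@le_trans _ _ (curve_length g (cs ++ ds))).
  by apply: ereal_inf_lbound; exists (cs ++ ds) => //; exact: joins_cat jds.
rewrite /curve_length big_cat/=.
apply: le_trans (leeD (ltW lcs) (ltW lds)) _.
by rewrite addeACA -EFinD -splitr.
Qed.

(** The factor [pi] bounds the derivative of [ramp]; its value is immaterial, as the bound only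
    serves to make distances small. *)
Lemma dist_segment (i : chart_index g) (p v : 'rV[R]_n) (C : R) :
  (forall s, (0 <= s <= 1)%R -> (chart i @` dom i) (p + s *: v)%R) ->
  (forall s, (0 <= s <= 1)%R ->
     ((v *m gram i (p + s *: v) *m v^T) ord0 ord0 <= C ^+ 2)%R) -> (0 <= C)%R ->
  dist g (chart_inv i p) (chart_inv i (p + v)%R) <= (pi * C)%:E.
Proof.
move=> pO pC C0; pose c := segment_curve i p v.
apply: (@le_trans _ _ (curve_length g [:: c])).
  apply: ereal_inf_lbound; exists [:: c] => //; split.
  - exact: segment_curve_C1.
  - by rewrite /c /segment_curve /ramp mulr0 sin0 expr0n /= scale0r addr0.
  - by rewrite /= /c /segment_curve /ramp mulr1 sin_pihalf expr1n scale1r.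
rewrite /curve_length big_seq1.
have sC t : (speed g c t <= pi * C)%R.
  rewrite segment_curve_speed// -(@ger0_norm _ (pi * C)%R) ?mulr_ge0 ?pi_ge0//.
  rewrite -sqrtr_sqr ler_wsqrtr// [leRHS]exprMn.
  apply: (@le_trans _ _ (dramp t ^+ 2 * C ^+ 2)%R).
    by rewrite ler_wpM2l ?sqr_ge0// pC// ramp01.
  rewrite ler_wpM2r ?sqr_ge0//.
  by rewrite -[leLHS]real_normK ?num_real// lerXn2r ?nnegrE ?pi_ge0// dramp_le.
apply: (@le_trans _ _ (\int[lebesgue_measure]_(t in `[0%R, 1%R]) cst (pi * C)%:E t)).
  (* Monotonicity is read off the integral as a supremum over the simple functions below the
     integrand, which raises no question about the measurability of the speed. *)
  rewrite integral_mkcond [leRHS]integral_mkcond !ge0_integralTE//.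
  - apply: ereal_sup_le => _ [h hs <-]; exists h => // x; apply: le_trans (hs x) _.
    by rewrite !patchE; case: ifP => // _; rewrite lee_fin.
  - move=> x; rewrite patchE; case: ifP => // _.
    by rewrite lee_fin mulr_ge0 ?pi_ge0.
  - by move=> x; rewrite patchE; case: ifP => // _; rewrite lee_fin speed_ge0.
rewrite integral_cst//= lebesgue_measure_itv/= lte_fin ltr01.
by rewrite -EFinB subr0 mule1.
Qed.

(** Near [y] the Gram matrix of a chart stays bounded, so chart segments are short when their
    coordinate vectors are. Both directions are kept because symmetry of [dist] is never
    established; [dist_fin] uses one for openness and the other for closedness. *)
Lemma dist_near (y : M) (e : R) : (0 < e)%R ->
  \forall z \near y, dist g y z < e%:E /\ dist g z y < e%:E.
Proof.
move=> e0; pose i := chart_at g y; pose p0 := chart i y.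
have yi : dom i y := chart_atP g y.
have p0i : (chart i @` dom i) p0 by exists y.
have N1 : nbhs p0 (chart i @` dom i).
  by apply: open_nbhs_nbhs; split=> //; exact: open_codom.
have cg : {for p0, continuous (gram i)}.
  by have := @gram_smooth _ _ _ g i [::] _ p0i => -[].
have N2 : \forall q \near p0, (`|gram i p0 - gram i q| <= 1)%R.
  move/(@cvgrPdist_le _ _ _ (nbhs p0) (nbhs_filter p0)): cg; exact.
have /nbhs_ballP : \forall q \near p0, (chart i @` dom i) q /\ (`|gram i p0 - gram i q| <= 1)%R.
  exact: filterI N1 N2.
move=> [eta eta0 Heta].
have qH q : (`|p0 - q| < eta)%R -> (chart i @` dom i) q /\ (`|gram i p0 - gram i q| <= 1)%R.
  by move=> qp; apply: Heta; rewrite rV_ballE.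
(* [G] bounds every entry of the Gram matrices near [p0]; being at least 1 it satisfies G <= G^2, so
   the quadratic form is at most the square (n G |v|)^2 that [dist_segment] asks for. *)
pose G := (1 + `|gram i p0|)%R.
have G1 : (1 <= G)%R by rewrite lerDl.
have G0 : (0 < G)%R by exact: lt_le_trans G1.
have form_le (q v : 'rV[R]_n) : (`|p0 - q| < eta)%R ->
    ((v *m gram i q *m v^T) ord0 ord0 <= (n%:R * G * `|v|) ^+ 2)%R.
  move=> qp; have [_ gq] := qH _ qp.
  have gqG a b : (`|gram i q a b| <= G)%R.
    apply: (@le_trans _ _ `|gram i q|%R).
      exact: mx_coord_le.
    have -> : gram i q = (gram i p0 - (gram i p0 - gram i q))%R by rewrite subKr.
    by rewrite (le_trans (ler_normB _ _))// addrC lerD2r.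
  rewrite mxE; apply: (@le_trans _ _ (\sum_(b < n) \sum_(a < n) (`|v| * G * `|v|)))%R.
    apply: ler_sum => b _; rewrite !mxE mulr_suml; apply: ler_sum => a _.
    apply: le_trans (ler_norm _) _; rewrite !normrM.
    by rewrite !ler_pM ?mulr_ge0// ?mx_coord_le// mulr_ge0// ltW.
  rewrite !sumr_const !card_ord -mulrnA -[leLHS]mulr_natr natrM !exprMn.
  have -> : (`|v| * G * `|v| * (n%:R * n%:R) = (n%:R * `|v|) ^+ 2 * G)%R by ring.
  have -> : (n%:R ^+ 2 * G ^+ 2 * `|v| ^+ 2 = (n%:R * `|v|) ^+ 2 * G ^+ 2)%R by ring.
  by rewrite ler_wpM2l ?sqr_ge0// expr2 ler_peMl// ltW.
have seg p v : (`|p0 - p| < eta)%R -> (`|p0 - (p + v)| < eta)%R ->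
    dist g (chart_inv i p) (chart_inv i (p + v)%R) <= (pi * (n%:R * G * `|v|))%:E.
  move=> pp pv.
  have H s : (0 <= s <= 1)%R -> (`|p0 - (p + s *: v)| < eta)%R.
    move=> /andP[s0 s1].
    have -> : (p0 - (p + s *: v) = (1 - s) *: (p0 - p) + s *: (p0 - (p + v)))%R.
      by apply/rowP => k; rewrite !mxE; ring.
    apply: (le_lt_trans (ler_normD _ _)); rewrite !normrZ (ger0_norm s0) ger0_norm ?subr_ge0//.
    have [->|s10] := eqVneq s 0%R; first by rewrite subr0 mul1r mul0r addr0.
    have sp : (0 < s)%R by rewrite lt_neqAle eq_sym s10.
    have A : ((1 - s) * `|p0 - p| <= (1 - s) * eta)%R.
      by rewrite ler_wpM2l ?subr_ge0// ltW.
    have B : (s * `|p0 - (p + v)| < s * eta)%R by rewrite ltr_pM2l.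
    by lra.
  apply: dist_segment.
  - by move=> s /H /qH[].
  - by move=> s /H /form_le; exact.
  - by rewrite !mulr_ge0// ltW.
have cy : {for y, continuous (chart i)} by exact: chart_continuous.
pose rho := Num.min eta (e / (pi * (n%:R * G) + 1))%R.
have pG0 : (0 <= pi * (n%:R * G) :> R)%R by rewrite !mulr_ge0 ?pi_ge0// ltW.
have rho0 : (0 < rho)%R by rewrite lt_min eta0 divr_gt0// ltr_wpDl.
have N3 : \forall z \near y, (`|p0 - chart i z| < rho)%R.
  move/cvgrPdist_lt: cy; exact.
have N4 : \forall z \near y, dom i z.
  by apply: open_nbhs_nbhs; split=> //; exact: open_dom.
near=> z.
have zr : (`|p0 - chart i z| < rho)%R by near: z.
have zi : dom i z by near: z.
have zeta : (`|p0 - chart i z| < eta)%R by rewrite (lt_le_trans zr)// ge_min lexx.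
have eta00 : (`|p0 - p0| < eta)%R by rewrite subrr normr0.
have small : (pi * (n%:R * G * `|p0 - chart i z|) < e)%R.
  apply: (@le_lt_trans _ _ (pi * (n%:R * G) * (e / (pi * (n%:R * G) + 1))))%R.
    have -> : (pi * (n%:R * G * `|p0 - chart i z|) = pi * (n%:R * G) * `|p0 - chart i z|)%R.
      by rewrite !mulrA.
    apply: ler_wpM2l => //; apply/ltW/(lt_le_trans zr).
    by rewrite /rho ge_min lexx orbT.
  rewrite mulrCA gtr_pMr// ltr_pdivrMr ?ltr_wpDl// mul1r ltrDl//.
split.
  have := seg p0 (chart i z - p0)%R eta00; rewrite [(p0 + (chart i z - p0))%R]addrC subrK !chartK//.
  by move=> /(_ zeta)/le_lt_trans; apply; rewrite lte_fin -normrN opprB.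
have := seg (chart i z) (p0 - chart i z)%R zeta; rewrite [(chart i z + (p0 - chart i z))%R]addrC subrK !chartK//.
by move=> /(_ eta00)/le_lt_trans; apply; rewrite lte_fin.
Unshelve. all: by end_near. Qed.

Lemma dist_ball_open x (r : R) : open [set y | dist g x y < r%:E].
Proof.
rewrite openE => y /= xyr; rewrite /interior.
have xyf : dist g x y \is a fin_num by rewrite ge0_fin_numE ?dist_ge0// (lt_trans xyr)// ltry.
have e0 : (0 < r - fine (dist g x y))%R by rewrite subr_gt0 -lte_fin fineK.
apply: filterS (dist_near y e0) => z [yz _] /=.
apply: le_lt_trans (dist_triangle x y z) _.
by rewrite -(fineK xyf) -lteBrDl// -EFinB.
Qed.

Lemma nbhdE (A : set M) (r : R) :
  nbhd g A r = \bigcup_(x in A) [set y | dist g x y < r%:E].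
Proof.
apply/seteqP; split=> [y /ereal_inf_lt[_ [x Ax <-] xy]|y [x Ax xy]]; first by exists x.
by apply: le_lt_trans xy; apply: ereal_inf_lbound; exists x.
Qed.

Lemma open_nbhd (A : set M) (r : R) : open (nbhd g A r).
Proof. by rewrite nbhdE; apply: bigcup_open => x _; exact: dist_ball_open. Qed.

(** The points at finite distance from [x] form a nonempty set that is both open and closed. *)
Lemma dist_fin x y : connected [set: M] -> dist g x y < +oo.
Proof.
move=> cM; pose B := [set y | dist g x y < +oo].
suff : B = setT by move=> /seteqP[_ /(_ y I)].
apply: cM.
- by exists x; rewrite /B /= dist_xx ltry.
- exists B; last by rewrite setTI.
  rewrite openE => z /= xz; rewrite /interior.
  apply: filterS (dist_near z ltr01) => w [zw _]; rewrite /B /=.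
  apply: le_lt_trans (dist_triangle x z w) _.
  by rewrite lte_add_pinfty// (lt_trans zw)// ltry.
- exists B; last by rewrite setTI.
  rewrite -[B]setCK; apply: open_closedC.
  rewrite openE => z /= xz; rewrite /interior.
  apply: filterS (dist_near z ltr01) => w [_ wz] /= xw; apply: xz.
  apply: le_lt_trans (dist_triangle x w z) _.
  by rewrite lte_add_pinfty// (lt_trans wz)// ltry.
Qed.

End Distance.

(** * Power comparison for phi *)

Section RealDerivatives.
Context {R : realType}.
Implicit Types (f g df dg : R -> R) (a b : R).

Lemma is_derive_continuous f a b : is_derive a 1 f b -> {for a, continuous f}.
Proof. by case=> d _; exact/differentiable_continuous/derivable1_diffP. Qed.

(** The comparisons of [ln_phi] and [u_phi] with powers go through derivatives and this lemma,
    rather than through estimates of their defining integrals. *)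
Lemma is_derive_le_increment f g df dg a b : a <= b ->
  (forall x, a <= x <= b -> is_derive x 1 f (df x)) ->
  (forall x, a <= x <= b -> is_derive x 1 g (dg x)) ->
  (forall x, a < x < b -> df x <= dg x) -> f b - f a <= g b - g a.
Proof.
rewrite le_eqVlt => /predU1P[-> _ _ _|ab Hf Hg H]; first by rewrite !subrr.
pose h := fun x => g x - f x.
have D x : x \in `[a, b] -> is_derive x 1 h (dg x - df x).
  by rewrite in_itv /= => xab; have := Hf _ xab; have := Hg _ xab => ? ?; exact: is_deriveB.
have D' x : x \in `]a, b[ -> is_derive x 1 h (dg x - df x).
  by move=> xab; apply: D; move: xab; rewrite !in_itv/= => /andP[/ltW-> /ltW->].
have C : {within `[a, b], continuous h}.
  by apply: continuous_in_subspaceT => x /[!inE] /D; exact: is_derive_continuous.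
have [c cab E] := MVT ab D' C.
have : 0 <= h b - h a.
  by rewrite E mulr_ge0 ?subr_ge0 ?(ltW ab)// H//; move: cab; rewrite in_itv.
by rewrite /h; lra.
Qed.

Lemma is_derive_pos_lt f df a b : a < b ->
  (forall x, a <= x <= b -> is_derive x 1 f (df x)) ->
  (forall x, a < x < b -> 0 < df x) -> f a < f b.
Proof.
move=> ab Hf H.
have D x : x \in `[a, b] -> is_derive x 1 f (df x) by rewrite in_itv /=; exact: Hf.
have D' x : x \in `]a, b[ -> is_derive x 1 f (df x).
  by move=> xab; apply: D; move: xab; rewrite !in_itv/= => /andP[/ltW-> /ltW->].
have C : {within `[a, b], continuous f}.
  by apply: continuous_in_subspaceT => x /[!inE] /D; exact: is_derive_continuous.
have [c cab E] := MVT ab D' C.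
by rewrite -subr_gt0 E mulr_gt0 ?subr_gt0// H//; move: cab; rewrite in_itv.
Qed.

Lemma is_derive_eq_increment f g df a b : a <= b ->
  (forall x, a <= x <= b -> is_derive x 1 f (df x)) ->
  (forall x, a <= x <= b -> is_derive x 1 g (df x)) -> f b - f a = g b - g a.
Proof.
by move=> ab Hf Hg; apply/eqP; rewrite eq_le !(@is_derive_le_increment _ _ df df).
Qed.

End RealDerivatives.

(** * The deformed logarithm and exponential *)

Section LnPhi.
Context {R : realType}.
Variable phi : R -> R.
Hypothesis phiP : phi_function phi.
Implicit Types s t a b c tau : R.
Notation mu := (@lebesgue_measure R).
Notation lnp := (ln_phi phi).

Let phi_gt0 s : 0 < s -> 0 < phi s. Proof. by case: phiP => + _ _; exact. Qed.


Let phi_cont s : 0 < s -> {for s, continuous phi}. Proof. by case: phiP => _ _; exact. Qed.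

Let invphi_cont s : 0 < s -> {for s, continuous (fun s => (phi s)^-1)}.
Proof. by move=> s0; apply: cvgV; [rewrite gt_eqF// phi_gt0|exact: phi_cont]. Qed.

Let invphi_int a b : 0 < a -> mu.-integrable `[a, b] (EFin \o (fun s => (phi s)^-1)).
Proof.
move=> a0; apply: continuous_compact_integrable; first exact: segment_compact.
apply: continuous_in_subspaceT => x /[!inE] /=; rewrite in_itv /= => /andP[ax _].
exact/invphi_cont/(lt_le_trans a0).
Qed.

Let integral_chasles a b c : 0 < a -> a <= b -> b <= c ->
  \int[mu]_(s in `[a, c]) (phi s)^-1 =
  \int[mu]_(s in `[a, b]) (phi s)^-1 + \int[mu]_(s in `[b, c]) (phi s)^-1.
Proof.
move=> a0 ab bc.
have := @Rintegral_itvB R (fun s => (phi s)^-1) (BLeft a) (BRight c) b (invphi_int c a0).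
rewrite !bnd_simp => /(_ ab bc) E.
rewrite addrC -[LHS](subrK (\int[mu]_(s in `[a, b]) (phi s)^-1)) E; congr (_ + _).
apply: Rintegral_itv_obnd_cbnd.
apply: integrableS (invphi_int c (lt_le_trans a0 ab)) => //.
by apply: subset_itvr; rewrite bnd_simp.
Qed.

(** A base point [a] below both 1 and [t] replaces the case split of the definition by one integral
    with a variable upper end, to which the fundamental theorem of calculus applies. *)
Lemma ln_phiE a t : 0 < a -> a <= 1 -> a <= t ->
  lnp t = \int[mu]_(s in `[a, t]) (phi s)^-1 - \int[mu]_(s in `[a, 1]) (phi s)^-1.
Proof.
move=> a0 a1 at_; rewrite /ln_phi; case: leP => [t1|/ltW t1].
  by rewrite (integral_chasles a0 a1 t1) addrC addKr.
rewrite (integral_chasles a0 at_ t1).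
by rewrite opprD addrA subrr add0r.
Qed.

Lemma ln_phi1 : lnp 1 = 0.
Proof. by rewrite /ln_phi lexx set_itv1 Rintegral_set1. Qed.

Lemma is_derive_ln_phi s : 0 < s -> is_derive s 1 lnp (phi s)^-1.
Proof.
move=> s0; pose a := Num.min (s / 2) 1.
have a0 : 0 < a by rewrite lt_min ltr01 divr_gt0.
have a1 : a <= 1 by rewrite ge_min lexx orbT.
have as_ : a < s by rewrite gt_min; apply/orP; left; lra.
have s1 : s < s + 1 by rewrite ltrDl.
have [dF FE] := @continuous_FTC1_closed R _ a s _ s1 (invphi_int _ a0) as_ (invphi_cont s0).
have N : \forall t \near s,
    (fun t => \int[mu]_(x in `[a, t]) (phi x)^-1 - \int[mu]_(x in `[a, 1]) (phi x)^-1) t = lnp t.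
  near=> t; rewrite (@ln_phiE a)//; apply: ltW; near: t; exact: lt_nbhsr.
apply: (near_eq_is_derive N).
have D : is_derive s 1 (fun t => \int[mu]_(x in `[a, t]) (phi x)^-1) (phi s)^-1.
  exact: DeriveDef dF (etrans (esym (derive1E _ _)) FE).
by rewrite -[(phi s)^-1]subr0; exact: is_deriveB.
Unshelve. all: by end_near. Qed.

Lemma ln_phi_continuous s : 0 < s -> {for s, continuous lnp}.
Proof. by move=> /is_derive_ln_phi/is_derive_continuous. Qed.

Lemma ln_phi_lt s t : 0 < s -> s < t -> lnp s < lnp t.
Proof.
move=> s0 st; apply: (@is_derive_pos_lt _ _ (fun x => (phi x)^-1)) => //.
  by move=> x /andP[sx _]; exact/is_derive_ln_phi/(lt_le_trans s0).
by move=> x /andP[sx _]; rewrite invr_gt0 phi_gt0// (lt_trans s0).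
Qed.

Lemma ln_phi_le s t : 0 < s -> s <= t -> lnp s <= lnp t.
Proof. by move=> s0; rewrite le_eqVlt => /predU1P[->//|/(ln_phi_lt s0)/ltW]. Qed.

Lemma ln_phi_inj : {in `]0, +oo[%classic &, injective lnp}.
Proof.
move=> x y; rewrite !inE /= !in_itv /= !andbT => x0 y0 E.
by have [xy|xy|//] := ltgtP x y; [have := ln_phi_lt x0 xy|have := ln_phi_lt y0 xy];
  rewrite E ltxx.
Qed.

Lemma l_phi_lt t : 0 < t -> (l_phi phi < (lnp t)%:E)%E.
Proof.
move=> t0; apply: (@le_lt_trans _ _ (lnp (t / 2))%:E).
  by apply: ereal_inf_lbound; exists (t / 2) => //=; rewrite in_itv/= andbT divr_gt0.
by rewrite lte_fin ln_phi_lt ?divr_gt0//; lra.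
Qed.

Lemma L_phi_gt t : 0 < t -> ((lnp t)%:E < L_phi phi)%E.
Proof.
move=> t0; apply: (@lt_le_trans _ _ (lnp (t + 1))%:E).
  by rewrite lte_fin ln_phi_lt// ltrDl.
by apply: ereal_sup_ubound; exists (t + 1) => //=; rewrite in_itv/= andbT addr_gt0.
Qed.

Lemma exp_phiK t : 0 < t -> exp_phi phi (lnp t) = t%:E.
Proof.
move=> t0; rewrite /exp_phi leNgt l_phi_lt// L_phi_gt//=; congr EFin.
apply: pinvKV; first exact: ln_phi_inj.
by rewrite inE /= in_itv /= andbT.
Qed.

Lemma ln_phi_surj tau : (l_phi phi < tau%:E)%E -> (tau%:E < L_phi phi)%E ->
  exists2 t, 0 < t & lnp t = tau.
Proof.
move=> /ereal_inf_lt[_ [s s0 <-] stau] /ereal_sup_gt[_ [t t0 <-] taut].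
rewrite lte_fin in stau; rewrite lte_fin in taut.
rewrite /= in_itv /= andbT in s0; rewrite /= in_itv /= andbT in t0.
have st : s <= t.
  by rewrite leNgt; apply/negP => /(ln_phi_lt t0); rewrite ltNge (le_trans (ltW stau))// ltW.
have C : {within `[s, t], continuous lnp}.
  apply: continuous_in_subspaceT => x /[!inE] /=; rewrite in_itv /= => /andP[sx _].
  exact/ln_phi_continuous/(lt_le_trans s0).
have B : Num.min (lnp s) (lnp t) <= tau <= Num.max (lnp s) (lnp t).
  by rewrite ge_min le_max (ltW stau) (ltW taut) orbT.
have [c + cE] := IVT st C B.
by rewrite in_itv /= => /andP[sc _]; exists c => //; exact: lt_le_trans sc.
Qed.

Lemma exp_phi_cases tau : (tau%:E < L_phi phi)%E ->
  ((tau%:E <= l_phi phi)%E /\ exp_phi phi tau = 0%E) \/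
  exists2 t, 0 < t & lnp t = tau /\ exp_phi phi tau = t%:E.
Proof.
move=> tL; have [tl|lt] := leP tau%:E (l_phi phi).
  by left; split=> //; rewrite /exp_phi tl.
by right; have [t t0 <-] := ln_phi_surj lt tL; exists t => //; rewrite exp_phiK.
Qed.

End LnPhi.

Section PowerPhi.
Context {R : realType}.
Implicit Types m p s t x : R.

Lemma powR_cont p x : 0 < x -> {for x, continuous (fun y : R => y `^ p)}.
Proof. by move=> x0; apply: is_derive_continuous; exact: is_derive1_powR. Qed.

Lemma powR_exponent_continuous t : 0 < t -> continuous (fun p : R => t `^ p).
Proof.
move=> t0; have -> : (fun p : R => t `^ p) = (fun p : R => expR (p * ln t)).
  by apply/funext => p; rewrite /powR gt_eqF.
move=> p; apply: (@continuous_comp _ _ _ (fun p : R => p * ln t) expR).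
  exact: mulrr_continuous.
exact: continuous_expR.
Qed.

Lemma phi_m_function m : m <= 2 -> phi_function (phi_m m).
Proof.
move=> m2; split=> [s s0|s t s0 st|s s0]; rewrite /phi_m ?powR_gt0//.
  by rewrite ge0_ler_powR ?nnegrE ?subr_ge0 ?(ltW s0)// (le_trans (ltW s0)).
exact: powR_cont.
Qed.

Lemma ln_phi_unique (phi F : R -> R) t : phi_function phi ->
  (forall x, 0 < x -> is_derive x 1 F (phi x)^-1) -> F 1 = 0 -> 0 < t -> ln_phi phi t = F t.
Proof.
move=> phiP dF F1 t0; have [t1|/ltW t1] := leP 1 t.
  have := @is_derive_eq_increment R (ln_phi phi) F (fun x => (phi x)^-1) 1 t t1.
  rewrite ln_phi1 F1 !subr0; apply=> x /andP[x1 _].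
    exact/is_derive_ln_phi/(lt_le_trans ltr01).
  exact/dF/(lt_le_trans ltr01).
have := @is_derive_eq_increment R (ln_phi phi) F (fun x => (phi x)^-1) t 1 t1.
rewrite ln_phi1 F1 !sub0r => H; apply: oppr_inj; apply: H => x /andP[x1 _].
  exact/is_derive_ln_phi/(lt_le_trans t0).
exact/dF/(lt_le_trans t0).
Qed.

Lemma is_derive_powR_primitive p x : p != 0 -> 0 < x ->
  is_derive x 1 (fun y => (y `^ p - 1) / p) (x `^ (p - 1)).
Proof.
move=> p0 x0; have d1 := is_derive1_powR p x0.
have d2 : is_derive x 1 (p^-1 \*: ((fun y => y `^ p) - cst 1)) (p^-1 *: (p * x `^ (p - 1) - 0)).
  by apply: is_deriveZ; apply: is_deriveB.
have -> : (fun y => (y `^ p - 1) / p) = p^-1 \*: ((fun y => y `^ p) - cst 1).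
  by apply/funext => y; rewrite mulrC.
by move: d2; rewrite subr0 -[_ *: _]/(p^-1 * (p * x `^ (p - 1))) mulKf.
Qed.

Lemma ln_phi_mE m t : m <= 2 -> m != 1 -> 0 < t ->
  ln_phi (phi_m m) t = (t `^ (m - 1) - 1) / (m - 1).
Proof.
move=> m2 m1 t0; apply: (@ln_phi_unique _ (fun t => (t `^ (m - 1) - 1) / (m - 1))) => //.
  exact: phi_m_function.
  move=> x x0; rewrite /phi_m -powRN opprB.
  have -> : m - 2 = m - 1 - 1 by lra.
  by apply: is_derive_powR_primitive; rewrite ?subr_eq0.
by rewrite powR1 subrr mul0r.
Qed.

Lemma ln_phi_m1E t : 0 < t -> ln_phi (phi_m 1) t = ln t.
Proof.
move=> t0; apply: (@ln_phi_unique _ (@ln R)) => //; last exact: ln1.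
  by apply: phi_m_function; rewrite ler1n.
move=> x x0; rewrite /phi_m (_ : 2 - 1 = 1 :> R); last by lra.
by rewrite powRr1 ?ltW//; exact: is_derive1_ln.
Qed.

Lemma ln_phi_m_le_subr1 m t : m <= 2 -> 1 <= t -> ln_phi (phi_m m) t <= t - 1.
Proof.
move=> m2 t1; rewrite -[leLHS]subr0 -(ln_phi1 (phi_m m)).
apply: (@is_derive_le_increment R _ id (fun x => (phi_m m x)^-1) (fun=> 1)) => //.
- move=> x /andP[x1 _]; apply: is_derive_ln_phi; first exact: phi_m_function.
  exact: lt_le_trans x1.
- move=> x /andP[x1 _]; rewrite invf_le1; last by rewrite powR_gt0// (lt_trans _ x1).
  by rewrite -(powRr0 x) ler_powR ?subr_ge0// ltW.
Qed.

Lemma powR_le_tangent p x : 0 <= p <= 1 -> 0 < x -> x `^ p <= 1 + p * (x - 1).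
Proof.
move=> /andP[p0 p1] x0.
have D (z : R) : 0 < z -> is_derive z 1 (fun y : R => y `^ p) (p * z `^ (p - 1)).
  by move=> ?; exact: is_derive1_powR.
have D' (z : R) : is_derive z 1 (fun y => p * y) (p : R).
  by have := @is_deriveZ R R R id p z 1 1 (is_derive_id z 1); rewrite /GRing.scale /= mulr1.
have [x1|/ltW x1] := leP 1 x.
  have H : x `^ p - 1 `^ p <= p * x - p * 1.
    apply: (@is_derive_le_increment R (fun y => y `^ p) (fun y => p * y)
      (fun z => p * z `^ (p - 1)) (fun=> p)) => // z /andP[z1 _].
      exact/D/(lt_le_trans ltr01).
    rewrite -[leRHS]mulr1 ler_wpM2l// -[leRHS](powRr0 z).
    by rewrite ler_powR ?(ltW z1)// subr_le0.
  by move: H; rewrite powR1; lra.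
have H : p * 1 - p * x <= 1 `^ p - x `^ p.
  apply: (@is_derive_le_increment R (fun y => p * y) (fun y => y `^ p)
    (fun=> p) (fun z => p * z `^ (p - 1))) => // z /andP[xz z1].
    exact/D/(lt_le_trans x0).
  rewrite -[leLHS]mulr1 ler_wpM2l// -[leLHS](powRr0 z).
  by rewrite ger_powR ?subr_le0// (lt_trans x0 xz) ltW.
by move: H; rewrite powR1; lra.
Qed.

End PowerPhi.

(** * Growth of phi from bounds on its Dini derivative *)

Section DiniGrowth.
Context {R : realType}.
Implicit Types (f g F : R -> R) (a b s t x p : R).

(** The supremum [m] of the points with F <= 0 satisfies F m <= 0 by continuity; if m < b, then
    either F m < 0 or the last hypothesis produces a further such point to the right. That
    hypothesis is existential and restricted to zeros of [F], because a limsup above a slope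
    controls difference quotients only along some points. *)
Lemma crossing_le0 F a b : a <= b ->
  (forall x, a <= x <= b -> {for x, continuous F}) -> F a <= 0 ->
  (forall x, a <= x < b -> F x = 0 -> forall e, 0 < e ->
     exists y, x < y < x + e /\ F y <= 0) -> F b <= 0.
Proof.
move=> ab cF Fa step.
pose S := [set x | a <= x <= b /\ F x <= 0].
have Sa : S a by rewrite /S /= lexx ab.
have hS : has_sup S by split; [exists a|exists b => x [/andP[]]].
pose m := sup S.
have mS x : S x -> x <= m by move=> Sx; apply: sup_ubound => //; case: hS.
have am : a <= m by exact: mS.
have mb : m <= b by apply: ge_sup; [exists a|move=> x [/andP[]]].
have cm : {for m, continuous F} by apply: cF; rewrite am mb.
have Fm : F m <= 0.
  rewrite leNgt; apply/negP => Fm.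
  have /nbhs_ballP[e /= e0 He] : \forall x \near m, 0 < F x.
    by have /cvgr_gt := cm; apply.
  have [x Sx xm] := sup_adherent e0 hS.
  have : 0 < F x.
    apply: He; rewrite /ball/= ger0_norm ?subr_ge0 ?mS//.
    by rewrite ltrBlDr -ltrBlDl.
  by rewrite ltNge; case: Sx => _ ->.
move: mb; rewrite le_eqVlt => /predU1P[<-//|mb].
suff [y [/andP[my yb] Fy]] : exists y, m < y < b /\ F y <= 0.
  have : y <= m by apply: mS; split=> //; rewrite (le_trans am (ltW my)) ltW.
  by rewrite leNgt my.
move: Fm; rewrite le_eqVlt => /predU1P[Fm|Fm].
  have amb : a <= m < b by rewrite am.
  have bm : 0 < b - m by rewrite subr_gt0.
  have [y [/andP[my ym] Fy]] := step m amb Fm (b - m) bm.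
  by exists y; rewrite my; move: ym; rewrite addrC subrK => ->.
have /nbhs_ballP[e /= e0 He] : \forall x \near m, F x < 0.
  by have /cvgr_lt := cm; apply.
pose y := m + Num.min (e / 2) ((b - m) / 2).
have bm : 0 < b - m by rewrite subr_gt0.
have d0 : 0 < Num.min (e / 2) ((b - m) / 2) by rewrite lt_min !divr_gt0.
exists y; split.
  rewrite ltrDl d0/= -ltrBrDl.
  by rewrite gt_min; apply/orP; right; lra.
apply/ltW/He; rewrite /ball /= opprD addNKr normrN gtr0_norm//.
by rewrite gt_min; apply/orP; left; lra.
Qed.

Lemma right_increment_cvg g x dg : is_derive x 1 g dg ->
  (g (x + t) - g x) / t @[t --> 0^'+] --> dg.
Proof.
move=> [dx <-]; apply: cvg_dnbhs_at_right.
have -> : (fun t => (g (x + t) - g x) / t) =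
    (fun h : R => h^-1 *: ((g \o shift x) (h *: (1 : R)) - g x)).
  by apply/funext => t; rewrite /= mulrC [t%:A]mulr1 (addrC x).
exact: dx.
Qed.

Definition right_dini f x : \bar R :=
  limf_esup (fun t => ((f (x + t) - f x) / t)%:E) (0 : R)^'+.

Lemma right_dini_lt f g x dg : is_derive x 1 g dg -> (right_dini f x < dg%:E)%E ->
  forall e, 0 < e -> exists y, x < y < x + e /\ f y - f x <= g y - g x.
Proof.
move=> dgx /ereal_inf_lt[_ [V V0 <-] /= supV] e e0.
have [c Vc cg] : exists2 c : R, (ereal_sup [set ((f (x + t) - f x) / t)%:E | t in V] <= c%:E)%E & c < dg.
  move: supV; set s := ereal_sup _; case: s => [r|//|_]; last by exists (dg - 1); rewrite ?leNye// ltrBlDr ltrDl.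
  by rewrite lte_fin => rd; exists r.
near (0 : R)^'+ => t.
have t0 : 0 < t by near: t; exact: nbhs_right_gt.
exists (x + t); split.
  by rewrite ltrDl t0 ltrD2l; near: t; exact: nbhs_right_lt.
have Vt : V t by near: t.
have ft : (f (x + t) - f x) / t <= c.
  by rewrite -lee_fin (le_trans _ Vc)//; apply: ereal_sup_ubound; exists t.
have gt_ : c < (g (x + t) - g x) / t.
  near: t; have /cvgr_gt := right_increment_cvg dgx; exact.
rewrite -[leLHS](divfK (lt0r_neq0 t0)) -[leRHS](divfK (lt0r_neq0 t0)).
by rewrite ler_wpM2r ?(ltW t0)// (le_trans ft) ?ltW.
Unshelve. all: by end_near. Qed.

Lemma right_dini_gt f g x dg : is_derive x 1 g dg -> (dg%:E < right_dini f x)%E ->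
  forall e, 0 < e -> exists y, x < y < x + e /\ g y - g x <= f y - f x.
Proof.
move=> dgx dgD e e0.
have [c gc cD] : exists2 c : R, dg < c & (c%:E < right_dini f x)%E.
  move: dgD; case: (right_dini f x) => [r|_|//]; last first.
    by exists (dg + 1); rewrite ?ltrDl// ltry.
  by rewrite lte_fin => rd; exists ((dg + r) / 2); rewrite ?lte_fin; lra.
(* The limsup is an infimum of suprema over neighbourhoods, so the supremum over this particular
   one, where the quotients of [g] are below [c], still exceeds [c]. *)
pose V := [set t : R | 0 < t < e /\ (g (x + t) - g x) / t < c].
have V0 : (0 : R)^'+ V.
  near=> t; split.
    by apply/andP; split; near: t; [exact: nbhs_right_gt|exact: nbhs_right_lt].
  near: t; have /cvgr_lt := right_increment_cvg dgx; exact.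
have /ereal_sup_gt[_ [t [/andP[t0 te] gt_] <-]] :
    (c%:E < ereal_sup [set ((f (x + t) - f x) / t)%:E | t in V])%E.
  by apply: lt_le_trans cD _; apply: ereal_inf_lbound; exists V.
rewrite lte_fin => ft; exists (x + t); rewrite ltrDl t0 ltrD2l te; split=> //.
rewrite -[leLHS](divfK (lt0r_neq0 t0)) -[leRHS](divfK (lt0r_neq0 t0)).
by rewrite ler_wpM2r ?(ltW t0)// ltW// (lt_trans gt_).
Unshelve. all: by end_near. Qed.

Section growth.
Variable phi : R -> R.
Hypothesis phiP : phi_function phi.

Let phi_gt0 s : 0 < s -> 0 < phi s. Proof. by case: phiP => + _ _; exact. Qed.

Let phi_cont s : 0 < s -> {for s, continuous phi}. Proof. by case: phiP => _ _; exact. Qed.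

Let power s p x := phi s * (x / s) `^ p.

Let power_derive s p x : 0 < s -> 0 < x -> is_derive x 1 (power s p) (p * power s p x / x).
Proof.
move=> s0 x0.
have E : {in `]0, +oo[%classic, (phi s * s^-1 `^ p) \*: (fun y => y `^ p) =1 power s p}.
  move=> y; rewrite inE /= in_itv /= andbT => y0.
  rewrite /power powRM ?(ltW y0) ?invr_ge0 ?(ltW s0)//.
  by rewrite -[LHS]/(_ * _) -mulrA; congr (_ * _); rewrite mulrC.
have N : \forall y \near x, ((phi s * s^-1 `^ p) \*: (fun y => y `^ p)) y = power s p y.
  near=> y; apply: E; rewrite inE /= in_itv /= andbT; near: y; exact: lt_nbhsr.
apply: (near_eq_is_derive N).
have xE := nbhs_singleton N.
have -> : p * power s p x / x = (phi s * s^-1 `^ p) *: (p * x `^ (p - 1)).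
  rewrite -xE -[LHS]/(p * (_ * _) / x) -[RHS]/(_ * (_ * _)).
  rewrite powRB; last by rewrite (gt_eqF x0)/= implybT.
  by rewrite powRr1 ?ltW//; ring.
by apply: is_deriveZ; exact: is_derive1_powR.
Unshelve. all: by end_near. Qed.

Let power_self s p : 0 < s -> power s p s = phi s.
Proof. by move=> s0; rewrite /power divff ?gt_eqF// powR1 mulr1. Qed.

Let power_cont_exp s t p : 0 < s -> 0 < t -> {for p, continuous (fun q => power s q t)}.
Proof.
move=> s0 t0; apply: cvgMr.
by apply: (powR_exponent_continuous (divr_gt0 t0 s0)).
Qed.

Let dini_ratio_le s x : 0 < s -> (dini_ratio phi s <= x%:E)%E ->
  (right_dini phi s <= (x * phi s / s)%:E)%E.
Proof.
move=> s0; have sp : 0 < phi s / s by rewrite divr_gt0 ?phi_gt0.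
rewrite /dini_ratio -/(right_dini phi s) -[s / _]invf_div lee_pdivrMl// -EFinM.
by rewrite [phi s / s * x]mulrC mulrA.
Qed.

Let dini_ratio_ge s x : 0 < s -> (x%:E <= dini_ratio phi s)%E ->
  ((x * phi s / s)%:E <= right_dini phi s)%E.
Proof.
move=> s0; have sp : 0 < phi s / s by rewrite divr_gt0 ?phi_gt0.
rewrite /dini_ratio -/(right_dini phi s) -[s / _]invf_div lee_pdivlMl// -EFinM.
by rewrite [phi s / s * x]mulrC mulrA.
Qed.

(** The power curve of exponent [q] through (s, phi s) solves y' = q y / x, while [dini_ratio]
    bounds the logarithmic slope of [phi] by [theta]. For q > theta the slopes compare strictly at
    every contact point, so [phi] cannot get above the curve; [q] is chosen so close to [theta] that
    this contradicts the assumed failure at [t]. *)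
Lemma phi_growth_le theta s t : (forall x, 0 < x -> (dini_ratio phi x <= theta%:E)%E) ->
  0 < s -> s <= t -> phi t <= phi s * (t / s) `^ theta.
Proof.
move=> H s0 st; have t0 := lt_le_trans s0 st.
rewrite leNgt; apply/negP => lt_.
have N : \forall q \near theta^'+, power s q t < phi t.
  have := @power_cont_exp s t theta s0 t0.
  by move=> /cvg_at_right_filter/cvgr_lt; exact.
near theta^'+ => q.
have tq : theta < q by near: q; exact: nbhs_right_gt.
suff : phi t - power s q t <= 0 by rewrite subr_le0 leNgt; near: q; move: N; apply: filterS => q' ->.
apply: (@crossing_le0 (fun x => phi x - power s q x) s t) => //.
- move=> x /andP[sx _]; have x0 := lt_le_trans s0 sx.
  by apply: cvgB; [exact: phi_cont|exact/(is_derive_continuous (power_derive q s0 x0))].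
- by rewrite power_self// subrr.
- move=> x /andP[sx _] /eqP; rewrite subr_eq0 => /eqP xE e e0.
  have x0 := lt_le_trans s0 sx.
  have dl : (right_dini phi x < (q * power s q x / x)%:E)%E.
    apply: le_lt_trans (dini_ratio_le x0 (H x x0)) _.
    by rewrite -xE lte_fin ltr_pM2r ?invr_gt0// ltr_pM2r ?phi_gt0.
  have [y [xy Hy]] := right_dini_lt (power_derive q s0 x0) dl e0.
  by exists y; split=> //; rewrite xE lerD2r in Hy; rewrite subr_le0.
Unshelve. all: by end_near. Qed.

Lemma phi_growth_ge delta s t : 0 < delta ->
  (forall x, 0 < x -> (delta%:E <= dini_ratio phi x)%E) ->
  0 < s -> s <= t -> phi s * (t / s) `^ delta <= phi t.
Proof.
move=> d0 H s0 st; have t0 := lt_le_trans s0 st.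
rewrite leNgt; apply/negP => lt_.
have N : \forall q \near delta^'-, phi t < power s q t.
  have := @power_cont_exp s t delta s0 t0.
  by move=> /cvg_at_left_filter/cvgr_gt; exact.
near delta^'- => q.
have qd : q < delta by near: q; exact: nbhs_left_lt.
have q0 : 0 < q by near: q; exact: nbhs_left_gt.
suff : power s q t - phi t <= 0 by rewrite subr_le0 leNgt; near: q; move: N; apply: filterS => q' ->.
apply: (@crossing_le0 (fun x => power s q x - phi x) s t) => //.
- move=> x /andP[sx _]; have x0 := lt_le_trans s0 sx.
  by apply: cvgB; [exact/(is_derive_continuous (power_derive q s0 x0))|exact: phi_cont].
- by rewrite power_self// subrr.
- move=> x /andP[sx _] /eqP; rewrite subr_eq0 => /eqP xE e e0.
  have x0 := lt_le_trans s0 sx.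
  have dl : ((q * power s q x / x)%:E < right_dini phi x)%E.
    apply: lt_le_trans (dini_ratio_ge x0 (H x x0)).
    by rewrite xE lte_fin ltr_pM2r ?invr_gt0// ltr_pM2r ?phi_gt0.
  have [y [xy Hy]] := right_dini_gt (power_derive q s0 x0) dl e0.
  by exists y; split=> //; rewrite xE lerD2r in Hy; rewrite subr_le0.
Unshelve. all: by end_near. Qed.

End growth.
End DiniGrowth.

(** * The convex function u and its Legendre transform *)

Section UPhi.
Context {R : realType}.
Notation mu := (@lebesgue_measure R).
Implicit Types s t x b r : R.

Lemma integral_invsqrt_le a b : 0 < a -> 0 < b ->
  (\int[mu]_(t in `[a, b]) (t `^ (- 2^-1))%:E <= (2 * b `^ 2^-1)%:E)%E.
Proof.
move=> a0 b0; have [ab|ba] := ltP a b; last first.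
  apply: (@le_trans _ _ 0%E); last by rewrite lee_fin mulr_ge0// powR_ge0.
  move: ba; rewrite le_eqVlt => /predU1P[->|ba]; first by rewrite set_itv1 integral_set1.
  by rewrite set_itv_ge ?integral_set0// bnd_simp -ltNge.
pose F := fun y : R => (y `^ 2^-1 - 1) / 2^-1.
have D x : 0 < x -> is_derive x 1 F (x `^ (- 2^-1)).
  move=> x0; have := @is_derive_powR_primitive R 2^-1 x _ x0.
  have -> : 2^-1 - 1 = - 2^-1 :> R by lra.
  by apply; rewrite invr_eq0 pnatr_eq0.
rewrite (@continuous_FTC2 _ _ F)//.
- rewrite -EFinB lee_fin /F.
  have := powR_ge0 a 2^-1; set A := a `^ _; set B := b `^ _ => A0; lra.
- apply: continuous_in_subspaceT => x /[!inE] /=; rewrite in_itv /= => /andP[ax _].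
  exact/powR_cont/(lt_le_trans a0).
- split.
  + move=> x; rewrite in_itv /= => /andP[ax _].
    by have [] := D x (lt_trans a0 ax).
  + by apply: cvg_at_right_filter; exact: is_derive_continuous (D a a0).
  + by apply: cvg_at_left_filter; exact: is_derive_continuous (D b b0).
- move=> x; rewrite in_itv /= => /andP[ax _].
  by rewrite derive1E; have [] := D x (lt_trans a0 ax).
Qed.

Lemma integrable_invsqrt b : 0 < b ->
  mu.-integrable `]0, b] (EFin \o (fun t => t `^ (- 2^-1))).
Proof.
move=> b0; apply/integrableP; split.
  apply/measurable_EFinP; apply: measurable_funTS; exact: measurable_powR.
under eq_integral => x _ do rewrite /= ger0_norm ?powR_ge0//.
apply: (@le_lt_trans _ _ (2 * b `^ 2^-1)%:E); last by rewrite ltry.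
have E := itv_open_bnd_bigcup false b 0.
have -> : `]0, b]%classic = \bigcup_k `[0 + k.+1%:R^-1, b]%classic by exact: E.
pose I k : set (measurableTypeR R) := `[0 + k.+1%:R^-1, b]%classic.
have c : (\int[mu]_(t in I k) (t `^ (- 2^-1))%:E @[k --> \oo] -->
    \int[mu]_(t in \bigcup_k I k) (t `^ (- 2^-1))%:E)%E.
  apply: ge0_nondecreasing_set_cvg_integral.
  - apply/nondecreasing_seqP => k; rewrite subsetEset; apply: subset_itvr.
    by rewrite bnd_simp !add0r lef_pV2 ?posrE// ler_nat.
  - by move=> k; exact: measurable_itv.
  - move=> k; apply/measurable_EFinP; apply: measurable_funTS; exact: measurable_powR.
  - by move=> k x _; rewrite lee_fin powR_ge0.
apply: (cvge_to_le c).
by near=> k; rewrite /I add0r; apply: integral_invsqrt_le.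
Unshelve. all: by end_near. Qed.

Variable phi : R -> R.
Hypothesis phiP : phi_function phi.
Hypothesis phi_lb : forall s, 0 < s -> s <= 1 -> s `^ (3 / 2) <= phi s.
Notation lnp := (ln_phi phi).
Notation u := (u_phi phi).

Let phi_gt0 s : 0 < s -> 0 < phi s. Proof. by case: phiP => + _ _; exact. Qed.

Lemma ln_phi_lower t : 0 < t -> t <= 1 -> - 2 * t `^ (- 2^-1) <= lnp t.
Proof.
move=> t0 t1.
have p0 : - 2^-1 != 0 :> R by rewrite oppr_eq0 invr_eq0 pnatr_eq0.
have H : lnp 1 - lnp t <= (1 `^ (- 2^-1) - 1) / (- 2^-1) - (t `^ (- 2^-1) - 1) / (- 2^-1).
  apply: (@is_derive_le_increment R lnp (fun y => (y `^ (- 2^-1) - 1) / (- 2^-1))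
    (fun x => (phi x)^-1) (fun x => x `^ (- 2^-1 - 1))) => // x /andP[tx x1].
  - exact/is_derive_ln_phi/(lt_le_trans t0).
  - exact/is_derive_powR_primitive/(lt_le_trans t0).
  - have x0 := lt_trans t0 tx.
    have -> : - 2^-1 - 1 = - (3 / 2) :> R by lra.
    by rewrite powRN lef_pV2 ?posrE ?powR_gt0 ?phi_gt0// phi_lb// ltW.
by move: H; rewrite ln_phi1 powR1 subrr mul0r; set T := t `^ _; lra.
Qed.

(** This is what makes [u_phi] meaningful: phi s >= s^(3/2) near 0 keeps [ln_phi] above -2 t^(-1/2),
    an integrable singularity. *)
Lemma ln_phi_integrable b : 1 <= b -> mu.-integrable `[0, b] (EFin \o lnp).
Proof.
move=> b1; have b0 := lt_le_trans ltr01 b1.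
have m0 : measurable_fun `]0, b] lnp.
  have sub : `]0, b] `<=` (`]0, +oo[ : set R) by apply: subset_itvl; rewrite bnd_simp.
  apply: (measurable_funS _ sub); first exact: measurable_itv.
  apply: open_continuous_measurable_fun; first exact: interval_open.
  by move=> x /[!inE] /=; rewrite in_itv /= andbT; exact: ln_phi_continuous.
have i0 : mu.-integrable `]0, b] (EFin \o lnp).
  have ig : mu.-integrable `]0, b] (EFin \o (fun t => 2 * t `^ (- 2^-1) + lnp b)).
    have -> : EFin \o (fun t => 2 * t `^ (- 2^-1) + lnp b) =
       ((fun t => 2%R%:E * (EFin \o (fun t => t `^ (- 2^-1))%R) t) \+ (fun=> (lnp b)%:E))%E.
      by apply/funext.
    apply: integrableD => //.
      by apply: integrableZl => //; exact: integrable_invsqrt.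
    apply: measurable_bounded_integrable => //.
    by rewrite /= lebesgue_measure_itv /= lte_fin b0 ltry.
    by exists `|lnp b|; split; rewrite ?num_real// => M /ltW MM x _.
  apply: le_integrable ig => //; first exact/measurable_EFinP.
  move=> x /=; rewrite in_itv /= => /andP[x0 xb].
  have lb0 : 0 <= lnp b by rewrite -(ln_phi1 phi) ln_phi_le.
  have X0 := powR_ge0 x (- 2^-1).
  rewrite lee_fin [leRHS]ger0_norm; last by rewrite addr_ge0// mulr_ge0.
  rewrite ler_norml; have := ln_phi_le phiP x0 xb; have [x1|/ltW x1] := leP x 1.
    by have := ln_phi_lower x0 x1; set T := x `^ _ in X0 *; lra.
  have : 0 <= lnp x by rewrite -(ln_phi1 phi) ln_phi_le.
  by set T := x `^ _ in X0 *; lra.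
apply/integrableP; split.
  exact/measurable_EFinP/measurable_fun_itv_obnd_cbndP.
rewrite -integral_itv_obnd_cbnd; first by case/integrableP : i0.
by apply: measurableT_comp => //; exact/measurable_EFinP.
Qed.

Lemma u_phi0 : u 0 = 0.
Proof. by rewrite /u_phi set_itv1 Rintegral_set1. Qed.

Lemma u_phi_neg r : r < 0 -> u r = 0.
Proof. by move=> r0; rewrite /u_phi set_itv_ge ?Rintegral_set0// bnd_simp -ltNge. Qed.

Lemma is_derive_u_phi s : 0 < s -> is_derive s 1 u (lnp s).
Proof.
move=> s0; have s1 : s < s + 1 by rewrite ltrDl.
have b1 : 1 <= s + 1 by rewrite lerDr ltW.
have [dF FE] := @continuous_FTC1_closed R _ 0 s _ s1 (ln_phi_integrable b1) s0 (ln_phi_continuous phiP s0).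
exact: DeriveDef dF (etrans (esym (derive1E _ _)) FE).
Qed.

Lemma u_phi_cvg0 : u x @[x --> 0^'+] --> 0.
Proof.
have /(continuous_within_itvP _ ltr01) [_ + _] :=
  parameterized_integral_continuous ler01 (ln_phi_integrable (lexx 1)).
by rewrite /parameterized_integral set_itv1 Rintegral_set1.
Qed.

(** Convexity, as u' = [ln_phi] increases. At [r = 0], where [ln_phi] may diverge, the inequality is
    obtained as a limit. *)
Lemma u_phi_tangent r s : 0 <= r -> 0 < s -> lnp s * (r - s) <= u r - u s.
Proof.
move=> r0 s0.
have D x : 0 < x -> is_derive x 1 (fun y => lnp s * y) (lnp s).
  by move=> _; have := @is_deriveZ R R R id (lnp s) x 1 1 (is_derive_id x 1); rewrite /GRing.scale /= mulr1.
have pos x : 0 < x -> lnp s * (x - s) <= u x - u s.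
  move=> x0; have [sx|/ltW xs] := leP s x.
    rewrite mulrBr; apply: (@is_derive_le_increment R (fun y => lnp s * y) u (fun=> lnp s) lnp) => // z /andP[sz zx].
    - exact/D/(lt_le_trans s0).
    - exact/is_derive_u_phi/(lt_le_trans s0).
    - exact/ln_phi_le/ltW.
  suff : u s - u x <= lnp s * s - lnp s * x by lra.
  apply: (@is_derive_le_increment R u (fun y => lnp s * y) lnp (fun=> lnp s)) => // z /andP[sz zx].
  - exact/is_derive_u_phi/(lt_le_trans x0).
  - exact/D/(lt_le_trans x0).
  - by apply: ln_phi_le => //; rewrite ?(lt_trans x0)// ltW.
move: r0; rewrite le_eqVlt => /predU1P[<-|]; last exact: pos.
rewrite u_phi0 !sub0r mulrN lerN2.
have c1 : lnp s * (x - s) @[x --> 0^'+] --> lnp s * (0 - s).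
  apply: cvg_at_right_filter; apply: cvgMr; apply: cvgB; [exact: cvg_id|exact: cvg_cst].
have c2 : u x - u s @[x --> 0^'+] --> 0 - u s.
  by apply: cvgB; [exact: u_phi_cvg0|exact: cvg_cst].
have := ler_cvg_to c1 c2; rewrite !sub0r mulrN lerN2; apply.
by near=> x; apply: pos; near: x; exact: nbhs_right_gt.
Unshelve. all: by end_near. Qed.

Lemma u_phi_le_increment r s : 0 < s -> 0 < r -> u r - u s <= lnp r * (r - s).
Proof.
by move=> s0 r0; have := u_phi_tangent (ltW s0) r0; lra.
Qed.

(* Legendre transform of [u] at [ln s]: its derivative in [s] is [s / phi s],
   and it tends to 0 at 0. *)
Lemma u_phi_legendre_le theta s : theta < 2 ->
  (forall x, 0 < x -> x <= s -> phi s * (x / s) `^ theta <= phi x) ->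
  0 < s -> s * lnp s - u s <= s * (s / phi s) / (2 - theta).
Proof.
move=> th2 H s0.
pose G x := x * lnp x - u x.
have DG x : 0 < x -> is_derive x 1 G (x / phi x).
  move=> x0; have d1 := is_derive_ln_phi phiP x0; have d2 := is_derive_u_phi x0.
  have d3 := @is_deriveM R R id lnp x 1 1 _ (is_derive_id x 1) d1.
  have := is_deriveB d3 d2.
  by rewrite /GRing.scale /= mulr1 addrK.
(* The hypothesis gives x / phi x <= C x^(1 - theta) on (0, s], and [P] is a primitive of this
   power. *)
pose C := s `^ theta / phi s.
have th0 : 2 - theta != 0 by rewrite subr_eq0 gt_eqF.
pose P := fun x : R => C * ((x `^ (2 - theta) - 1) / (2 - theta)).
have DP x : 0 < x -> is_derive x 1 P (C * x `^ (1 - theta)).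
  move=> x0; have := is_derive_powR_primitive th0 x0.
  have -> : 2 - theta - 1 = 1 - theta by lra.
  by move=> d; have := is_deriveZ C d.
have GP x : 0 < x -> x < s -> G s - G x <= P s - P x.
  move=> x0 xs; apply: (@is_derive_le_increment R G P (fun x => x / phi x)
     (fun x => C * x `^ (1 - theta))); first exact: ltW.
  - by move=> z /andP[xz _]; exact/DG/(lt_le_trans x0).
  - by move=> z /andP[xz _]; exact/DP/(lt_le_trans x0).
  - move=> z /andP[xz zs]; have z0 := lt_trans x0 xz.
    have := H _ z0 (ltW zs).
    rewrite powRM ?(ltW z0) ?invr_ge0 ?(ltW s0)// powRB ?(gt_eqF z0) ?implybT//.
    rewrite powRr1 ?(ltW z0)// => Hz.
    have zt : 0 < z `^ theta by rewrite powR_gt0.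
    have st : 0 < s `^ theta by rewrite powR_gt0.
    have pz := phi_gt0 z0; have ps := phi_gt0 s0.
    rewrite /C mulrCA ler_wpM2l ?(ltW z0)// invf_ple ?posrE ?mulr_gt0 ?divr_gt0 ?invr_gt0//.
    apply: le_trans Hz; rewrite le_eqVlt; apply/orP; left; apply/eqP.
    have -> : s^-1 `^ theta = (s `^ theta)^-1.
      by rewrite -(powR_inv1 (ltW s0)) -powRrM mulN1r powRN.
    by rewrite !invfM !invrK mulrA [in RHS]mulrC mulrA; ring.
have Pb x : 0 < x -> P s - P x <= s * (s / phi s) / (2 - theta).
  move=> x0; have -> : P s - P x = C * (s `^ (2 - theta)) / (2 - theta) - C * (x `^ (2 - theta)) / (2 - theta).
    by rewrite /P; field; rewrite subr_eq0 gt_eqF.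
  have -> : C * (s `^ (2 - theta)) = s * (s / phi s).
    rewrite /C mulrAC -powRD; last by rewrite (gt_eqF s0) implybT.
    by rewrite addrC subrK (powR_mulrn 2) ?(ltW s0)// expr2 mulrA.
  rewrite gerBl divr_ge0 ?subr_ge0 ?(ltW th2)// mulr_ge0 ?powR_ge0//.
  by rewrite /C divr_ge0 ?powR_ge0// ltW ?phi_gt0.
(* For x <= 1 the term - x ln_phi x in - G x is nonnegative and is dropped; what remains is [u x],
   which tends to 0. *)
have bound x : 0 < x -> x < s -> x <= 1 -> G s + u x <= s * (s / phi s) / (2 - theta).
  move=> x0 xs x1; apply: le_trans (Pb x x0); apply: le_trans (GP x x0 xs).
  rewrite lerD2l /G opprB lerDl oppr_ge0 mulr_ge0_le0 ?(ltW x0)//.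
  by rewrite -(ln_phi1 phi) ln_phi_le.
have c1 : G s + u x @[x --> 0^'+] --> G s + 0.
  by apply: cvgD; [exact: cvg_cst|exact: u_phi_cvg0].
rewrite -[leLHS]addr0; apply: (ler_cvg_to c1 (cvg_cst _)).
near=> x; apply: bound; near: x; [exact: nbhs_right_gt|exact: nbhs_right_lt|exact: nbhs_right_le].
Unshelve. all: by end_near. Qed.

(** The left side has derivative s / phi(s x) in [x], at most s / phi(s) times x^(-delta) by the
    growth of [phi], and the logarithm of index [2 - delta] is the primitive of x^(-delta). This is
    where that index enters the estimates. *)
Lemma ln_phi_dilation_le delta s x : 0 <= delta ->
  (forall y, s <= y -> phi s * (y / s) `^ delta <= phi y) ->
  0 < s -> 1 <= x -> lnp (s * x) - lnp s <= s / phi s * ln_phi (phi_m (2 - delta)) x.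
Proof.
move=> d0 H s0 x1.
have m2 : 2 - delta <= 2 by rewrite gerBl.
have mP := phi_m_function m2.
have DL (y : R) : 0 < y -> is_derive y 1 (fun y => lnp (s * y)) (s / phi (s * y)).
  move=> y0; have d1 := is_derive_ln_phi phiP (mulr_gt0 s0 y0).
  have d2 := @is_deriveZ R R R id s y 1 1 (is_derive_id y 1).
  have := @is_derive1_comp R lnp (s \*: id) y _ _ d1 d2.
  by rewrite [X in is_derive _ _ _ X]mulrC /GRing.scale /= mulr1.
have DR (y : R) : 0 < y -> is_derive y 1 (fun y => s / phi s * ln_phi (phi_m (2 - delta)) y)
    (s / phi s * y `^ (- delta)).
  move=> y0; have d1 := is_derive_ln_phi mP y0.
  have := is_deriveZ (s / phi s) d1.
  by rewrite /phi_m -powRN subKr.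
have := @is_derive_le_increment R (fun y => lnp (s * y))
  (fun y => s / phi s * ln_phi (phi_m (2 - delta)) y) _ _ 1 x x1
  (fun y yx => DL y (lt_le_trans ltr01 (andP yx).1))
  (fun y yx => DR y (lt_le_trans ltr01 (andP yx).1)).
rewrite mulr1 ln_phi1 mulr0 subr0; apply => y /andP[y1 _].
have y0 := lt_trans ltr01 y1.
have := H (s * y); rewrite ler_peMr ?(ltW s0)// ?(ltW y1)// => /(_ isT).
rewrite [s * y]mulrC mulfK ?gt_eqF// => Hy.
rewrite -mulrA ler_wpM2l ?(ltW s0)// powRN -invfM lef_pV2 ?posrE ?phi_gt0 ?mulr_gt0//.
  by rewrite phi_gt0.
by rewrite powR_gt0.
Qed.

End UPhi.

(** * The exponents theta and delta of an admissible tuple *)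

Section AdmissibleExponents.
Context {R : realType}.
Variable phi : R -> R.
Hypothesis phiP : phi_function phi.

Let phi_gt0 s : 0 < s -> 0 < phi s. Proof. by case: phiP => + _ _; exact. Qed.

Lemma dini_ratio_ge0 s : 0 < s -> (0 <= dini_ratio phi s)%E.
Proof.
move=> s0; apply: mule_ge0; first by rewrite lee_fin divr_ge0 ?(ltW s0)// ltW ?phi_gt0.
apply: le_ereal_inf_tmp => _ [V V0 <-].
have [t [Vt t0]] : exists t, V t /\ 0 < t.
  have P : ProperFilter (0 : R)^'+ by exact: at_right_proper_filter.
  by apply: (@filter_ex _ _ P); apply: filterI => //; exact: nbhs_right_gt.
apply: le_trans (_ : (((phi (s + t) - phi s) / t)%:E <= _)%E).
  rewrite lee_fin divr_ge0 ?(ltW t0)// subr_ge0.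
  by case: phiP => _ + _; apply=> //; rewrite lerDl ltW.
by apply: ereal_sup_ubound; exists t.
Qed.

Lemma dini_ratio_le_theta s : 0 < s -> (dini_ratio phi s <= theta_phi phi)%E.
Proof. by move=> s0; apply: ereal_sup_ubound; exists s => //=; rewrite in_itv /= andbT. Qed.

Lemma dini_ratio_ge_delta s : 0 < s -> (delta_phi phi <= dini_ratio phi s)%E.
Proof. by move=> s0; apply: ereal_inf_lbound; exists s => //=; rewrite in_itv /= andbT. Qed.

(** An infinite [theta_phi] would give N = 0, which lies in neither range as n >= 2. A finite N >= n
    different from 2 exceeds 2, that is, theta - 1 < 1/2; N <= -1 gives theta < 1. *)
Lemma admissible_exponents (n : nat) : (2 <= n)%N ->
  [/\ (-oo < N_phi phi <= (-1)%:E \/ n%:R%:E <= N_phi phi)%E & (N_phi phi != 2%:R%:E)%E] ->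
  exists theta delta : R, [/\ theta_phi phi = theta%:E, delta_phi phi = delta%:E,
    0 <= delta, delta <= theta & theta < 3 / 2].
Proof.
move=> n2 [NP N2].
have t0 : (0 <= theta_phi phi)%E.
  exact: le_trans (dini_ratio_ge0 ltr01) (dini_ratio_le_theta ltr01).
have d0 : (0 <= delta_phi phi)%E.
  apply: le_ereal_inf_tmp => _ [s + <-]; rewrite /= in_itv /= andbT => s0.
  exact: dini_ratio_ge0.
have dt : (delta_phi phi <= theta_phi phi)%E.
  exact: le_trans (dini_ratio_ge_delta ltr01) (dini_ratio_le_theta ltr01).
have [theta thetaE] : exists theta, theta_phi phi = theta%:E.
  move: NP t0; rewrite /N_phi; case: (theta_phi phi) => [r _ _|NP _|//]; first by exists r.
  move: NP; rewrite /= addye// invey => -[/andP[_]|].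
    by rewrite lee_fin lerNr oppr0 ler10.
  by rewrite lee_fin lern0 => /eqP n0; rewrite n0 in n2.
have [delta deltaE] : exists delta, delta_phi phi = delta%:E.
  by move: d0 dt; rewrite thetaE; case: (delta_phi phi) => [r _ _|//|//]; exists r.
exists theta, delta; split=> //.
- by rewrite deltaE lee_fin in d0.
- by rewrite deltaE thetaE lee_fin in dt.
move: NP N2; rewrite /N_phi thetaE eqe; case: eqP => [->|/eqP t1] NP N2; first by lra.
have t1' : theta - 1 != 0 by rewrite subr_eq0.
move: NP N2; rewrite -EFinB inver (negbTE t1') !lee_fin eqe => -[/andP[_]|] NP N2.
  have : theta - 1 < 0 by rewrite -invr_lt0; lra.
  lra.
have n2' : 2 <= (theta - 1)^-1 by apply: le_trans NP; rewrite ler_nat.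
have p0 : 0 < theta - 1 by rewrite -invr_gt0; lra.
have : 2 < (theta - 1)^-1 by rewrite lt_neqAle eq_sym N2.
by rewrite -(ltr_pM2l p0) mulfV//; lra.
Qed.

End AdmissibleExponents.

Section Growth.
Context {R : realType}.
Variables (phi : R -> R) (theta delta : R).
Hypothesis phiP : phi_function phi.
Hypothesis phi1 : phi 1 = 1.
Hypothesis theta_ge0 : 0 <= theta.
Hypothesis thetaP : theta_phi phi = theta%:E.

Let phi_gt0 s : 0 < s -> 0 < phi s. Proof. by case: phiP => + _ _; exact. Qed.

Let dini_theta s : 0 < s -> (dini_ratio phi s <= theta%:E)%E.
Proof. by rewrite -thetaP; exact: dini_ratio_le_theta. Qed.

Lemma phi_ge_power_below s x : 0 < x -> x <= s -> phi s * (x / s) `^ theta <= phi x.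
Proof.
move=> x0 xs; have s0 := lt_le_trans x0 xs.
have := phi_growth_le phiP dini_theta x0 xs.
have -> : x / s = (s / x)^-1 by rewrite invf_div.
have H : 0 < (s / x) `^ theta by rewrite powR_gt0// divr_gt0.
rewrite -(powR_inv1 (ltW (divr_gt0 s0 x0))) -powRrM mulN1r powRN.
by rewrite ler_pdivrMr.
Qed.

Lemma powR_theta_le_phi s : 0 < s -> s <= 1 -> s `^ theta <= phi s.
Proof. by move=> s0 s1; have := phi_ge_power_below s0 s1; rewrite phi1 mul1r divr1. Qed.

Lemma phi_le_powR_theta s : 1 <= s -> phi s <= s `^ theta.
Proof.
by move=> s1; have := phi_growth_le phiP dini_theta ltr01 s1; rewrite phi1 mul1r divr1.
Qed.

Lemma phi_lower_near0 s : theta < 3 / 2 -> 0 < s -> s <= 1 -> s `^ (3 / 2) <= phi s.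
Proof.
move=> t32 s0 s1; apply: le_trans (powR_theta_le_phi s0 s1).
by rewrite ger_powR ?s0// ltW.
Qed.

(** Above 1, [phi] is at most the power of exponent [theta], so its logarithm is larger. This turns
    the admissibility condition on [Psi], stated with L of index 2 - theta, into - Psi < L_phi,
    which makes sigma finite everywhere. *)
Lemma L_phi_power_le : (L_phi (phi_m (2 - theta)) <= L_phi phi)%E.
Proof.
have m2 : 2 - theta <= 2 by rewrite gerBl.
have mP := phi_m_function m2.
apply: ge_ereal_sup => _ [t + <-]; rewrite /= in_itv /= andbT => t0.
have [t1|/ltW t1] := leP 1 t; last first.
  apply: (@le_trans _ _ (ln_phi phi 1)%:E); last exact/ltW/L_phi_gt.
  by rewrite lee_fin (ln_phi1 phi) -(ln_phi1 (phi_m (2 - theta))) ln_phi_le.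
apply: (@le_trans _ _ (ln_phi phi t)%:E); last exact/ltW/L_phi_gt.
rewrite lee_fin -[leLHS]subr0 -[leRHS]subr0 -[X in _ - X <= _](ln_phi1 (phi_m (2 - theta))).
rewrite -[X in _ <= _ - X](ln_phi1 phi).
apply: (@is_derive_le_increment _ _ _ (fun x => (phi_m (2 - theta) x)^-1) (fun x => (phi x)^-1)) => //.
- by move=> x /andP[x1 _]; exact/is_derive_ln_phi/(lt_le_trans ltr01).
- by move=> x /andP[x1 _]; exact/is_derive_ln_phi/(lt_le_trans ltr01).
- move=> x /andP[x1 _]; have x0 := lt_trans ltr01 x1.
  rewrite lef_pV2 ?posrE ?phi_gt0// /phi_m ?powR_gt0// subKr.
  exact/phi_le_powR_theta/ltW.
Qed.

Hypothesis delta_gt0 : 0 < delta.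
Hypothesis deltaP : delta_phi phi = delta%:E.

Let dini_delta s : 0 < s -> (delta%:E <= dini_ratio phi s)%E.
Proof. by rewrite -deltaP; exact: dini_ratio_ge_delta. Qed.

Lemma phi_ge_power_above s x : 0 < s -> s <= x -> phi s * (x / s) `^ delta <= phi x.
Proof. exact: phi_growth_ge. Qed.

Lemma powR_delta_le_phi s : 1 <= s -> s `^ delta <= phi s.
Proof.
by move=> s1; have := phi_ge_power_above ltr01 s1; rewrite phi1 mul1r divr1.
Qed.

(** Below 1, [phi] dominates the power [theta]; above 1, the power [delta]. The factor s^(-eps)
    absorbs the blow-up of s / phi s at 0 when theta > 1, and what exceeds it for large [s] is paid
    by a power of [xi]. With eps = 0 or eps = theta - 1 this is the origin of the powers of xi0 in
    the theorem. *)
Lemma div_phi_le (eps xi s : R) : theta - 1 <= eps -> delta <= 1 + eps -> 0 < s -> s <= xi -> 1 <= xi ->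
  s / phi s <= s `^ (- eps) * xi `^ (1 + eps - delta).
Proof.
move=> te de s0 sxi xi1.
have xi0 := lt_le_trans ltr01 xi1.
have E q : s / s `^ q = s `^ (1 - q).
  by rewrite powRB ?(gt_eqF s0) ?implybT// powRr1 ?(ltW s0).
have [s1|/ltW s1] := leP s 1.
  apply: (@le_trans _ _ (s / s `^ theta)).
    by rewrite ler_wpM2l ?(ltW s0)// lef_pV2 ?posrE ?phi_gt0 ?powR_gt0// powR_theta_le_phi.
  rewrite E; apply: (@le_trans _ _ (s `^ (- eps))).
    by rewrite ger_powR ?s0//; lra.
  rewrite ler_peMr ?powR_ge0// -[leLHS](powRr0 xi) ler_powR//.
  lra.
apply: (@le_trans _ _ (s / s `^ delta)).
  by rewrite ler_wpM2l ?(ltW s0)// lef_pV2 ?posrE ?phi_gt0 ?powR_gt0// powR_delta_le_phi.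
rewrite E; have -> : 1 - delta = - eps + (1 + eps - delta) by lra.
rewrite powRD ?(gt_eqF s0) ?implybT// ler_wpM2l ?powR_ge0//.
by rewrite ge0_ler_powR// ?nnegrE ?(ltW s0) ?(ltW xi0)//; lra.
Qed.

End Growth.

(** * Integration against a density plus a singular part *)

Section Density.
Local Open Scope ereal_scope.
Context d (T : measurableType d) (R : realType) (mu : {measure set T -> \bar R}).
Variable w : T -> R.
Hypothesis mw : measurable_fun setT w.
Hypothesis w0 : forall x, (0 <= w x)%R.

Let dm (A : set T) := \int[mu]_(x in A) (w x)%:E.

Let mEw A : measurable_fun A (EFin \o w).
Proof. exact/measurable_EFinP/measurable_funTS. Qed.

Let dm0 : dm set0 = 0. Proof. by rewrite /dm integral_set0. Qed.

Let dm_ge0 A : 0 <= dm A.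
Proof. by apply: integral_ge0 => x _; rewrite lee_fin. Qed.

Let dm_sigma_additive : semi_sigma_additive dm.
Proof.
move=> /= F mF tF mUF; rewrite /dm; apply: cvg_toP.
  apply: ereal_nondecreasing_is_cvgn => m n mn.
  by apply: lee_sum_nneg_natr => // k _ _; exact: dm_ge0.
rewrite ge0_integral_bigcup//=.
by move=> x _; rewrite lee_fin.
Qed.

HB.instance Definition _ := isMeasure.Build _ _ _ dm dm0 dm_ge0 dm_sigma_additive.

Import HBNNSimple.

Let integral_dm_nnsfun (h : {nnsfun T >-> R}) :
  \int[dm]_x (h x)%:E = \int[mu]_x ((h x)%:E * (w x)%:E).
Proof.
transitivity (\int[dm]_x
   (\sum_(y \in range h) (y * \1_(h @^-1` [set y]) x)%:E)).
  by apply: eq_integral => t tE; rewrite /= fimfunE -fsumEFin.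
have indich r : measurable_fun setT (fun x => (r * \1_(h @^-1` [set r]) x)%:E).
  by apply: (measurable_comp measurableT) => //; exact: measurable_funM.
rewrite ge0_integral_fsum//; last by move=> m y Ey; exact: nnfun_muleindic_ge0.
transitivity (\int[mu]_x (\sum_(y \in range h)
    (y * \1_(h @^-1` [set y]) x)%:E * (w x)%:E)); last first.
  apply: eq_integral => x xE.
  rewrite -ge0_mule_fsuml => [|y]; last exact: nnfun_muleindic_ge0.
  by rewrite fsumEFin // -(fimfunE _ x).
rewrite ge0_integral_fsum//; last 2 first.
  - move=> y; apply: emeasurable_funM => //; exact: mEw.
  - move=> m y Ey; apply: mule_ge0; last by rewrite lee_fin.
    by rewrite EFinM nnfun_muleindic_ge0.
apply: eq_fsbigr => r rhn.
under [LHS]eq_integral do rewrite EFinM.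
rewrite integralZl_indic_nnsfun => //.
under [RHS]eq_integral do rewrite EFinM -muleA.
rewrite ge0_integralZl//.
- under [in RHS]eq_integral do rewrite muleC.
  rewrite [in RHS](eq_integral ((EFin \o w) \_ (h @^-1` [set r]))); last first.
    by move=> x xE; rewrite epatch_indic.
  rewrite -integral_mkcond integral_indic// setIT; congr (_ * _).
- apply: emeasurable_funM; first exact/measurable_EFinP.
  exact: mEw.
- by move=> t Et; rewrite mule_ge0 ?lee_fin.
- by move: rhn; rewrite inE => -[t _ <-]; rewrite lee_fin.
Qed.

Let integral_dm (f : T -> \bar R) : (forall x, 0 <= f x) -> measurable_fun setT f ->
  \int[dm]_x f x = \int[mu]_x (f x * (w x)%:E).
Proof.
move=> f0 mf; pose h := nnsfun_approx measurableT mf.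
have -> : \int[dm]_x f x = lim (\int[dm]_x (h n x)%:E @[n --> \oo]).
  have fE x : f x = lim ((h n x)%:E @[n --> \oo]).
    by apply/esym/cvg_lim => //; exact: cvg_nnsfun_approx.
  under eq_integral => x _ do rewrite fE.
  apply: monotone_convergence => //.
  - by move=> n; exact/measurable_EFinP/measurable_funP.
  - by move=> n x Ex //=; rewrite lee_fin.
  - by move=> x Ex a b ab; rewrite lee_fin; exact/lefP/nd_nnsfun_approx.
have -> : \int[mu]_x (f x * (w x)%:E) = lim (\int[mu]_x ((h n x)%:E * (w x)%:E) @[n --> \oo]).
  have fg x : f x * (w x)%:E = lim (((h n x)%:E * (w x)%:E) @[n --> \oo]).
    by apply/esym/cvg_lim => //; apply: cvgeZr => //; exact: cvg_nnsfun_approx.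
  under eq_integral => x _ do rewrite fg.
  apply: monotone_convergence => [//| | |].
  - move=> n; apply/emeasurable_funM; last exact: mEw.
    exact/measurable_EFinP/measurable_funP.
  - by move=> n x Ex /=; rewrite mule_ge0 ?lee_fin.
  - by move=> x Ex a b ab/=; rewrite lee_wpmul2r ?lee_fin//; exact/lefP/nd_nnsfun_approx.
by under eq_fun do rewrite integral_dm_nnsfun.
Qed.

Lemma ge0_integral_decomposition (nu mus : {measure set T -> \bar R}) (f : T -> \bar R) :
  (forall A, measurable A -> nu A = \int[mu]_(x in A) (w x)%:E + mus A) ->
  (forall x, 0 <= f x) -> measurable_fun setT f ->
  \int[nu]_x f x = \int[mu]_x (f x * (w x)%:E) + \int[mus]_x f x.
Proof.
move=> nuE f0 mf; rewrite -integral_dm// -ge0_integral_measure_add//.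
apply: eq_measure_integral => A mA _.
by rewrite nuE//; exact/esym/measure_addE.
Qed.

(** The alternatives match the two cases of the entropy: L_phi infinite, where a nonzero singular
    part has infinite cost, and L_phi finite, where h'_phi(sigma) <= 0. In both, the positive part
    of [f] has integral zero against [mus]. *)
Lemma integral_decomposition_le (nu mus : {measure set T -> \bar R}) (f : T -> R) :
  (forall A, measurable A -> nu A = \int[mu]_(x in A) (w x)%:E + mus A) ->
  (mus setT = 0 \/ forall x, (f x <= 0)%R) ->
  nu.-integrable setT (EFin \o f) ->
  mu.-integrable setT (fun x => (f x * w x)%:E) /\
  \int[nu]_x (f x)%:E <= \int[mu]_x (f x * w x)%:E.
Proof.
move=> nuE H fi; have mf : measurable_fun setT f.
  exact/measurable_EFinP/(measurable_int nu).
have maf : measurable_fun setT (fun x => `|(f x)%:E|) by exact/measurableT_comp/measurable_EFinP.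
have fin : \int[mu]_x (`|(f x)%:E| * (w x)%:E) + \int[mus]_x `|(f x)%:E| < +oo.
  rewrite -(ge0_integral_decomposition nuE (f := fun x => `|(f x)%:E|))//.
  by case/integrableP : fi.
have fwi : mu.-integrable setT (fun x => (f x * w x)%:E).
  apply/integrableP; split; first exact/measurable_EFinP/measurable_funM.
  apply: le_lt_trans fin.
  have -> : \int[mu]_x `|(f x * w x)%:E| = \int[mu]_x (`|(f x)%:E| * (w x)%:E).
    by apply: eq_integral => x _; rewrite /= normrM (ger0_norm (w0 x)) EFinM.
  by rewrite leeDl// integral_ge0.
split=> //.
have pos0 : \int[mus]_x ((EFin \o f)^\+ x) = 0.
  case: H => [m0|f0].
    have mz A : measurable A -> A `<=` setT -> mus A = mzero A.
      move=> mA _; rewrite /mzero; apply/eqP; rewrite eq_le measure_ge0 andbT.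
      by rewrite -m0 le_measure ?inE.
    by rewrite (eq_measure_integral _ mz) integral_measure_zero.
  apply: integral0_eq => x _ /=; rewrite funeposE.
  by apply/max_idPr; rewrite lee_fin.
have fposE x : (EFin \o f)^\+ x * (w x)%:E = (fun x => (f x * w x)%:E)^\+ x.
  by rewrite !funeposE /= -!EFin_max -EFinM maxr_pMl// mul0r.
have fnegE x : (EFin \o f)^\- x * (w x)%:E = (fun x => (f x * w x)%:E)^\- x.
  by rewrite !funenegE /= -!EFin_max -EFinM maxr_pMl// mul0r mulNr.
rewrite integralE [leRHS]integralE.
rewrite (ge0_integral_decomposition nuE (f := (EFin \o f)^\+))//; last 1 first.
  by apply: measurable_funepos; exact/measurable_EFinP.
rewrite (ge0_integral_decomposition nuE (f := (EFin \o f)^\-))//; last 1 first.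
  by apply: measurable_funeneg; exact/measurable_EFinP.
rewrite pos0 adde0.
under eq_integral do rewrite fposE.
under [X in _ - (X + _)]eq_integral do rewrite fnegE.
rewrite leeD2l// leeN2 leeDl// integral_ge0//.
Qed.

(** Equality comes from the previous inequality for [f] and for its opposite, with zero singular
    part. *)
Lemma integral_density (nu : {measure set T -> \bar R}) (f : T -> R) :
  (forall A, measurable A -> nu A = \int[mu]_(x in A) (w x)%:E) ->
  measurable_fun setT f ->
  mu.-integrable setT (fun x => (f x * w x)%:E) ->
  nu.-integrable setT (EFin \o f) /\
  \int[nu]_x (f x)%:E = \int[mu]_x (f x * w x)%:E.
Proof.
move=> nuE mf fwi.
have nuE0 A : measurable A -> nu A = \int[mu]_(x in A) (w x)%:E + (@mzero _ T R) A.
  by move=> mA; rewrite nuE// adde0.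
have fi : nu.-integrable setT (EFin \o f).
  apply/integrableP; split; first exact/measurable_EFinP.
  have maf : measurable_fun setT (fun x => `|(f x)%:E|) by exact/measurableT_comp/measurable_EFinP.
  rewrite [X in X < _](ge0_integral_decomposition nuE0 (f := fun x => `|(f x)%:E|))//.
  rewrite integral_measure_zero adde0.
  case/integrableP : fwi => _; apply: le_lt_trans.
  have -> : \int[mu]_x (`|(f x)%:E| * (w x)%:E) = \int[mu]_x `|(f x * w x)%:E|; last by [].
  by apply: eq_integral => x _; rewrite /= normrM (ger0_norm (w0 x)) EFinM.
split=> //; apply/eqP; rewrite eq_le.
have [_ ->] := integral_decomposition_le nuE0 (or_introl erefl) fi.
have fiN : nu.-integrable setT (EFin \o (\- f)%R).
  exact: (integrableN fi).
have [fwiN] := integral_decomposition_le nuE0 (or_introl erefl) fiN.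
have -> : \int[nu]_x ((\- f)%R x)%:E = - \int[nu]_x (f x)%:E.
  by rewrite -integralN//; exact: integrable_add_def.
have -> : \int[mu]_x ((\- f)%R x * w x)%:E = - \int[mu]_x (f x * w x)%:E.
  rewrite -integralN/=; first by apply: eq_integral => x _; rewrite mulNr.
  exact: integrable_add_def.
by rewrite leeN2 => ->.
Qed.

End Density.

(** * The relative entropy *)

Section Entropy.
Context {R : realType} {M : ptopologicalType}.
Variables (omega : {measure set (borel M) -> \bar R}) (nu : probability (borel M) R).
Variables (phi : R -> R) (Psi : M -> R).
Hypothesis phiP : phi_function phi.
Hypothesis phi_lb : forall s, 0 < s -> s <= 1 -> s `^ (3 / 2) <= phi s.
Hypothesis Psi_continuous : continuous Psi.
Hypothesis PsiL : forall x, ((- Psi x)%:E < L_phi phi)%E.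
Hypothesis nuP : has_density omega nu (sigma phi Psi).

Notation sg := (fun x => fine (sigma phi Psi x)).
Notation lnp := (ln_phi phi).
Notation u := (u_phi phi).

Hypothesis int_h : omega.-integrable setT (fun x => (h_phi phi (sg x))%:E).
Hypothesis int_ln : omega.-integrable setT (fun x => (sg x * lnp (sg x))%:E).

Let phi_gt0 s : 0 < s -> 0 < phi s. Proof. by case: phiP => + _ _; exact. Qed.

Lemma sigma_cases x :
  [/\ 0 < sg x, lnp (sg x) = - Psi x, x \in Mpsi phi Psi & sigma phi Psi x = (sg x)%:E] \/
  [/\ sg x = 0, sigma phi Psi x = 0%E, x \notin Mpsi phi Psi &
      ((- Psi x)%:E <= l_phi phi)%E].
Proof.
have [[xl E]|[t t0 [tE E]]] := exp_phi_cases phiP (PsiL x).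
  right; rewrite /sigma E; split=> //; apply/negP; rewrite inE /Mpsi /= => /andP[_].
  by rewrite lteNr -EFinN ltNge xl.
left; rewrite /sigma E /=; split=> //; rewrite inE /Mpsi /= lteNl -EFinN -tE L_phi_gt//=.
by rewrite lteNr -EFinN -tE l_phi_lt.
Qed.

Lemma sigma_ge0 x : 0 <= sg x.
Proof. by have [[/ltW]|[->]] := sigma_cases x. Qed.

Lemma sigmaE x : sigma phi Psi x = (sg x)%:E.
Proof. by have [[]|[-> ->]] := sigma_cases x. Qed.

(** Sublevel sets of sigma become sublevel sets of - Psi, whence the measurability of sigma. *)
Lemma sigma_lt x y : (sg x < y) = (0 < y) && (- Psi x < lnp y).
Proof.
have [y0|y0] := ltP 0 y; last first.
  by apply/negbTE; rewrite -leNgt (le_trans y0) ?sigma_ge0.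
have [[s0 <- _ _]|[-> _ _ xl]] := sigma_cases x; last first.
  by rewrite y0 /=; apply/esym; rewrite -lte_fin (le_lt_trans xl)// l_phi_lt.
apply/idP/idP => [|]; first exact: ln_phi_lt.
by apply: contraTT; rewrite -!leNgt => /(ln_phi_le phiP y0).
Qed.

Let measurable_open (A : set M) : open A -> measurable (A : set (borel M)).
Proof. by move=> oA; exact: sub_sigma_algebra. Qed.

Lemma measurable_Psi : measurable_fun setT (Psi : borel M -> R).
Proof.
apply: (measurability (@RGenOpens.G R)) => [|/= _ [_] [a [b ->] <-]].
  exact: RGenOpens.measurableE.
rewrite setTI; apply: measurable_open.
by apply: open_comp; [move=> x _; exact: Psi_continuous|exact: interval_open].
Qed.

Lemma measurable_sigma : measurable_fun setT (sg : borel M -> R).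
Proof.
apply: (measurability (@RGenInftyO.G R)) => [|/= _ [_] [y ->] <-].
  exact: RGenInftyO.measurableE.
rewrite setTI; have [y0|y0] := ltP 0 y.
  have -> : (sg : borel M -> R) @^-1` `]-oo, y[ = (fun x => - Psi x) @^-1` `]-oo, lnp y[.
    by apply/seteqP; split=> x /=; rewrite !in_itv /= sigma_lt y0.
  rewrite -[X in measurable X]setTI.
  by apply: (measurableT_comp (@oppr_measurable R setT) measurable_Psi) => //; exact: measurable_itv.
have -> : (sg : borel M -> R) @^-1` `]-oo, y[ = set0; last exact: measurable0.
by apply/seteqP; split=> x //=; rewrite in_itv /= sigma_lt ltNge y0.
Qed.

(* [fine] loses nothing: a point outside [Mpsi] forces [l_phi] to be finite. *)
Definition log_sigma (x : M) : R :=
  if x \in Mpsi phi Psi then - Psi x else fine (l_phi phi).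

(** The shift occurring in [h_phi], with 0 for no shift, so that a single formula covers both cases
    of that definition. *)
Definition L_const : R := if L_phi phi == +oo%E then 0 else fine (L_phi phi).

Lemma log_sigma_outside x : x \notin Mpsi phi Psi -> l_phi phi = (log_sigma x)%:E.
Proof.
move=> xM; rewrite /log_sigma (negbTE xM); have [[_ _ +]|[_ _ _ xl]] := sigma_cases x.
  by rewrite (negbTE xM).
rewrite fineK// fin_real// (lt_le_trans _ xl) ?ltNyr//=.
by rewrite (lt_trans (l_phi_lt phiP ltr01)) ?ltry.
Qed.

Lemma L_phi_gt0 : (0 < L_phi phi)%E.
Proof. by have := L_phi_gt phiP ltr01; rewrite (ln_phi1 phi). Qed.

Lemma L_phi_const : L_phi phi != +oo%E -> L_phi phi = L_const%:E.
Proof.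
rewrite /L_const => Ly; rewrite (negbTE Ly) fineK//.
by rewrite ge0_fin_numE ?ltW ?L_phi_gt0// lt_neqAle Ly leey.
Qed.

Lemma h_phiE r : h_phi phi r = u r - r * L_const.
Proof. by rewrite /h_phi /L_const; case: ifP => //; rewrite mulr0 subr0. Qed.

Lemma dh_sigmaE x : dh_sigma phi Psi x = (log_sigma x - L_const)%:E.
Proof.
rewrite /dh_sigma; case: ifPn => xM; last first.
  rewrite (log_sigma_outside xM); case: ifPn => [/eqP LE|/L_phi_const -> //].
  by rewrite /L_const LE eqxx subr0.
have [[s0 sE _ _]|[_ _ +]] := sigma_cases x; last by rewrite xM.
rewrite /log_sigma xM -sE; congr EFin.
have -> : h_phi phi = (fun r => u r - r * L_const) by apply/funext => r; rewrite h_phiE.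
rewrite derive1E.
have d1 := is_derive_u_phi phiP phi_lb s0.
have d2 : is_derive (sg x : R) 1 (L_const \*: (id : R -> R)) (L_const *: 1).
  exact: is_deriveZ.
have d3 := is_deriveB d1 d2.
have -> : (fun r => u r - r * L_const) = u - (L_const \*: id).
  by apply/funext => r; rewrite mulrC.
by case: d3 => _ ->; rewrite /GRing.scale /= mulr1.
Qed.

Lemma measurable_Mpsi : measurable (Mpsi phi Psi : set (borel M)).
Proof.
have -> : (Mpsi phi Psi : set (borel M)) = (sg : borel M -> R) @^-1` `]0, +oo[.
  apply/seteqP; split=> x /=; rewrite in_itv /= andbT.
    by move=> /mem_set xM; have [[]//|[_ _ /negP]] := sigma_cases x.
  by move=> s0; have [[_ _ /set_mem]//|[s00]] := sigma_cases x; rewrite s00 ltxx in s0.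
by rewrite -[X in measurable X]setTI; apply: measurable_sigma => //; exact: measurable_itv.
Qed.

Lemma measurable_log_sigma : measurable_fun setT (log_sigma : borel M -> R).
Proof.
apply: measurable_fun_ifT => //.
  apply: (measurable_fun_bool true); rewrite setTI.
  have -> : (fun x : borel M => x \in Mpsi phi Psi) @^-1` [set true] = Mpsi phi Psi.
    by apply/seteqP; split=> x /=; [move/set_mem|move/mem_set].
  exact: measurable_Mpsi.
exact: (measurableT_comp (@oppr_measurable R setT) measurable_Psi).
Qed.

Lemma measurable_u_phi : measurable_fun setT u.
Proof.
have -> : [set: R] = `]-oo, 0] `|` `]0, +oo[.
  by apply/seteqP; split=> // x _ /=; rewrite !in_itv /= andbT; case: (leP x 0); [left|right].
apply/measurable_funU; [exact: measurable_itv|exact: measurable_itv|split].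
  have E0 : {in (`]-oo, 0]%classic : set R), (cst 0 : R -> R) =1 u}.
    move=> x; rewrite inE /= in_itv /= le_eqVlt => /predU1P[->|x0].
      by rewrite u_phi0.
    by rewrite u_phi_neg.
  by apply: (eq_measurable_fun _ E0); exact: measurable_cst.
apply: open_continuous_measurable_fun; first exact: interval_open.
move=> x /[!inE] /=; rewrite in_itv /= andbT => x0.
exact: (is_derive_continuous (is_derive_u_phi phiP phi_lb x0)).
Qed.

(** Meant for the zeros of sigma: there [l_phi] is finite and is a subgradient of [u] at 0, which
    replaces the tangent at sigma in Young's inequality. *)
Lemma u_phi_ge_linear (c r : R) : (forall t, 0 < t -> c <= lnp t) -> 0 <= r -> r * c <= u r.
Proof.
move=> cl; rewrite le_eqVlt => /predU1P[<-|r0]; first by rewrite mul0r u_phi0.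
have c1 : u r - u x - c * (r - x) @[x --> 0^'+] --> u r - 0 - c * (r - 0).
  apply: cvgB; first by apply: cvgB; [exact: cvg_cst|exact: u_phi_cvg0].
  apply: cvg_at_right_filter; apply: cvgMr; apply: cvgB; [exact: cvg_cst|exact: cvg_id].
suff : 0 <= u r - 0 - c * (r - 0) by rewrite !subr0 subr_ge0 mulrC.
apply: (cvgr_to_ge c1); near=> x.
have x0 : 0 < x by near: x; exact: nbhs_right_gt.
have xr : x <= r by near: x; exact: nbhs_right_le.
rewrite subr_ge0; apply: le_trans (u_phi_tangent phiP phi_lb (ltW r0) x0).
by rewrite ler_wpM2r ?subr_ge0// cl.
Unshelve. all: by end_near. Qed.

(* Minimal value of [u r - r ln sigma] over [r >= 0], attained at [sigma]. *)
Definition young_min (x : M) : R := u (sg x) - sg x * log_sigma x.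

Lemma log_sigma_pos x : 0 < sg x -> log_sigma x = lnp (sg x).
Proof.
have [[_ sE xM _] _|[-> _ _ _]] := sigma_cases x; last by rewrite ltxx.
by rewrite /log_sigma xM sE.
Qed.

Lemma young_min_le x r : 0 <= r -> young_min x <= u r - r * log_sigma x.
Proof.
move=> r0; rewrite /young_min; have [[s0 _ _ _]|[-> _ xM _]] := sigma_cases x.
  rewrite (log_sigma_pos s0); have := u_phi_tangent phiP phi_lb r0 s0; lra.
rewrite u_phi0 mul0r subr0 subr_ge0; apply: u_phi_ge_linear => // t t0.
by rewrite -lee_fin -(log_sigma_outside xM) ltW// l_phi_lt.
Qed.

Lemma integrable_sigma : omega.-integrable setT (fun x => (sg x)%:E).
Proof.
apply/integrableP; split.
  exact: (measurable_EFinP _ _).2 measurable_sigma.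
have -> : (\int[omega]_x `|(sg x)%:E| = \int[omega]_x (sigma phi Psi x))%E.
  by apply: eq_integral => x _; rewrite (sigmaE x) /= (ger0_norm (sigma_ge0 x)).
rewrite -nuP//; apply: (@le_lt_trans _ _ 1%E); last exact: ltry.
exact: (@probability_le1 _ _ _ nu setT).
Qed.

Lemma integrable_sigma_log : omega.-integrable setT (fun x => (sg x * log_sigma x)%:E).
Proof.
apply: eq_integrable int_ln => // x _; congr EFin.
have [[s0 _ _ _]|[-> _ _ _]] := sigma_cases x; first by rewrite (log_sigma_pos s0).
by rewrite !mul0r.
Qed.

Lemma integrable_young_min : omega.-integrable setT (fun x => (young_min x)%:E).
Proof.
have -> : (fun x => (young_min x)%:E) =
   ((fun x => (h_phi phi (sg x))%:E) \+ (fun x => L_const%:E * (sg x)%:E) \- (fun x => (sg x * log_sigma x)%:E))%E.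
  apply/funext => x.
  rewrite -[RHS]/((h_phi phi (sg x) + L_const * sg x - sg x * log_sigma x)%:E).
  by rewrite /young_min h_phiE; congr EFin; lra.
apply: integrableB => //; last exact: integrable_sigma_log.
by apply: integrableD => //; apply: integrableZl => //; exact: integrable_sigma.
Qed.

Definition entropy_min : R := fine (\int[omega]_x (young_min x)%:E)%E.

Lemma entropy_minE : (\int[omega]_x (young_min x)%:E = entropy_min%:E)%E.
Proof. by rewrite /entropy_min fineK//; apply: integrable_fin_num => //; exact: integrable_young_min. Qed.

Let measurable_dh : measurable_fun setT ((fun x => log_sigma x - L_const) : borel M -> R).
Proof. by apply: measurable_funB; [exact: measurable_log_sigma|exact: measurable_cst]. Qed.

Let dh_fun : dh_sigma phi Psi = (fun x => (log_sigma x - L_const)%:E).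
Proof. by apply/funext => x; rewrite dh_sigmaE. Qed.

(** The constant [L_const] cancels between h(rho) and rho h'(sigma). *)
Let young_dual rho x : u rho - rho * log_sigma x = h_phi phi rho - (log_sigma x - L_const) * rho.
Proof. by rewrite h_phiE; lra. Qed.

Lemma log_sigma_lt_L x : L_phi phi != +oo%E -> log_sigma x - L_const <= 0.
Proof.
move=> Ly; rewrite subr_le0 -lee_fin -L_phi_const// /log_sigma; case: ifPn => xM.
  exact/ltW.
rewrite fineK ?ltW//; last by rewrite (log_sigma_outside xM).
exact: lt_trans (l_phi_lt phiP ltr01) (L_phi_gt phiP ltr01).
Qed.

(** Wherever the definition does not yield a finite value, including the default of [xget] and a
    nonzero singular part when L_phi is infinite, it yields +oo. Otherwise
    [integral_decomposition_le] reduces the claim to the pointwise bound [young_min_le]. *)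
Lemma relative_entropy_ge (mu : probability (borel M) R) :
  (entropy_min%:E <= relative_entropy omega phi Psi mu)%E.
Proof.
rewrite /relative_entropy; case: xgetP => [v -> [rho [mus [[mrho rho0 _ muE] ->]]]|_]; last exact: leey.
case: ifPn => [/asboolP[ih id_]|_]; last exact: leey.
have hfin := integrable_fin_num measurableT ih.
have dfin := integrable_fin_num measurableT id_.
have [Ly|Ly] := eqVneq (L_phi phi) +oo%E.
  have [m0|m0] := eqVneq (mus setT) 0%E; last first.
    have mgt : (0 < mus setT)%E by rewrite lt_neqAle eq_sym m0 measure_ge0.
    rewrite /dh_phi_oo Ly eqxx gt0_mulye// addey ?leey//.
    have : (\int[omega]_x (h_phi phi (rho x))%:E - \int[mu]_x dh_sigma phi Psi x)%E \is a fin_num.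
      by rewrite fin_numB hfin dfin.
    by rewrite fin_numE => /andP[].
  rewrite m0 mule0 adde0.
  move: id_; rewrite dh_fun => id_.
  have [fr le_] := @integral_decomposition_le _ _ R omega rho mrho rho0 mu mus _ muE (or_introl m0) id_.
  rewrite -entropy_minE.
  apply: (@le_trans _ _ (\int[omega]_x (h_phi phi (rho x))%:E - \int[omega]_x ((log_sigma x - L_const) * rho x)%:E)%E).
    rewrite -integralB_EFin//; apply: le_integral => //; first exact: integrable_young_min.
      exact: integrableB.
    by move=> x _; rewrite -EFinB lee_fin -young_dual young_min_le.
  by rewrite leeB.
rewrite /dh_phi_oo (negbTE Ly) mul0e adde0.
move: id_; rewrite dh_fun => id_.
have [fr le_] := @integral_decomposition_le _ _ R omega rho mrho rho0 mu mus _ muE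
  (or_intror (fun x => log_sigma_lt_L x Ly)) id_.
rewrite -entropy_minE.
apply: (@le_trans _ _ (\int[omega]_x (h_phi phi (rho x))%:E - \int[omega]_x ((log_sigma x - L_const) * rho x)%:E)%E).
  rewrite -integralB_EFin//; apply: le_integral => //; first exact: integrable_young_min.
    exact: integrableB.
  by move=> x _; rewrite -EFinB lee_fin -young_dual young_min_le.
by rewrite leeB.
Qed.

(* The Lebesgue decomposition of a measure with a density is unique, so the
   value selected in [relative_entropy] is the one computed from the density. *)
Lemma relative_entropy_density (mu : probability (borel M) R) (rho : borel M -> R) :
  measurable_fun setT rho -> (forall x, 0 <= rho x) ->
  (forall A : set (borel M), measurable A -> mu A = (\int[omega]_(x in A) (rho x)%:E)%E) ->
  omega.-integrable setT (fun x => (u (rho x) - rho x * log_sigma x)%:E) ->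
  omega.-integrable setT (fun x => (rho x * log_sigma x)%:E) ->
  relative_entropy omega phi Psi mu =
  (\int[omega]_x (u (rho x) - rho x * log_sigma x)%:E)%E.
Proof.
move=> mrho rho0 muE iz il.
have irho : omega.-integrable setT (fun x => (rho x)%:E).
  apply/integrableP; split; first exact: (measurable_EFinP _ _).2 mrho.
  have -> : (\int[omega]_x `|(rho x)%:E| = \int[omega]_x (rho x)%:E)%E.
    by apply: eq_integral => x _; rewrite /= ger0_norm.
  rewrite -muE//; apply: (@le_lt_trans _ _ 1%E); last exact: ltry.
  exact: (@probability_le1 _ _ _ mu setT).
have ifr : omega.-integrable setT (fun x => ((log_sigma x - L_const) * rho x)%:E).
  have -> : (fun x => ((log_sigma x - L_const) * rho x)%:E) =
      ((fun x => (rho x * log_sigma x)%:E) \- (fun x => L_const%:E * (rho x)%:E))%E.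
    apply/funext => x; rewrite -[RHS]/((rho x * log_sigma x - L_const * rho x)%:E).
    by congr EFin; lra.
  by apply: integrableB => //; exact: integrableZl.
have ih : omega.-integrable setT (fun x => (h_phi phi (rho x))%:E).
  have -> : (fun x => (h_phi phi (rho x))%:E) =
      ((fun x => (u (rho x) - rho x * log_sigma x)%:E) \+
       (fun x => ((log_sigma x - L_const) * rho x)%:E))%E.
    apply/funext => x; rewrite -[RHS]/((u (rho x) - rho x * log_sigma x + (log_sigma x - L_const) * rho x)%:E).
    by rewrite young_dual; congr EFin; lra.
  exact: integrableD.
have [idh dhE] := integral_density mrho rho0 muE measurable_dh ifr.
have mh : measurable_fun setT (h_phi phi).
  have -> : h_phi phi = (fun r => u r - r * L_const) by apply/funext => r; rewrite h_phiE.
  by apply: measurable_funB; [exact: measurable_u_phi|exact: measurable_funM].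
rewrite /relative_entropy; case: xgetP => [v -> [rho' [mus [[mrho' rho'0 [N [mN oN musN]] muE'] ->]]]|none]; last first.
  exfalso; apply: (none (if `[< omega.-integrable setT (fun x => (h_phi phi (rho x))%:E) /\
               mu.-integrable setT (dh_sigma phi Psi) >]
        then (\int[omega]_x (h_phi phi (rho x))%:E
             - \int[mu]_x dh_sigma phi Psi x
             + dh_phi_oo phi * (@mzero _ (borel M) R) setT)%E
        else +oo%E)).
  exists rho, (@mzero _ (borel M) R); split=> //; split=> //.
    by exists set0; split=> //; exact: measure0.
  by move=> A mA; rewrite muE// /mzero adde0.
(* The set [N] carrying [mus] is omega-null, hence mu-null since [mu] has a density, and [mus N] is
   at most [mu N]. *)
have mus0 (A : set (borel M)) : measurable A -> mus A = 0%E.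
  have musN0 : mus N = 0%E.
    have mu0 : mu N = 0%E.
      by rewrite muE//; apply: null_set_integral => //; apply/measurable_EFinP; exact: measurable_funTS.
    apply/eqP; rewrite eq_le measure_ge0 andbT.
    move: (muE' N mN); rewrite [X in X = _ -> _]mu0 => ->.
    by rewrite leeDr//; apply: integral_ge0 => x _; rewrite lee_fin.
  have musT : mus setT = 0%E.
    have := measureU mus (measurableC mN) mN (setICl N).
    rewrite setvU => ->; transitivity (0 + 0 : \bar R)%E; last by rewrite adde0.
    by congr (_ + _)%E.
  move=> mA; apply/eqP; rewrite eq_le measure_ge0 andbT -musT.
  by rewrite le_measure ?inE.
have rr : ae_eq omega setT (EFin \o rho) (EFin \o rho').
  apply: integral_ae_eq => //; first exact/measurable_EFinP.
  by move=> E _ mE; rewrite -[LHS]muE// muE'// mus0// adde0.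
have hh : ae_eq omega setT (fun x => (h_phi phi (rho x))%:E) (fun x => (h_phi phi (rho' x))%:E).
  by apply: filterS rr => x /(_ I) [] rE _; rewrite rE.
have mh1 : measurable_fun setT (fun x => (h_phi phi (rho x))%:E).
  by apply/measurable_EFinP; exact: measurableT_comp.
have mh2 : measurable_fun setT (fun x : borel M => (h_phi phi (rho' x))%:E).
  by apply/measurable_EFinP; exact: measurableT_comp.
have ih' : omega.-integrable setT (fun x : borel M => (h_phi phi (rho' x))%:E).
  apply/integrableP; split=> //.
  case/integrableP : (ih) => _; congr (_ < _)%E; apply: ae_eq_integral => //.
  - exact: measurableT_comp.
  - exact: measurableT_comp.
  - by apply: filterS hh => x /(_ I) hE _; rewrite hE.
rewrite dh_fun ifT; last exact/asboolP.
rewrite mus0// mule0 adde0 dhE -(ae_eq_integral _ _ measurableT mh1 mh2 hh) -integralB_EFin//.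
by apply: eq_integral => x _; rewrite -EFinB -young_dual.
Qed.

Variables theta delta : R.
Hypothesis theta_lt2 : theta < 2.
Hypothesis delta_ge0 : 0 <= delta.
Hypothesis phi_below : forall s x, 0 < x -> x <= s -> phi s * (x / s) `^ theta <= phi x.
Hypothesis phi_above : forall s x, 0 < s -> s <= x -> phi s * (x / s) `^ delta <= phi x.

Notation Lam := (ln_phi (phi_m (2 - delta))).

(** This is sigma^2 / phi(sigma); the outer factor makes it 0 at the zeros of sigma, whatever the
    value of [phi] at 0. *)
Definition phi_weight (x : M) : R := sg x * (sg x / phi (sg x)).

Lemma phi_weight_ge0 x : 0 <= phi_weight x.
Proof.
rewrite /phi_weight; have [[s0 _ _ _]|[-> _ _ _]] := sigma_cases x; last by rewrite mul0r.
by rewrite mulr_ge0 ?divr_ge0 ?(ltW s0)// ltW ?phi_gt0.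
Qed.

(** By convexity, u(s k) - u(s) <= (s k - s) ln_phi(s k), so the excess is at most (s k - s)
    (ln_phi(s k) - ln_phi(s)), to which the dilation bound applies. *)
Lemma young_excess_inside x k : 1 <= k ->
  u (sg x * k) - sg x * k * log_sigma x <= young_min x + (k - 1) * Lam k * phi_weight x.
Proof.
move=> k1; have k0 := lt_le_trans ltr01 k1.
rewrite /young_min /phi_weight; have [[s0 _ _ _]|[-> _ _ _]] := sigma_cases x; last first.
  by rewrite !mul0r mulr0 addr0.
rewrite (log_sigma_pos s0); move: s0; set s := sg x => s0.
have H1 := u_phi_le_increment phiP phi_lb s0 (mulr_gt0 s0 k0).
have H2 := ln_phi_dilation_le phiP delta_ge0 (fun y => @phi_above s y s0) s0 k1.
have H3 : (s * k - s) * (lnp (s * k) - lnp s) <= (s * k - s) * (s / phi s * Lam k).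
  by rewrite ler_wpM2l// subr_ge0 ler_peMr// ltW.
have -> : (k - 1) * Lam k * (s * (s / phi s)) = (s * k - s) * (s / phi s * Lam k) by ring.
lra.
Qed.

(** Where the density is cut to 0 the excess is - young_min, the Legendre transform s ln_phi(s) -
    u(s). *)
Lemma young_excess_outside x : 0 <= young_min x + (2 - theta)^-1 * phi_weight x.
Proof.
rewrite /young_min /phi_weight; have [[s0 _ _ _]|[-> _ _ _]] := sigma_cases x; last first.
  by rewrite u_phi0 !mul0r mulr0 subr0 addr0.
rewrite (log_sigma_pos s0); move: s0; set s := sg x => s0.
have := u_phi_legendre_le phiP phi_lb theta_lt2 (fun x x0 xs => @phi_below s x x0 xs) s0.
by rewrite [(2 - theta)^-1 * _]mulrC; lra.
Qed.

Hypothesis integrable_weight : omega.-integrable setT (fun x => (phi_weight x)%:E).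

Definition weight (E : set (borel M)) : R :=
  fine (\int[omega]_x (phi_weight x * \1_E x)%:E)%E.

Lemma integrable_weight_indic (E : set (borel M)) : measurable E ->
  omega.-integrable setT (fun x => (phi_weight x * \1_E x)%:E).
Proof.
move=> mE; apply: le_integrable integrable_weight => //.
  apply/measurable_EFinP; apply: measurable_funM; last exact: measurable_indic.
  by apply/measurable_EFinP; case/integrableP : integrable_weight.
move=> x _; rewrite lee_fin normrM ler_piMr// indicE.
by case: (x \in E); rewrite /= ?normr1 ?normr0.
Qed.

Lemma weightE (E : set (borel M)) : measurable E ->
  (\int[omega]_x (phi_weight x * \1_E x)%:E = (weight E)%:E)%E.
Proof.
by move=> mE; rewrite /weight fineK//; apply: integrable_fin_num => //; exact: integrable_weight_indic.
Qed.

Lemma entropy_restriction (A : set (borel M)) (mu : probability (borel M) R) (a : R) :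
  measurable A -> 0 < a -> a <= 1 ->
  (forall E : set (borel M), measurable E -> mu E = (a^-1%:E * nu (E `&` A))%E) ->
  (relative_entropy omega phi Psi mu <=
   (entropy_min + (a^-1 - 1) * Lam a^-1 * weight A + (2 - theta)^-1 * weight (~` A))%:E)%E.
Proof.
move=> mA a0 a1 muE.
have k1 : 1 <= a^-1 by rewrite invf_ge1.
pose rho : borel M -> R := fun x => sg x * (a^-1 * \1_A x).
have mrho : measurable_fun setT rho.
  by apply: measurable_funM; [exact: measurable_sigma|exact: measurable_funM].
have rho0 x : 0 <= rho x.
  by rewrite mulr_ge0 ?sigma_ge0// mulr_ge0 ?invr_ge0 ?(ltW a0)// indicE.
have rhoE (E : set (borel M)) : measurable E -> mu E = (\int[omega]_(x in E) (rho x)%:E)%E.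
  move=> mE; rewrite muE// nuP; last exact: measurableI.
  have E1 : (\int[omega]_(x in E `&` A) sigma phi Psi x =
      \int[omega]_(x in E) (sg x * \1_A x)%:E)%E.
    rewrite integral_mkcondr; apply: eq_integral => x _.
    rewrite patchE indicE; case: (x \in A); last by rewrite mulr0.
    by rewrite mulr1 sigmaE.
  rewrite E1 -ge0_integralZl_EFin//.
  - by apply: eq_integral => x _; rewrite -EFinM /rho; congr EFin; ring.
  - by move=> x _; rewrite lee_fin mulr_ge0 ?sigma_ge0// indicE.
  - apply/measurable_EFinP; apply: measurable_funTS; apply: measurable_funM; first exact: measurable_sigma.
    exact: measurable_indic.
  - by rewrite invr_ge0 ltW.
have il : omega.-integrable setT (fun x => (rho x * log_sigma x)%:E).
  apply: (@le_integrable _ _ _ _ _ _ _ (fun x : borel M => a^-1%:E * (sg x * log_sigma x)%:E)%E) => //.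
  - by apply/measurable_EFinP; apply: measurable_funM => //; exact: measurable_log_sigma.
  - move=> x _; rewrite -EFinM lee_fin /rho indicE; case: (x \in A); last by rewrite !mulr0 mul0r normr0.
    by rewrite mulr1 (_ : sg x * a^-1 * log_sigma x = a^-1 * (sg x * log_sigma x))//; ring.
  - by apply: integrableZl => //; exact: integrable_sigma_log.
pose z x := u (rho x) - rho x * log_sigma x.
pose B x := (a^-1 - 1) * Lam a^-1 * (phi_weight x * \1_A x) + (2 - theta)^-1 * (phi_weight x * \1_(~` A) x).
have zB x : z x <= young_min x + B x.
  rewrite /z /B /rho !indicE in_setC; case: (x \in A) => /=.
    by rewrite !mulr1 !mulr0 addr0; exact: young_excess_inside.
  by rewrite !mulr0 mulr1 add0r u_phi0 mul0r subr0 young_excess_outside.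
have yz x : young_min x <= z x by exact: young_min_le.
have B0 x : 0 <= B x by have := zB x; have := yz x; lra.
have iB : omega.-integrable setT (fun x => (B x)%:E).
  have -> : (fun x => (B x)%:E) =
     ((fun x => ((a^-1 - 1) * Lam a^-1)%:E * (phi_weight x * \1_A x)%:E) \+
      (fun x => ((2 - theta)^-1)%:E * (phi_weight x * \1_(~` A) x)%:E))%E by apply/funext.
  by apply: integrableD => //; apply: integrableZl => //; apply: integrable_weight_indic => //; exact: measurableC.
have iy := integrable_young_min.
(* [z] lies between [young_min] and [young_min + B], both integrable. *)
have iz : omega.-integrable setT (fun x => (z x)%:E).
  apply: (@le_integrable _ _ _ _ _ _ _ (fun x : borel M => (`|young_min x| + B x)%:E)) => //.
  - apply/measurable_EFinP; apply: measurable_funB.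
      by apply: measurableT_comp mrho; exact: measurable_u_phi.
    by apply: measurable_funM => //; exact: measurable_log_sigma.
  - move=> x _; have YB : 0 <= `|young_min x| + B x by apply: addr_ge0 => //; exact: B0.
    rewrite lee_fin (ger0_norm YB) ler_norml.
    have := zB x; have := yz x; have := B0 x.
    have := ler_norm (young_min x); have := lerNnormlW (lexx `|young_min x|); lra.
  - have -> : (fun x => (`|young_min x| + B x)%:E) = ((abse \o (fun x => (young_min x)%:E)) \+ (fun x => (B x)%:E))%E by apply/funext.
    by apply: integrableD => //; exact: integrable_abse.
rewrite (relative_entropy_density mrho rho0 rhoE iz il).
apply: (@le_trans _ _ (\int[omega]_x ((young_min x)%:E + (B x)%:E))%E).
  apply: le_integral => //; first exact: integrableD.
  by move=> x _; rewrite -EFinD lee_fin; exact: zB.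
rewrite integralD_EFin// entropy_minE.
have -> : (\int[omega]_x (B x)%:E = \int[omega]_x
     (((a^-1 - 1) * Lam a^-1 * (phi_weight x * \1_A x))%:E + ((2 - theta)^-1 * (phi_weight x * \1_(~` A) x))%:E))%E.
  by apply: eq_integral.
have iA := integrable_weight_indic mA; have iAC := integrable_weight_indic (measurableC mA).
have ZE k (E : set (borel M)) : measurable E ->
    (\int[omega]_x (k * (phi_weight x * \1_E x))%:E = (k * weight E)%:E)%E.
  by move=> mE; rewrite EFinM -weightE// -integralZl//; exact: integrable_weight_indic.
rewrite integralD_EFin//; last 2 first.
- by have := integrableZl measurableT ((a^-1 - 1) * Lam a^-1) iA.
- by have := integrableZl measurableT ((2 - theta)^-1) iAC.
by rewrite !ZE//; [rewrite -!EFinD addrA|exact: measurableC].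
Qed.

End Entropy.

(** Applied to the squared distance on the product space, where it spares a proof of joint
    measurability. *)
Lemma ge0_le_integralT d (T : measurableType d) (R : realType)
    (mu : {measure set T -> \bar R}) (f1 f2 : T -> \bar R) :
  (forall x, 0 <= f1 x)%E -> (forall x, f1 x <= f2 x)%E ->
  (\int[mu]_x f1 x <= \int[mu]_x f2 x)%E.
Proof.
move=> f10 f12; rewrite !ge0_integralTE//; last by move=> x; exact: le_trans (f10 x) (f12 x).
by apply: ereal_sup_le => _ [h hf <-]; exists h => // x; exact: le_trans (hf x) (f12 x).
Qed.

(** * Transport between conditional measures *)

Section Transport.
Context {R : realType} {n : nat} {M : ptopologicalType}.
Variable g : riemannianStructure (R := R) n M.
Local Open Scope ereal_scope.
Implicit Types mu : probability (borel M) R.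

Let open_measurable_borel (A : set M) : open A -> measurable (A : set (borel M)).
Proof. by move=> oA; exact: sub_sigma_algebra. Qed.

Lemma measurable_nbhd (A : set M) (r : R) : measurable (nbhd g A r : set (borel M)).
Proof. by apply: open_measurable_borel; exact: open_nbhd. Qed.

Lemma measurable_dist_ball x (r : R) : measurable ([set y | dist g x y < r%:E] : set (borel M)).
Proof. by apply: open_measurable_borel; exact: dist_ball_open. Qed.

Lemma measurable_dist x : measurable_fun setT (dist g x : borel M -> \bar R).
Proof.
apply: (measurability (@ErealGenInftyO.G R)) => [|/= _ [_ [r ->] <-]].
  exact: ErealGenInftyO.measurableE.
rewrite setTI; have := measurable_dist_ball x r.
by congr (measurable _); apply/seteqP; split=> y /=; rewrite in_itv.
Qed.

Lemma finite_second_moment_ball mu x0 (k : R) :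
  mu (~` [set y | dist g x0 y < k%:E]) = 0 -> finite_second_moment g mu.
Proof.
move=> muV; exists x0; apply: (@le_lt_trans _ _ (\int[mu]_x cst ((k ^+ 2)%:E) x)).
  apply: ae_ge0_le_integral => //.
  - by move=> x _; rewrite expe_ge0// dist_ge0.
  - exact: emeasurable_funM (measurable_dist x0) (measurable_dist x0).
  - by move=> x _; rewrite lee_fin sqr_ge0.
  exists (~` [set y | dist g x0 y < k%:E]); split=> //.
    by apply: measurableC; exact: measurable_dist_ball.
  move=> x /= + xk; apply => _; rewrite EFin_expe.
  by apply: lee_pmul; rewrite ?dist_ge0 ?ltW.
rewrite integral_cst// [X in _ * X]probability_setT mule1.
exact: ltry.
Qed.

(** Every coupling gives full mass to the product of [A] and [B], and on it the cost is at least
    r^2; elsewhere the cost is bounded below by 0, so the comparison function is a multiple of an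
    indicator. *)
Lemma W2_ge (A B : set (borel M)) mu0 mu1 (r : R) : (0 <= r)%R ->
  measurable A -> measurable B ->
  (forall x y, A x -> B y -> r%:E <= dist g x y) ->
  mu0 (~` A) = 0 -> mu1 (~` B) = 0 -> (r ^+ 2)%:E <= W2 g mu0 mu1 ^+ 2.
Proof.
move=> r0 mA mB AB muA muB; rewrite /W2.
have S0 : (r ^+ 2)%:E <= ereal_inf [set \int[pi]_z (dist g z.1 z.2 ^+ 2) | pi in coupling mu0 mu1].
  apply: le_ereal_inf_tmp => _ [pi cpi <-].
  have mAB : measurable (A `*` B) by exact: measurableX.
  have piAB : pi (A `*` B) = 1.
    have sub : ~` (A `*` B) `<=` ((~` A) `*` setT) `|` (setT `*` (~` B)).
      move=> [x y] /= /not_andP[Ax|By]; [by left|by right].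
    have m1 : measurable ((~` A) `*` [set: borel M]) by apply: measurableX => //; exact: measurableC.
    have m2 : measurable ([set: borel M] `*` (~` B)) by apply: measurableX => //; exact: measurableC.
    have p0 : pi (~` (A `*` B)) = 0.
      apply/eqP; rewrite eq_le measure_ge0 andbT.
      apply: (@le_trans _ _ (pi (((~` A) `*` setT) `|` (setT `*` (~` B))))).
        by apply: le_measure; rewrite ?inE; [exact: measurableC|exact: measurableU|].
      apply: le_trans (measureU2 _ m1 m2) _.
      rewrite -[leRHS](adde0 (0 : \bar R)); apply: leeD.
        by rewrite le_eqVlt; apply/orP; left; apply/eqP; exact: etrans (cpi _ (measurableC mA)).1 muA.
      by rewrite le_eqVlt; apply/orP; left; apply/eqP; exact: etrans (cpi _ (measurableC mB)).2 muB.
    have := probability_setC pi mAB; rewrite [X in X = _ -> _]p0.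
    have : pi (A `*` B) \is a fin_num by exact: fin_num_measure.
    move=> /fineK <- => /esym/eqP; rewrite -EFinB eqe subr_eq0 => /eqP E.
    by rewrite -E.
  apply: (@le_trans _ _ (\int[pi]_z ((r ^+ 2)%:E * (\1_(A `*` B) z)%:E))).
    rewrite integralZl//; last exact: integrable_indic.
    by rewrite integral_indic// setIT [X in _ * X](_ : _ = 1) ?mule1//; exact: piAB.
  apply: ge0_le_integralT => -[x y].
    by rewrite mule_ge0 ?lee_fin ?sqr_ge0.
  rewrite indicE; case: (boolP ((x, y) \in A `*` B)) => [/set_mem[/= Ax By]|_].
    rewrite mule1 EFin_expe; apply: lee_pmul; rewrite ?lee_fin//; exact: AB.
  by rewrite mule0 expe_ge0// dist_ge0.
rewrite sqr_sqrte//; apply: le_trans S0.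
by rewrite lee_fin sqr_ge0.
Qed.

(** The last argument of [mnormalize] is the value taken when [nu A = 0]; the lemmas about
    [conditioned] assume [0 < nu A]. *)
Definition conditioned (nu : probability (borel M) R) (A : set (borel M)) (mA : measurable A) :
  probability (borel M) R := mnormalize (mrestr nu mA) nu.

Lemma conditionedE (nu : probability (borel M) R) (A : set (borel M)) (mA : measurable A) E :
  0 < nu A -> measurable E -> conditioned nu mA E = ((fine (nu A))^-1)%:E * nu (E `&` A).
Proof.
move=> nuA mE; rewrite /conditioned /= /mnormalize /= /mrestr /= setTI.
have fA : nu A \is a fin_num by exact: fin_num_measure.
rewrite (gt_eqF nuA) /=; case: eqP => [E'|_]; first by rewrite E' in fA.
by rewrite muleC.
Qed.

Lemma conditioned_compl (nu : probability (borel M) R) (A : set (borel M)) (mA : measurable A)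
    (V : set (borel M)) : 0 < nu A -> measurable V -> A `<=` V -> conditioned nu mA (~` V) = 0.
Proof.
move=> nuA mV AV; rewrite conditionedE//; last exact: measurableC.
have -> : ~` V `&` A = set0 by apply/seteqP; split=> // x [/= nV /AV].
by rewrite measure0 mule0.
Qed.

End Transport.

(** * From convexity of the entropy to separated sets *)

Section Concentration.
Context {R : realType} {n : nat} {M : ptopologicalType}.
Variable g : riemannianStructure (R := R) n M.
Variables (omega : {measure set (borel M) -> \bar R}) (nu : probability (borel M) R).
Variables (phi : R -> R) (Psi : M -> R) (K theta delta : R).
Hypothesis M_connected : connected [set: M].
Hypothesis phiP : phi_function phi.
Hypothesis phi_lb : forall s, 0 < s -> s <= 1 -> s `^ (3 / 2) <= phi s.
Hypothesis Psi_continuous : continuous Psi.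
Hypothesis PsiL : forall x, ((- Psi x)%:E < L_phi phi)%E.
Hypothesis nuP : has_density omega nu (sigma phi Psi).
Notation sg := (fun x => fine (sigma phi Psi x)).
Hypothesis int_h : omega.-integrable setT (fun x => (h_phi phi (sg x))%:E).
Hypothesis int_ln : omega.-integrable setT (fun x => (sg x * ln_phi phi (sg x))%:E).
Hypothesis theta_lt2 : theta < 2.
Hypothesis delta_ge0 : 0 <= delta.
Hypothesis phi_below : forall s x, 0 < x -> x <= s -> phi s * (x / s) `^ theta <= phi x.
Hypothesis phi_above : forall s x, 0 < s -> s <= x -> phi s * (x / s) `^ delta <= phi x.
Hypothesis K_gt0 : 0 < K.
Hypothesis hess : Hess_ge g (relative_entropy omega phi Psi) K.

Notation Lam := (ln_phi (phi_m (2 - delta))).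
Notation weight := (weight omega phi Psi).

Variables (P eps : R).
Hypothesis integrable_weight : omega.-integrable setT (fun x => (phi_weight phi Psi x)%:E).
Hypothesis weight_le : forall E : set (borel M), measurable E -> (0 < nu E)%E ->
  weight E <= P * fine (nu E) `^ (1 - eps).

(* The excess entropy of nu conditioned on a set of measure [a] is at most
   [P * entropy_gap a]: the first term is the cost of dilating the density by
   [a^-1] on the set, the second that of killing it outside. *)
Definition entropy_gap (a : R) : R :=
  (1 - a) * a `^ (- eps) * Lam a^-1 + (2 - theta)^-1 * (1 - a) `^ (1 - eps).

Let nu_fin (E : set (borel M)) : measurable E -> nu E = (fine (nu E))%:E.
Proof. by move=> mE; rewrite fineK//; exact: fin_num_measure. Qed.

Let Lam_ge0 k : 1 <= k -> 0 <= Lam k.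
Proof.
move=> k1; have mP : phi_function (phi_m (2 - delta)) by apply: phi_m_function; rewrite gerBl.
by rewrite -(ln_phi1 (phi_m (2 - delta))); exact: ln_phi_le.
Qed.

Lemma entropy_conditioned_le (A : set (borel M)) (mA : measurable A) :
  (0 < nu A)%E -> (nu A < 1)%E ->
  (relative_entropy omega phi Psi (conditioned nu mA) <=
   (entropy_min omega phi Psi + P * entropy_gap (fine (nu A)))%:E)%E.
Proof.
move=> A0 A1; set a := fine (nu A).
have a0 : 0 < a by rewrite -lte_fin -nu_fin.
have a1 : a < 1 by rewrite -lte_fin -nu_fin.
have cE (E : set (borel M)) : measurable E -> conditioned nu mA E = (a^-1%:E * nu (E `&` A))%E.
  by move=> mE; rewrite conditionedE.
have := entropy_restriction phiP phi_lb Psi_continuous PsiL nuP int_h int_ln theta_lt2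
  delta_ge0 phi_below phi_above integrable_weight mA a0 (ltW a1) cE.
move=> /le_trans; apply; rewrite lee_fin -addrA lerD2l /entropy_gap mulrDr; apply: lerD.
  have -> : P * ((1 - a) * a `^ (- eps) * Lam a^-1) = (a^-1 - 1) * Lam a^-1 * (P * a `^ (1 - eps)).
    rewrite powRD ?(gt_eqF a0) ?implybT// powRr1 ?(ltW a0)//; field.
    by rewrite gt_eqF.
  apply: ler_wpM2l; last exact: weight_le.
  by rewrite mulr_ge0 ?Lam_ge0 ?subr_ge0 ?invf_ge1// ltW.
have nAC : nu (~` A) = (1 - a)%:E.
  by have := probability_setC nu mA; rewrite (nu_fin mA) EFinB => <-.
have C0 : (0 < nu (~` A))%E by rewrite [X in (_ < X)%E]nAC lte_fin subr_gt0.
rewrite mulrCA ler_wpM2l ?invr_ge0 ?subr_ge0 ?(ltW theta_lt2)//.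
by have := weight_le (measurableC mA) C0; rewrite [X in fine X]nAC.
Qed.

(* Convexity at time 1/2 between the two conditional measures, the entropy of
   the midpoint being at least the minimum, attained by nu. *)
Lemma separated_sets_bound (A B : set (borel M)) x0 (k r : R) :
  measurable A -> measurable B -> 0 <= r -> (0 < nu A)%E -> (0 < nu B)%E ->
  A `<=` [set y | dist g x0 y < k%:E]%E -> B `<=` [set y | dist g x0 y < k%:E]%E ->
  (forall x y, A x -> B y -> (r%:E <= dist g x y)%E) -> A `&` B = set0 ->
  K / 4 * r ^+ 2 <= P * (entropy_gap (fine (nu A)) + entropy_gap (fine (nu B))).
Proof.
move=> mA mB r0 A0 B0 AV BV sep AB.
have nuAB : (nu A + nu B <= 1)%E.
  have := measureU nu mA mB AB; move=> <-.
  by apply: (@probability_le1 _ _ _ nu); exact: measurableU.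
have A1 : (nu A < 1)%E.
  move: nuAB B0; rewrite (nu_fin mA) (nu_fin mB) -EFinD !lee_fin !lte_fin; lra.
have B1 : (nu B < 1)%E.
  move: nuAB A0; rewrite (nu_fin mA) (nu_fin mB) -EFinD !lee_fin !lte_fin; lra.
have mV := measurable_dist_ball g x0 k.
have fA : finite_second_moment g (conditioned nu mA).
  by apply: (finite_second_moment_ball (x0 := x0) (k := k)); exact: conditioned_compl.
have fB : finite_second_moment g (conditioned nu mB).
  by apply: (finite_second_moment_ball (x0 := x0) (k := k)); exact: conditioned_compl.
have W : ((r ^+ 2)%:E <= W2 g (conditioned nu mA) (conditioned nu mB) ^+ 2)%E.
  by apply: (W2_ge r0 mA mB sep); exact: conditioned_compl.
have [mu _ H] := hess fA fB.
have h01 : 0 <= (2^-1 : R) <= 1 by rewrite invr_ge0 ler0n invf_le1// ler1n.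
have := H _ h01; set I0 := entropy_min omega phi Psi.
have lo := relative_entropy_ge phiP phi_lb Psi_continuous PsiL nuP int_h int_ln (mu 2^-1).
move=> /(le_trans lo).
set HA := relative_entropy _ _ _ (conditioned nu mA).
set HB := relative_entropy _ _ _ (conditioned nu mB).
have hA : (HA <= (I0 + P * entropy_gap (fine (nu A)))%:E)%E by exact: entropy_conditioned_le.
have hB : (HB <= (I0 + P * entropy_gap (fine (nu B)))%:E)%E by exact: entropy_conditioned_le.
have h12 : (0 <= (1 - 2^-1 : R)%:E)%E by rewrite lee_fin; lra.
have K0 : (0 <= (K / 2 * (1 - 2^-1) * 2^-1)%:E)%E by rewrite lee_fin; have := ltW K_gt0; lra.
have c0 : (0 <= (2^-1 : R)%:E)%E by rewrite lee_fin invr_ge0.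
have step := leeB (leeD (lee_wpmul2l h12 hA) (lee_wpmul2l c0 hB)) (lee_wpmul2l K0 W).
move=> /le_trans/(_ step) {H step}.
set GA := entropy_gap (fine (nu A)); set GB := entropy_gap (fine (nu B)) => H0.
have {H0} H : I0 <= (1 - 2^-1) * (I0 + P * GA) + 2^-1 * (I0 + P * GB) -
   K / 2 * (1 - 2^-1) * 2^-1 * r ^+ 2 := H0.
rewrite mulrDr.
set PA := P * GA in H *; set PB := P * GB in H *; set rr := K * r ^+ 2.
have E1 : K / 2 * (1 - 2^-1) * 2^-1 * r ^+ 2 = rr / 8 by rewrite /rr; field.
have E2 : K / 4 * r ^+ 2 = rr / 4 by rewrite /rr; field.
by rewrite E1 in H; rewrite E2; lra.
Qed.

(** Serves to remove the cut-off to balls: the measures of the truncated sets converge to those of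
    the full sets, which are below 1 because both are positive and their sum is at most 1. *)
Lemma entropy_gap_continuous a : 0 < a -> a < 1 -> {for a, continuous entropy_gap}.
Proof.
move=> a0 a1; have mP : phi_function (phi_m (2 - delta)) by apply: phi_m_function; rewrite gerBl.
have c1 : {for a, continuous (fun x : R => 1 - x)} by apply: cvgB; [exact: cvg_cst|exact: cvg_id].
apply: cvgD.
  apply: cvgM; first by apply: cvgM; [exact: c1|exact: powR_cont].
  apply: (@continuous_comp _ _ _ (fun x : R => x^-1) Lam); first by apply: inv_continuous; rewrite gt_eqF.
  by apply: ln_phi_continuous => //; rewrite invr_gt0.
apply: cvgMr; apply: (@continuous_comp _ _ _ (fun x : R => 1 - x) (fun y => y `^ (1 - eps))); first exact: c1.
by apply: powR_cont; rewrite subr_gt0.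
Qed.

Lemma concentration_bound (A : set (borel M)) (r : R) : 0 < r -> measurable A ->
  ((2^-1)%:E <= nu A)%E -> (nu (nbhd g A r) < 1)%E ->
  let b := 1 - fine (nu (nbhd g A r)) in
  [/\ 0 < b, fine (nu A) + b <= 1 &
   K / 4 * r ^+ 2 <= P * (entropy_gap (fine (nu A)) + entropy_gap b)].
Proof.
move=> r0 mA A2 N1 b.
have mN : measurable (nbhd g A r : set (borel M)) by exact: measurable_nbhd.
pose B : set (borel M) := ~` (nbhd g A r).
have mB : measurable B by exact: measurableC.
have nB : nu B = b%:E.
  by have := probability_setC nu mN; rewrite (nu_fin mN) -EFinB => <-.
have b0 : 0 < b by rewrite subr_gt0 -lte_fin -nu_fin.
have sep x y : A x -> B y -> (r%:E <= dist g x y)%E.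
  move=> Ax By; rewrite leNgt; apply/negP => xy; apply: By.
  by rewrite nbhdE; exists x.
have AB : A `&` B = set0.
  apply/seteqP; split=> // x [Ax Bx]; have := sep x x Ax Bx.
  by rewrite dist_xx lee_fin leNgt r0.
have ab1 : fine (nu A) + b <= 1.
  have E : nu (A `|` B) = (fine (nu A) + b)%:E.
    by rewrite EFinD -nB -nu_fin//; exact: measureU.
  by rewrite -lee_fin -E; apply: (@probability_le1 _ _ _ nu); exact: measurableU.
have a0 : 0 < fine (nu A).
  by apply: lt_le_trans (_ : 2^-1 <= _); rewrite ?invr_gt0// -lee_fin -nu_fin.
split=> //.
pose x0 : M := point.
(* These balls exhaust [M] because distances are finite. *)
pose V k : set (borel M) := [set y | (dist g x0 y < k%:R%:E)%E].
have mV k : measurable (V k) by exact: measurable_dist_ball.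
have VT : \bigcup_k V k = setT.
  apply/seteqP; split=> // y _.
  have yf : dist g x0 y \is a fin_num by rewrite ge0_fin_numE ?dist_ge0// dist_fin.
  exists (Num.bound (fine (dist g x0 y))) => //.
  by rewrite /V /= -(fineK yf) lte_fin archi_boundP// fine_ge0// dist_ge0.
have lim (E : set (borel M)) : measurable E -> fine (nu (E `&` V k)) @[k --> \oo] --> fine (nu E).
  move=> mE; apply: fine_cvg; rewrite -nu_fin//.
  have -> : nu E = nu (\bigcup_k (E `&` V k)) by rewrite -setI_bigcupr VT setIT.
  apply: nondecreasing_cvg_mu.
  - by move=> k; exact: measurableI.
  - by rewrite -setI_bigcupr VT setIT.
  - apply/nondecreasing_seqP => k; rewrite subsetEset => y [Ey Vy]; split=> //.
    by rewrite /V /= (lt_trans Vy)// lte_fin ltr_nat.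
have limA := lim A mA; have limB := lim B mB.
have gA : entropy_gap (fine (nu (A `&` V k))) @[k --> \oo] --> entropy_gap (fine (nu A)).
  apply: (cvg_comp _ _ limA); apply: entropy_gap_continuous => //.
  by move: ab1; rewrite -lerBrDr => /le_lt_trans; apply; rewrite ltrBlDr ltrDl.
have gB : entropy_gap (fine (nu (B `&` V k))) @[k --> \oo] --> entropy_gap b.
  have bE : fine (nu B) = b by rewrite [X in fine X]nB.
  rewrite -bE; apply: (cvg_comp _ _ limB); rewrite bE; apply: entropy_gap_continuous => //.
  by move: ab1; rewrite addrC -lerBrDr => /le_lt_trans; apply; rewrite ltrBlDr ltrDl.
have gAB : P * (entropy_gap (fine (nu (A `&` V k))) + entropy_gap (fine (nu (B `&` V k)))) @[k --> \oo]
    --> P * (entropy_gap (fine (nu A)) + entropy_gap b) by apply: cvgMr; exact: cvgD.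
apply: (cvgr_to_ge gAB).
have posA : \forall k \near \oo, 0 < fine (nu (A `&` V k)) by have /cvgr_gt := limA; exact.
have posB : \forall k \near \oo, 0 < fine (nu (B `&` V k)).
  by have /cvgr_gt := limB; apply; rewrite [X in fine X]nB.
near=> k.
have mAk : measurable (A `&` V k) by exact: measurableI.
have mBk : measurable (B `&` V k) by exact: measurableI.
apply: (@separated_sets_bound _ _ x0 k%:R) => //.
- exact: ltW.
- by rewrite nu_fin// lte_fin; near: k.
- by rewrite nu_fin// lte_fin; near: k.
- by move=> x y [Ax _] [By _]; exact: sep.
- by apply/seteqP; split=> // x [[Ax _] [Bx _]]; rewrite -AB.
Unshelve. all: by end_near. Qed.

End Concentration.

(** * Explicit bounds *)

Section RealEstimates.
Context {R : realType}.
Implicit Types (a b x tau theta delta eps kap q Z : R).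

Lemma e_mE m tau : m <= 2 -> m != 1 -> 0 < 1 + (m - 1) * tau ->
  e_m m tau = ((1 + (m - 1) * tau) `^ (1 / (m - 1)))%:E.
Proof.
move=> m2 m1 y0; set y := 1 + _ in y0 *; set t := y `^ _.
have t0 : 0 < t by rewrite powR_gt0.
have p0 : m - 1 != 0 by rewrite subr_eq0.
rewrite /e_m -(exp_phiK (phi_m_function m2) t0); congr exp_phi.
rewrite ln_phi_mE// /t -powRrM div1r mulVf// powRr1 ?(ltW y0)// /y addrAC subrr add0r.
by rewrite mulrC mulKf.
Qed.

Lemma e_m1E tau : e_m 1 tau = (expR tau)%:E.
Proof.
have m2 : 1 <= 2 :> R by rewrite ler1n.
rewrite /e_m -(exp_phiK (phi_m_function m2) (expR_gt0 tau)).
by rewrite ln_phi_m1E ?expR_gt0// expRK.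
Qed.

Lemma half_le_inv a : 2^-1 <= a -> a <= 1 -> 1 <= a^-1 <= 2.
Proof.
move=> a2 a1; have a0 : 0 < a by apply: lt_le_trans a2; rewrite invr_gt0.
by rewrite invf_ge1// a1 invf_ple ?posrE.
Qed.

(** Origin of the constant 2: since a >= 1/2, the logarithm of a^-1 is at most 1, and (2 - theta)^-1
    <= 1, so all terms but the logarithm of b^-1 add up to at most (1 - a) + (1 - a) + (1 - b) <=
    2. *)
Lemma entropy_gap_sum_le theta delta a b : theta <= 1 -> 0 <= delta ->
  2^-1 <= a -> 0 < b -> a + b <= 1 ->
  entropy_gap theta delta 0 a + entropy_gap theta delta 0 b <=
  ln_phi (phi_m (2 - delta)) b^-1 + 2.
Proof.
move=> th1 d0 a2 b0 ab; rewrite /entropy_gap oppr0 !powRr0 !mulr1 addr0.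
have a0 : 0 < a by apply: lt_le_trans a2; rewrite invr_gt0.
have a1 : a <= 1 by lra.
have b1 : b <= 1 by lra.
rewrite !powRr1 ?subr_ge0//.
have m2 : 2 - delta <= 2 by rewrite gerBl.
have /andP[ai1 ai2] := half_le_inv a2 a1.
have bi1 : 1 <= b^-1 by rewrite invf_ge1.
have La : ln_phi (phi_m (2 - delta)) a^-1 <= 1.
  by apply: le_trans (ln_phi_m_le_subr1 m2 ai1) _; rewrite lerBlDr.
have Lb : 0 <= ln_phi (phi_m (2 - delta)) b^-1.
  by rewrite -(ln_phi1 (phi_m (2 - delta))) ln_phi_le//; exact: phi_m_function.
have c1 : (2 - theta)^-1 <= 1 by rewrite invf_le1; lra.
have c0 : 0 <= (2 - theta)^-1 by rewrite invr_ge0; lra.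
set L := ln_phi _ a^-1 in La *; set L' := ln_phi _ b^-1 in Lb *; set c := _^-1 in c1 c0 *.
have e1 : (1 - a) * L <= (1 - a) * 1 by rewrite ler_wpM2l// subr_ge0.
have e2 : (1 - b) * L' <= 1 * L' by rewrite ler_wpM2r//; lra.
have e3 : c * (1 - a) <= 1 * (1 - a) by rewrite ler_wpM2r// subr_ge0.
have e4 : c * (1 - b) <= 1 * (1 - b) by rewrite ler_wpM2r// subr_ge0.
lra.
Qed.

Lemma powRN_ge1 b q : 0 < b -> b <= 1 -> 0 <= q -> 1 <= b `^ (- q).
Proof. by move=> b0 b1 q0; rewrite -[leLHS](powRr0 b) ger_powR ?b0// oppr_le0. Qed.

Lemma powR_inv_base b q : 0 < b -> b^-1 `^ q = b `^ (- q).
Proof. by move=> b0; rewrite -(powR_inv1 (ltW b0)) -powRrM mulN1r. Qed.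

(** [Z] stands for b^-1 to the power 1 - delta. As Z >= 1, the hypothesis bounds 1 + (1 - delta) tau
    by (3 - 2 delta) Z. The coefficient is at most delta / (2 - delta), because 1 - theta <= 1 -
    delta, and delta (3 - 2 delta) <= 2 - delta amounts to (1 - delta)^2 >= 0. *)
Lemma coefficient_theta_lt1 theta delta tau Z : 0 < delta -> delta <= theta -> theta < 1 -> 1 <= Z ->
  tau <= (Z - 1) / (1 - delta) + 2 ->
  delta * (1 - theta) / ((1 - delta) * (2 - delta)) * (1 + (1 - delta) * tau) <= Z.
Proof.
move=> d0 dt t1 Z1 tauZ.
have q0 : 0 < 1 - delta by lra.
have d2 : 0 < 2 - delta by lra.
have H1 : (1 - delta) * tau <= Z - 1 + 2 * (1 - delta).
  apply: le_trans (ler_wpM2l (ltW q0) tauZ) _.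
  by rewrite mulrDr mulrCA divff ?gt_eqF// mulr1; lra.
set c := _ / _; have c0 : 0 <= c.
  by rewrite divr_ge0 ?mulr_ge0//; lra.
have c1 : c * (1 + 2 * (1 - delta)) <= 1.
  rewrite /c mulrAC ler_pdivrMr ?mulr_gt0// mul1r.
  have : delta * (1 - theta) * (1 + 2 * (1 - delta)) <= delta * (1 - delta) * (1 + 2 * (1 - delta)).
    rewrite ler_wpM2r; [lra| |]; first by lra.
    by rewrite ler_wpM2l//; lra.
  move=> /le_trans; apply.
  have -> : delta * (1 - delta) * (1 + 2 * (1 - delta)) = (1 - delta) * (delta * (3 - 2 * delta)) by ring.
  apply: ler_wpM2l; first exact: ltW.
  by have := sqr_ge0 (1 - delta); rewrite sqrrB expr1n mul1r mulr2n; lra.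
have H2 : c * (1 + (1 - delta) * tau) <= c * ((1 + 2 * (1 - delta)) * Z).
  apply: ler_wpM2l => //.
  have : 2 * (1 - delta) * 1 <= 2 * (1 - delta) * Z by rewrite ler_wpM2l//; lra.
  lra.
apply: le_trans H2 _; rewrite mulrA -[leRHS]mul1r ler_wpM2r//; lra.
Qed.

(** [q] is 1 - delta and [X] is b^-1 to the power [q]. The index 3 - 2 delta = 1 + 2 q doubles the
    exponent [q], and 2 X - 1 <= X^2 provides the square. *)
Lemma coefficient_theta_eq1 q tau X : 0 < q -> q < 2^-1 -> 1 <= X -> tau <= (X - 1) / q + 2 ->
  (1 - 2 * q) / (1 + 2 * q) * (1 + 2 * q * tau) <= X ^+ 2.
Proof.
move=> q0 q2 X1 tauX.
have H1 : 2 * q * tau <= 2 * (X - 1) + 4 * q.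
  have : 2 * q * tau <= 2 * q * ((X - 1) / q + 2) by rewrite ler_wpM2l//; lra.
  by rewrite (_ : 2 * q * ((X - 1) / q + 2) = 2 * (X - 1) + 4 * q)//; field; rewrite gt_eqF.
have p0 : 0 < 1 + 2 * q by lra.
rewrite mulrAC ler_pdivrMr//.
apply: (@le_trans _ _ ((1 - 2 * q) * (2 * X - 1 + 4 * q))).
  by rewrite ler_wpM2l//; lra.
have Y1 : 2 * X - 1 <= X ^+ 2.
  by have := sqr_ge0 (X - 1); rewrite sqrrB expr1n mulr1 mulr2n; lra.
have H3 : (2 * X - 1) * (1 + 2 * q) <= X ^+ 2 * (1 + 2 * q) by rewrite ler_wpM2r// ltW.
have H4 : 0 <= q * (2 * X - 2) by rewrite mulr_ge0//; lra.
have H5 : 0 <= q * q by rewrite mulr_ge0// ltW.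
apply: le_trans H3; lra.
Qed.

(** After division by x^eps, derivatives are compared; the inequality between them is the tangent at
    1 to the concave power 1 - eps / kap, taken at y^kap. The choice of [kap] keeps it at least
    [eps], hence positive, so that one formula serves for delta below, at and above 1. *)
Lemma powR_mul_ln_phi_le delta eps kap x : 0 <= delta -> 0 < eps -> eps <= kap ->
  kap = 2 * eps + 1 - delta -> 1 <= x ->
  x `^ eps * ln_phi (phi_m (2 - delta)) x <= (x `^ kap - 1) / kap.
Proof.
move=> d0 e0 ek kE x1; have x0 := lt_le_trans ltr01 x1.
have k0 : 0 < kap by exact: lt_le_trans ek.
have m2 : 2 - delta <= 2 by rewrite gerBl.
pose F := fun y : R => (y `^ kap - 1) / kap.
pose G := fun y : R => y `^ (- eps).
have dF (y : R) : 0 < y -> is_derive y (1 : R) (F * G) (F y * (- eps * y `^ (- eps - 1)) + G y * y `^ (kap - 1)).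
  move=> y0; have d1 := is_derive_powR_primitive (lt0r_neq0 k0) y0.
  have d2 := is_derive1_powR (- eps) y0.
  exact: (is_deriveM d1 d2).
have := @is_derive_le_increment R (ln_phi (phi_m (2 - delta))) (F * G)
  (fun y => (phi_m (2 - delta) y)^-1)
  (fun y => F y * (- eps * y `^ (- eps - 1)) + G y * y `^ (kap - 1)) 1 x x1
  (fun y yx => is_derive_ln_phi (phi_m_function m2) (lt_le_trans ltr01 (andP yx).1))
  (fun y yx => dF y (lt_le_trans ltr01 (andP yx).1)).
rewrite (ln_phi1 (phi_m (2 - delta))) subr0.
have -> : (F * G) 1 = 0 by rewrite -[LHS]/(F 1 * G 1) /F powR1 subrr mul0r mul0r.
rewrite subr0 -[(F * G) x]/(F x * G x) => H.
have {}H : ln_phi (phi_m (2 - delta)) x <= F x * G x.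
  apply: H => y /andP[y1 _]; have y0 := lt_trans ltr01 y1.
  rewrite /phi_m subKr -powRN.
  have A0 : 0 < y `^ kap by rewrite powR_gt0.
  have B := @powR_le_tangent R (1 - eps / kap) (y `^ kap).
  have ek01 : 0 <= 1 - eps / kap <= 1.
    rewrite subr_ge0 ler_pdivrMr// mul1r ek/= gerBl.
    by rewrite divr_ge0 ?(ltW e0)// ltW.
  have {B} B := B ek01 A0.
  have E1 : (y `^ kap) `^ (1 - eps / kap) = y `^ (kap - eps).
    by rewrite -powRrM; congr (_ `^ _); field; rewrite gt_eqF.
  rewrite E1 in B.
  have yn0 : y != 0 by rewrite gt_eqF.
  have E2 : y `^ (- delta) = y `^ (- eps - 1) * y `^ (kap - eps).
    by rewrite -powRD ?yn0 ?implybT//; congr (_ `^ _); lra.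
  have E3 : G y * y `^ (kap - 1) = y `^ (- eps - 1) * y `^ kap.
    by rewrite /G -!powRD ?yn0 ?implybT//; congr (_ `^ _); lra.
  rewrite E2 E3 (_ : F y * _ + _ = y `^ (- eps - 1) * (y `^ kap - eps * F y)); last by ring.
  rewrite ler_wpM2l ?powR_ge0//; apply: le_trans B _.
  rewrite /F le_eqVlt; apply/orP; left; apply/eqP; field.
  by rewrite gt_eqF.
have -> : (x `^ kap - 1) / kap = x `^ eps * (F x * G x).
  rewrite /G powRN mulrCA divff ?mulr1// gt_eqF// powR_gt0//.
by rewrite ler_wpM2l ?powR_ge0.
Qed.

Section ThetaGt1.
Variables theta delta eps kap : R.
Hypothesis epsE : theta = 1 + eps.
Hypothesis kapE : kap = 2 * eps + 1 - delta.
Hypothesis eps_gt0 : 0 < eps.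
Hypothesis eps_lt : eps < 2^-1.
Hypothesis eps_le_kap : eps <= kap.
Hypothesis kap_lt : kap < 1 - eps.

Let delta_ge0 : 0 <= delta. Proof. by move: kap_lt; rewrite kapE; have := eps_gt0; lra. Qed.

Let kap_gt0 : 0 < kap. Proof. exact: lt_le_trans eps_le_kap. Qed.

Let log_term a : 0 < a -> a <= 1 ->
  a `^ (- eps) * ln_phi (phi_m (2 - delta)) a^-1 <= (a `^ (- kap) - 1) / kap.
Proof.
move=> a0 a1; rewrite -!powR_inv_base//; apply: powR_mul_ln_phi_le => //.
by rewrite invf_ge1.
Qed.

Let twoE : 2 - theta = 1 - eps. Proof. rewrite epsE; lra. Qed.

Lemma entropy_gap_small_le b : 0 < b -> b <= 1 ->
  entropy_gap theta delta eps b <= (b `^ (- kap) - 1) / kap + (1 - eps)^-1.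
Proof.
move=> b0 b1; rewrite /entropy_gap twoE -mulrA; apply: lerD.
  have T := log_term b0 b1; apply: le_trans T.
  rewrite -[leRHS]mul1r ler_wpM2r//; last by lra.
  rewrite mulr_ge0 ?powR_ge0// -(ln_phi1 (phi_m (2 - delta))) ln_phi_le ?invf_ge1//.
  by apply: phi_m_function; rewrite gerBl.
rewrite ler_piMr ?invr_ge0//; first by have := eps_lt; lra.
apply: (@le_trans _ _ (1 `^ (1 - eps))); last by rewrite powR1.
by rewrite ge0_ler_powR ?nnegrE//; have := eps_lt; lra.
Qed.

(** The first term is at most 1/2, and the power of 1 - a <= 1/2 at most (1 + eps) / 2; the two
    contributions add up exactly to (1 - eps)^-1. *)
Lemma entropy_gap_large_le a : 2^-1 <= a -> a <= 1 ->
  entropy_gap theta delta eps a <= (1 - eps)^-1.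
Proof.
move=> a2 a1; have a0 : 0 < a by apply: lt_le_trans a2; rewrite invr_gt0.
have /andP[ai1 ai2] := half_le_inv a2 a1.
have k1 : kap <= 1 by have := kap_lt; have := eps_gt0; lra.
have T : a `^ (- eps) * ln_phi (phi_m (2 - delta)) a^-1 <= 1.
  apply: le_trans (log_term a0 a1) _; rewrite ler_pdivrMr// mul1r lerBlDr.
  rewrite -powR_inv_base//; have := @powR_le_tangent R kap a^-1.
  rewrite (ltW kap_gt0) k1 invr_gt0 => /(_ isT a0) /le_trans; apply.
  by rewrite addrC lerD2r ler_piMr ?(ltW kap_gt0)//; lra.
have S : (1 - a) `^ (1 - eps) <= (1 + eps) / 2.
  apply: (@le_trans _ _ ((2^-1) `^ (1 - eps))).
    by rewrite ge0_ler_powR ?nnegrE//; have := eps_lt; lra.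
  have := @powR_le_tangent R (1 - eps) 2^-1.
  have e01 : 0 <= 1 - eps <= 1 by have := eps_lt; have := eps_gt0; lra.
  by move=> /(_ e01); rewrite invr_gt0 ltr0n => /(_ isT); lra.
rewrite /entropy_gap twoE -mulrA.
have c0 : 0 < 1 - eps by have := eps_lt; lra.
have E : (1 - eps)^-1 = 1 / 2 * 1 + (1 - eps)^-1 * ((1 + eps) / 2).
  by field; rewrite gt_eqF.
rewrite [leRHS]E; apply: lerD; last by rewrite ler_wpM2l// invr_ge0 ltW.
apply: (@le_trans _ _ ((1 - a) * 1)); first by rewrite ler_wpM2l// subr_ge0.
by rewrite ler_wpM2r//; lra.
Qed.

(** [Z] stands for b^(-kap). The left side is the coefficient eps D / kap plus S tau; the former is
    at most 1 - 2 eps, and the two parts of the bound on [tau] contribute at most Z - 1 and 2 eps,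
    with total Z. *)
Lemma coefficient_theta_gt1 tau Z : 1 <= Z -> tau <= (Z - 1) / kap + 2 / (1 - eps) ->
  eps * (1 - eps - kap) / kap * (1 + kap * (2 * eps / ((1 - eps) * (kap + eps)) * tau)) <= Z.
Proof.
move=> Z1 tauZ.
have c0 : 0 < 1 - eps by have := eps_lt; lra.
have D0 : 0 < 1 - eps - kap by have := kap_lt; lra.
have D1 : 1 - eps - kap <= 1 - 2 * eps by have := eps_le_kap; lra.
have ke0 : 0 < kap + eps by rewrite addr_gt0.
have k0 := kap_gt0; have e0 := eps_gt0; have ek := eps_le_kap; have e2 := eps_lt.
move: D0 D1; set D := 1 - eps - kap => D0 D1.
set S := 2 * eps ^+ 2 * D / ((1 - eps) * (kap + eps)).
have -> : eps * D / kap * (1 + kap * (2 * eps / ((1 - eps) * (kap + eps)) * tau)) =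
    eps * D / kap + S * tau.
  by rewrite /S; field; rewrite !gt_eqF.
have S0 : 0 <= S.
  by apply: ltW; rewrite divr_gt0 ?mulr_gt0// exprn_gt0.
have T1 : eps * D / kap <= 1 - 2 * eps.
  rewrite ler_pdivrMr// mulrC; apply: ler_pM => //; exact: ltW.
have S1 : S <= eps * D / (1 - eps).
  rewrite /S ler_pdivrMr ?mulr_gt0//.
  have -> : eps * D / (1 - eps) * ((1 - eps) * (kap + eps)) = eps * D * (kap + eps).
    by field; rewrite gt_eqF.
  have -> : 2 * eps ^+ 2 * D = eps * D * (eps + eps) by ring.
  by rewrite ler_wpM2l ?lerD2r// mulr_ge0// ltW.
have S2 : S / kap <= 1.
  rewrite ler_pdivrMr// mul1r; apply: le_trans S1 _; rewrite ler_pdivrMr//.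
  by apply: ler_pM => //; [exact: ltW|exact: ltW|lra].
have S3 : S * (2 / (1 - eps)) <= 2 * eps.
  apply: (@le_trans _ _ (eps * D / (1 - eps) * (2 / (1 - eps)))).
    by rewrite ler_wpM2r// divr_ge0// ltW.
  have -> : eps * D / (1 - eps) * (2 / (1 - eps)) = 2 * eps * D / (1 - eps) ^+ 2.
    by field; rewrite gt_eqF.
  rewrite ler_pdivrMr ?exprn_gt0// ler_wpM2l//; first by lra.
  by apply: le_trans D1 _; have := sqr_ge0 eps; rewrite sqrrB expr1n mul1r mulr2n; lra.
have S4 : S * tau <= S * ((Z - 1) / kap + 2 / (1 - eps)) by rewrite ler_wpM2l.
have S5 : S * ((Z - 1) / kap) <= Z - 1.
  by rewrite mulrCA -[leRHS]mulr1 ler_wpM2l// subr_ge0.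
by rewrite mulrDr in S4; lra.
Qed.

End ThetaGt1.
End RealEstimates.

(** * Bounding the weight of a set by its measure *)

Section WeightBound.
Context {R : realType} {M : ptopologicalType}.
Variables (omega : {measure set (borel M) -> \bar R}) (nu : probability (borel M) R).
Variables (phi : R -> R) (Psi : M -> R) (theta delta eps xi0 : R).
Hypothesis phiP : phi_function phi.
Hypothesis phi1 : phi 1 = 1.
Hypothesis Psi_continuous : continuous Psi.
Hypothesis PsiL : forall x, ((- Psi x)%:E < L_phi phi)%E.
Hypothesis nuP : has_density omega nu (sigma phi Psi).
Notation sg := (fun x => fine (sigma phi Psi x)).
Hypothesis thetaP : theta_phi phi = theta%:E.
Hypothesis delta_gt0 : 0 < delta.
Hypothesis deltaP : delta_phi phi = delta%:E.
Hypothesis eps_ge : theta - 1 <= eps.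
Hypothesis eps_ge_delta : delta <= 1 + eps.
Hypothesis eps_ge0 : 0 <= eps.
Hypothesis eps_le1 : eps <= 1.
Hypothesis eps_omega : eps = 0 \/ (omega setT < +oo)%E.
Hypothesis xi0_ge1 : 1 <= xi0.
Hypothesis sigma_le_xi0 : ('N[omega]_(+oo)[sigma phi Psi] <= xi0%:E)%E.

(** The norm of exponent infinity is the essential supremum only for a nonzero measure, and omega[M]
    also occurs as a divisor. *)
Lemma omega_setT_gt0 : (0 < omega setT)%E.
Proof.
rewrite lt0e measure_ge0 andbT; apply/eqP => o0.
have ms : measurable_fun setT (sigma phi Psi : borel M -> \bar R).
  rewrite (_ : (sigma phi Psi : borel M -> \bar R) = EFin \o sg).
    exact: (measurable_EFinP _ _).2 (measurable_sigma phiP Psi_continuous PsiL).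
  by apply/funext => x; exact: sigmaE.
have := nuP (@measurableT _ (borel M)).
rewrite (null_set_integral _ ms o0)// => n0;
have : (nu setT : \bar R) = 1%E by exact: probability_setT.
by rewrite [LHS]n0 => /eqP; rewrite eqe eq_sym oner_eq0.
Qed.

Lemma sigma_le_ae : {ae omega, forall x : borel M, sg x <= xi0}.
Proof.
move: sigma_le_xi0; rewrite unlock omega_setT_gt0 => /ess_supP.
apply: filterS => x /=; rewrite sigmaE// => H.
by rewrite -lee_fin; apply: le_trans H; rewrite /= lee_fin ler_norm.
Qed.

Lemma measurable_phi_weight : measurable_fun setT (phi_weight phi Psi : borel M -> R).
Proof.
(* [phi] is arbitrary outside the positive half-line, so the weight is written as a function of
   sigma that is 0 there. *)
pose W (s : R) := if 0 < s then s * (s / phi s) else 0.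
have mW : measurable_fun setT W.
  apply: measurable_fun_if => //.
    exact: measurable_fun_ltr.
  rewrite setTI.
  rewrite (_ : _ @^-1` _ = `]0, +oo[%classic); last first.
    by apply/seteqP; split=> t /=; rewrite in_itv /= andbT.
  apply: open_continuous_measurable_fun => //.
  move=> s; rewrite inE /= in_itv /= andbT => s0.
  case: phiP => p0 _ pc; apply: cvgM; first exact: cvg_id.
  by apply: cvgM; [exact: cvg_id|apply: cvgV; [rewrite gt_eqF ?p0|exact: pc]].
have -> : (phi_weight phi Psi : borel M -> R) = W \o sg.
  apply/funext => x; rewrite /W /= /phi_weight; case: ifPn => // s0.
  have [[s1 _ _ _]|[-> _ _ _]] := sigma_cases phiP PsiL x; first by rewrite s1 in s0.
  by rewrite mul0r.
exact: measurableT_comp mW (measurable_sigma phiP Psi_continuous PsiL).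
Qed.

Let Q := xi0 `^ (1 + eps - delta).

(* The concave power [sigma^(1 - eps)] is replaced by its tangent at [lam], so
   that its integral over [E] involves only [nu E] and [omega E]; [lam] is
   optimised later. *)
Lemma phi_weight_le_affine lam x : 0 < lam -> sg x <= xi0 ->
  phi_weight phi Psi x <= Q * lam `^ (- eps) * ((1 - eps) * sg x + eps * lam).
Proof.
move=> l0 sx; rewrite /phi_weight.
have Q0 : 0 <= Q * lam `^ (- eps) by rewrite mulr_ge0 ?powR_ge0.
have [[s0 _ _ _]|[-> _ _ _]] := sigma_cases phiP PsiL x; last first.
  by rewrite mul0r mulr_ge0// mulr0 add0r mulr_ge0// ltW.
move: s0 sx; set s := fine _ => s0 sx.
apply: (@le_trans _ _ (s * (s `^ (- eps) * Q))).
  by rewrite ler_wpM2l ?(ltW s0)//; exact: (div_phi_le phiP phi1 thetaP delta_gt0 deltaP).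
have p01 : 0 <= 1 - eps <= 1 by rewrite subr_ge0 eps_le1 gerBl.
have T := powR_le_tangent p01 (divr_gt0 s0 l0).
have E1 : s * (s `^ (- eps) * Q) = Q * lam `^ (- eps) * (lam * (s / lam) `^ (1 - eps)).
  have E : s `^ (1 - eps) = lam `^ (1 - eps) * (s / lam) `^ (1 - eps).
    by rewrite -powRM ?ltW ?divr_gt0// mulrCA divff ?mulr1// gt_eqF.
  have F (y : R) : 0 < y -> y `^ (1 - eps) = y * y `^ (- eps).
    by move=> y0; rewrite powRD ?(gt_eqF y0) ?implybT// powRr1 ?ltW.
  by move: E; rewrite (F s)// (F lam)// mulrA => ->; ring.
rewrite E1 ler_wpM2l//; apply: le_trans (ler_wpM2l (ltW l0) T) _.
rewrite le_eqVlt; apply/orP; left; apply/eqP; field.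
by rewrite gt_eqF.
Qed.

Let c1 lam := Q * lam `^ (- eps) * (1 - eps).
Let c2 lam := Q * lam `^ (- eps) * eps * lam.

Let c1_ge0 lam : 0 <= c1 lam.
Proof. by rewrite /c1 !mulr_ge0 ?powR_ge0// subr_ge0. Qed.

Let c2_ge0 lam : 0 < lam -> 0 <= c2 lam.
Proof. by move=> l0; rewrite /c2 !mulr_ge0 ?powR_ge0// ltW. Qed.

Let mJ (E : set (borel M)) : measurable E -> measurable_fun setT (fun x : borel M => (sg x * \1_E x)%:E).
Proof.
move=> mE; apply/measurable_EFinP; apply: measurable_funM; last exact: measurable_indic.
exact: (measurable_sigma phiP Psi_continuous PsiL).
Qed.

Lemma integral_affine_indic (c d : R) (E : set (borel M)) : 0 <= c -> 0 <= d -> measurable E ->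
  (\int[omega]_x ((c * sg x + d) * \1_E x)%:E = c%:E * nu E + d%:E * omega E)%E.
Proof.
move=> c0 d0 mE.
have s0 (x : M) : 0 <= fine (sigma phi Psi x) by exact: sigma_ge0.
have i0 (x : borel M) : 0 <= (\1_E x : R) by rewrite indicE.
have -> : (nu E = \int[omega]_x (sg x * \1_E x)%:E)%E.
  rewrite nuP// integral_mkcond; apply: eq_integral => x _.
  rewrite /patch indicE; case: (x \in E); rewrite /= ?mulr1 ?mulr0//.
  exact: sigmaE.
have -> : (omega E = \int[omega]_x (\1_E x)%:E)%E by rewrite integral_indic ?setIT.
have m1 : measurable_fun setT (fun x : borel M => (\1_E x : R)%:E).
  by apply/measurable_EFinP; exact: measurable_indic.
rewrite -[X in (_ = X + _)%E]ge0_integralZl_EFin//; last 2 first.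
- by move=> x _; rewrite lee_fin mulr_ge0.
- exact: mJ.
rewrite -[X in (_ = _ + X)%E]ge0_integralZl_EFin//.
rewrite -ge0_integralD//; last 4 first.
- by move=> x _; rewrite -EFinM lee_fin !mulr_ge0.
- by apply: measurable_funeM; exact: mJ.
- by move=> x _; rewrite -EFinM lee_fin mulr_ge0.
- by apply: measurable_funeM.
by apply: eq_integral => x _; rewrite -!EFinM -EFinD mulrDl mulrA.
Qed.

Lemma integral_weight_le lam (E : set (borel M)) : 0 < lam -> measurable E ->
  (\int[omega]_x (phi_weight phi Psi x * \1_E x)%:E <= (c1 lam)%:E * nu E + (c2 lam)%:E * omega E)%E.
Proof.
move=> l0 mE.
have c10 := c1_ge0 lam; have c20 := c2_ge0 l0.
rewrite -integral_affine_indic//.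
apply: ae_ge0_le_integral => //.
- by move=> x _; rewrite lee_fin; apply: mulr_ge0; [exact: phi_weight_ge0|rewrite indicE].
- by apply/measurable_EFinP; apply: measurable_funM; [exact: measurable_phi_weight|exact: measurable_indic].
- move=> x _; rewrite lee_fin; apply: mulr_ge0; last by rewrite indicE.
  by apply: addr_ge0 => //; apply: mulr_ge0 => //; exact: sigma_ge0.
- apply/measurable_EFinP; apply: measurable_funM; last exact: measurable_indic.
  apply: measurable_funD => //; apply: measurable_funM => //.
  exact: (measurable_sigma phiP Psi_continuous PsiL).
apply: filterS sigma_le_ae => x sx _; rewrite lee_fin; apply: ler_wpM2r; first by rewrite indicE.
apply: le_trans (phi_weight_le_affine l0 sx) _.
by rewrite le_eqVlt; apply/orP; left; apply/eqP; rewrite /c1 /c2; ring.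
Qed.

Lemma integrable_phi_weight : omega.-integrable setT (fun x => (phi_weight phi Psi x)%:E).
Proof.
apply/integrableP; split.
  by apply/measurable_EFinP; exact: measurable_phi_weight.
have := integral_weight_le ltr01 (@measurableT _ (borel M)).
have -> : (\int[omega]_x `|(phi_weight phi Psi x)%:E| = \int[omega]_x (phi_weight phi Psi x * \1_setT x)%:E)%E.
  apply: eq_integral => x _; rewrite indicT mulr1 gee0_abs// lee_fin.
  exact: phi_weight_ge0.
move=> /le_lt_trans; apply; rewrite probability_setT mule1.
have [e0|oT] := eps_omega; first by rewrite /c2 e0 mulr0 mul0r mul0e adde0 ltry.
by rewrite lte_add_pinfty ?ltry// lte_mul_pinfty ?lee_fin ?c2_ge0.
Qed.

Lemma weight_power_le (E : set (borel M)) : measurable E -> (0 < nu E)%E ->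
  weight omega phi Psi E <= Q * fine (omega setT) `^ eps * fine (nu E) `^ (1 - eps).
Proof.
move=> mE nE0.
have nuE : nu E = (fine (nu E))%:E by rewrite fineK//; exact: fin_num_measure.
have a0 : 0 < fine (nu E) by rewrite -lte_fin -nuE.
have W := weightE integrable_phi_weight mE.
rewrite -lee_fin -W; set a := fine (nu E) in a0 *.
(* For eps = 0 the coefficient [c2] vanishes, which removes [omega E] even if it is infinite, and
   the factor [fine (omega setT)] to the power 0 is 1. *)
have [e0|oT] := eps_omega.
  apply: le_trans (integral_weight_le ltr01 mE) _.
  rewrite /c2 /c1 e0 mulr0 mul0r mul0e adde0 nuE -EFinM lee_fin -/a.
  by rewrite oppr0 !powRr0 !mulr1 addr0 mulr1 powRr1 // ltW.
have w0 : 0 < fine (omega setT) by rewrite fine_gt0// omega_setT_gt0.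
have wE : omega setT = (fine (omega setT))%:E by rewrite fineK// ge0_fin_numE.
set w := fine _ in w0 wE *.
(* The value lam = a / w minimises lam^(-eps) ((1 - eps) a + eps lam w), the bound obtained once
   omega E is replaced by omega M. *)
have l0 : 0 < a / w by rewrite divr_gt0.
apply: le_trans (integral_weight_le l0 mE) _; rewrite nuE.
apply: (@le_trans _ _ ((c1 (a / w))%:E * a%:E + (c2 (a / w))%:E * omega setT)%E).
  rewrite leeD2l// lee_wpmul2l ?lee_fin ?c2_ge0//.
  by apply: le_measure; rewrite ?inE.
rewrite wE -!EFinM -EFinD lee_fin.
have -> : c1 (a / w) * a + c2 (a / w) * w = Q * (a / w) `^ (- eps) * a.
  by rewrite /c1 /c2; field; rewrite gt_eqF.
rewrite powRM ?(ltW a0) ?invr_ge0 ?(ltW w0)// -(powR_inv1 (ltW w0)) -powRrM mulrNN mul1r.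
rewrite [a `^ (1 - eps)]powRD ?(gt_eqF a0) ?implybT// powRr1 ?(ltW a0)//.
by rewrite le_eqVlt; apply/orP; left; apply/eqP; ring.
Qed.

End WeightBound.

Lemma le_inve_of_le (R : realType) (z : R) (x : \bar R) : 0 < z -> (0 <= x)%E ->
  (x <= (z^-1)%:E)%E -> (z%:E <= x^-1)%E.
Proof.
move=> z0 + xz; move: xz; case: (inveP x) => [| | |t t0]; rewrite ?leey// !lee_fin => tz t1.
by rewrite -[z]invrK lef_pV2// posrE ?invr_gt0// lt0r t0.
Qed.

Section ConcentrationBounds.
Context {R : realType} {n : nat} {M : ptopologicalType}.
Variables (g : riemannianStructure (R := R) n M) (nu : probability (borel M) R).

Lemma concentration_ge0 (r : R) : (0 <= concentration g nu r)%E.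
Proof.
apply: (@le_trans _ _ (1 - nu (nbhd g setT r))%E).
  by rewrite sube_ge0 ?probability_le1 ?orbT//; exact: measurable_nbhd.
apply: ereal_sup_ubound; exists setT => //; split; first exact: measurableT.
have -> : (nu setT : \bar R) = 1%E by exact: probability_setT.
by rewrite lee_fin invf_le1// ler1n.
Qed.

Lemma concentration_le (r z : R) : 0 <= z ->
  (forall A : set (borel M), measurable A -> ((2^-1)%:E <= nu A)%E ->
    (nu (nbhd g A r) < 1)%E -> 1 - fine (nu (nbhd g A r)) <= z) ->
  (concentration g nu r <= z%:E)%E.
Proof.
move=> z0 H; apply: ge_ereal_sup => _ [A [mA A2] <-].
have mN : measurable (nbhd g A r : set (borel M)) by exact: measurable_nbhd.
have nE : nu (nbhd g A r) = (fine (nu (nbhd g A r)))%:E.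
  by rewrite fineK//; exact: fin_num_measure.
have [N1|N1] := ltP (nu (nbhd g A r)) 1%E; first by rewrite nE -EFinB lee_fin; exact: H.
by apply: (@le_trans _ _ 0%E); rewrite ?lee_fin// sube_le0.
Qed.

End ConcentrationBounds.

(** * The three concentration estimates *)

Section Estimates.
Context {R : realType} {n : nat} {M : ptopologicalType}.
Variables (g : riemannianStructure (R := R) n M).
Variables (omega : {measure set (borel M) -> \bar R}) (nu : probability (borel M) R).
Variables (phi : R -> R) (Psi : M -> R) (K theta delta xi0 : R).
Hypothesis M_connected : connected [set: M].
Hypothesis phiP : phi_function phi.
Hypothesis phi1 : phi 1 = 1.
Hypothesis Psi_continuous : continuous Psi.
Hypothesis PsiL : forall x, (- L_phi (phi_m (2 - theta)) < (Psi x)%:E)%E.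
Hypothesis nuP : has_density omega nu (sigma phi Psi).
Notation sg := (fun x => fine (sigma phi Psi x)).
Hypothesis int_h : omega.-integrable setT (fun x => (h_phi phi (sg x))%:E).
Hypothesis int_ln : omega.-integrable setT (fun x => (sg x * ln_phi phi (sg x))%:E).
Hypothesis thetaP : theta_phi phi = theta%:E.
Hypothesis deltaP : delta_phi phi = delta%:E.
Hypothesis delta_gt0 : 0 < delta.
Hypothesis delta_le_theta : delta <= theta.
Hypothesis theta_lt : theta < 3 / 2.
Hypothesis K_gt0 : 0 < K.
Hypothesis hess : Hess_ge g (relative_entropy omega phi Psi) K.
Hypothesis xi0_ge1 : 1 <= xi0.
Hypothesis sigma_le_xi0 : ('N[omega]_(+oo)[sigma phi Psi] <= xi0%:E)%E.

Lemma entropy_gap_lower_bound eps (r : R) (A : set (borel M)) :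
  theta - 1 <= eps -> 0 <= eps -> eps <= 1 -> delta <= 1 + eps ->
  eps = 0 \/ (omega setT < +oo)%E ->
  0 < r -> measurable A -> ((2^-1)%:E <= nu A)%E -> (nu (nbhd g A r) < 1)%E ->
  let b := 1 - fine (nu (nbhd g A r)) in
  exists a, [/\ 2^-1 <= a, 0 < b, a + b <= 1 &
   K / 4 * r ^+ 2 / (xi0 `^ (1 + eps - delta) * fine (omega setT) `^ eps) <=
   entropy_gap theta delta eps a + entropy_gap theta delta eps b].
Proof.
move=> te e0 e1 de eo r0 mA A2 N1 b.
have theta_ge0 : 0 <= theta by apply: le_trans delta_le_theta; exact: ltW.
have PsiL' x : ((- Psi x)%:E < L_phi phi)%E.
  apply: lt_le_trans (L_phi_power_le phiP phi1 theta_ge0 thetaP).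
  by rewrite EFinN lteNl; exact: PsiL.
have phi_lb s : 0 < s -> s <= 1 -> s `^ (3 / 2) <= phi s.
  by move=> s0 s1; exact: (phi_lower_near0 phiP phi1 thetaP).
have theta_lt2 : theta < 2 by have := theta_lt; lra.
have := concentration_bound M_connected phiP phi_lb Psi_continuous PsiL' nuP int_h int_ln
  theta_lt2 (ltW delta_gt0) (phi_ge_power_below phiP thetaP)
  (phi_ge_power_above phiP delta_gt0 deltaP) K_gt0 hess
  (integrable_phi_weight phiP phi1 Psi_continuous PsiL' nuP thetaP delta_gt0 deltaP
     te de e0 e1 eo xi0_ge1 sigma_le_xi0)
  (weight_power_le phiP phi1 Psi_continuous PsiL' nuP thetaP delta_gt0 deltaP
     te de e0 e1 eo xi0_ge1 sigma_le_xi0) r0 mA A2 N1.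
move=> [b0 ab H]; exists (fine (nu A)); split=> //.
  by rewrite -lee_fin fineK//; exact: fin_num_measure.
have w0 : 0 < fine (omega setT) `^ eps.
  case: eo => [->|oT]; first by rewrite powRr0.
  rewrite powR_gt0// fine_gt0// oT andbT.
  exact: (omega_setT_gt0 phiP Psi_continuous PsiL' nuP).
have x0 : 0 < xi0 `^ (1 + eps - delta) by rewrite powR_gt0// (lt_le_trans ltr01).
by rewrite ler_pdivrMr ?mulr_gt0// [leRHS]mulrC.
Qed.

(** Common to the cases theta < 1 and theta = 1, where eps = 0 and the power of omega[M]
    disappears. *)
Lemma concentration_inv_ge (r z : R) : theta <= 1 -> 0 < r -> 0 < z ->
  (forall b, 0 < b -> b <= 1 ->
    K / 4 * xi0 `^ (delta - 1) * r ^+ 2 <= ln_phi (phi_m (2 - delta)) b^-1 + 2 -> z <= b^-1) ->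
  (z%:E <= (concentration g nu r)^-1)%E.
Proof.
move=> t1 r0 z0 H; apply: le_inve_of_le => //; first exact: concentration_ge0.
apply: concentration_le; first by rewrite invr_ge0 ltW.
move=> A mA A2 N1.
have d1 : delta <= 1 by exact: le_trans t1.
have t10 : theta - 1 <= 0 by rewrite subr_le0.
have d10 : delta <= 1 + 0 by rewrite addr0.
have [a [a2 b0 ab]] := entropy_gap_lower_bound t10 (lexx 0) ler01 d10 (or_introl erefl) r0 mA A2 N1.
move: b0 ab; set b := 1 - _ => b0 ab.
rewrite powRr0 mulr1 addr0 => L.
have b1 : b <= 1 by lra.
rewrite -[leLHS]invrK lef_pV2 ?posrE ?invr_gt0//; apply: H => //.
apply: (le_trans _ (entropy_gap_sum_le t1 (ltW delta_gt0) a2 b0 ab)); apply: le_trans L.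
by rewrite -powRN opprB mulrAC.
Qed.

Lemma concentration_theta_lt1 (r : R) : theta < 1 -> 0 < r ->
  (((delta * (1 - theta) / ((1 - delta) * (2 - delta))) `^ (1 / (1 - delta)))%:E
   * e_m (2 - delta) (K / 4 * xi0 `^ (delta - 1) * r ^+ 2)
   <= (concentration g nu r)^-1)%E.
Proof.
move=> t1 r0; have dt := delta_le_theta; have d0 := delta_gt0.
have q0 : 0 < 1 - delta by lra.
set tau := K / 4 * _ * _.
have tau0 : 0 <= tau.
  by rewrite /tau !mulr_ge0 ?powR_ge0 ?sqr_ge0// ltW.
have m2 : 2 - delta <= 2 by rewrite gerBl ltW.
have mE : 2 - delta - 1 = 1 - delta by lra.
have m1 : 2 - delta != 1 by rewrite -subr_eq0 mE gt_eqF.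
have y0 : 0 < 1 + (1 - delta) * tau by rewrite ltr_pwDl// mulr_ge0// ltW.
rewrite e_mE// mE// -EFinM.
set c := delta * _ / _; have c0 : 0 < c by rewrite /c divr_gt0 ?mulr_gt0//; lra.
rewrite -powRM ?(ltW c0) ?(ltW y0)//.
apply: concentration_inv_ge => //; first exact: ltW.
  by apply: powR_gt0; apply: mulr_gt0.
move=> b b0 b1; rewrite -/tau ln_phi_mE ?invr_gt0// mE => L.
have bi1 : 1 <= b^-1 by rewrite invf_ge1.
have Z1 : 1 <= b^-1 `^ (1 - delta) by rewrite powR_inv_base// powRN_ge1// ltW.
have C := coefficient_theta_lt1 d0 dt t1 Z1 L.
have bE : b^-1 = (b^-1 `^ (1 - delta)) `^ (1 / (1 - delta)).
  by rewrite -powRrM div1r divff ?gt_eqF// powRr1 ?invr_ge0// ltW.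
rewrite [leRHS]bE ge0_ler_powR ?nnegrE ?powR_ge0//.
  by rewrite div1r invr_ge0 ltW.
by rewrite mulr_ge0 ?(ltW c0) ?(ltW y0).
Qed.

Lemma concentration_theta_eq1 (r : R) : theta = 1 -> 1 / 2 < delta -> 0 < r ->
  (e_m (3 - 2 * delta) (- 2 / (3 - 2 * delta))
   * e_m (3 - 2 * delta) (K / 4 * xi0 `^ (delta - 1) * r ^+ 2)
   <= (concentration g nu r)^-1)%E.
Proof.
move=> t1 d2 r0; have dt := delta_le_theta; have d0 := delta_gt0.
have d1 : delta <= 1 by rewrite -t1.
have bound := @concentration_inv_ge r _ _ r0; rewrite t1 in bound.
set tau := K / 4 * _ * _ in bound *.
have tau0 : 0 <= tau.
  by rewrite /tau !mulr_ge0 ?powR_ge0 ?sqr_ge0// ltW.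
(* At delta = 1 both deformed exponentials are [expR], and the first factor exp(-2) is exactly the
   additive constant 2 of [entropy_gap_sum_le]. *)
move: d1; rewrite le_eqVlt => /orP[/eqP dE|d1].
  have -> : 3 - 2 * delta = 1 by rewrite dE; lra.
  rewrite divr1 !e_m1E -EFinM -expRD.
  apply: bound => //; first exact: expR_gt0.
  move=> b b0 b1; rewrite dE (_ : 2 - 1 = 1 :> R); last by lra.
  rewrite ln_phi_m1E ?invr_gt0// => L.
  by rewrite -[leRHS](@lnK R) ?posrE ?invr_gt0// ler_expR; lra.
set q := 1 - delta; have q0 : 0 < q by rewrite subr_gt0.
have q2 : q < 2^-1 by rewrite /q; lra.
have mE : 3 - 2 * delta = 1 + 2 * q by rewrite /q; lra.
have m'E : 1 + 2 * q - 1 = 2 * q by lra.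
have m0 : 0 < 1 + 2 * q by lra.
(* Base of the first deformed exponential; it is positive because delta > 1/2. *)
have cE : 1 + (1 + 2 * q - 1) * (- 2 / (1 + 2 * q)) = (1 - 2 * q) / (1 + 2 * q).
  by field; rewrite gt_eqF.
have c0 : 0 < (1 - 2 * q) / (1 + 2 * q) by rewrite divr_gt0//; lra.
have m2 : 1 + 2 * q <= 2 by lra.
have m1 : 1 + 2 * q != 1 by rewrite -subr_eq0 m'E mulf_neq0 ?gt_eqF.
have y0 : 0 < 1 + 2 * q * tau by rewrite ltr_pwDl// mulr_ge0// ltW// mulr_gt0.
rewrite mE e_mE ?cE// e_mE ?m'E// -EFinM -powRM ?(ltW c0) ?(ltW y0)//.
apply: bound => //; first by rewrite powR_gt0// mulr_gt0.
have e1 : 2 - delta - 1 = q by rewrite /q; lra.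
have e2 : 2 - delta <= 2 by rewrite gerBl ltW.
have e3 : 2 - delta != 1 by rewrite -subr_eq0 e1 gt_eqF.
move=> b b0 b1; rewrite ln_phi_mE ?invr_gt0// e1 => L.
have X1 : 1 <= b^-1 `^ q by rewrite powR_inv_base// powRN_ge1// ltW.
have C := coefficient_theta_eq1 q0 q2 X1 L.
have bE : b^-1 = ((b^-1 `^ q) ^+ 2) `^ (1 / (2 * q)).
  rewrite -powR_mulrn ?powR_ge0// -!powRrM (_ : q * _ = 1) ?powRr1 ?invr_ge0 ?ltW//.
  by field; rewrite gt_eqF.
rewrite [leRHS]bE ge0_ler_powR ?nnegrE ?sqr_ge0//.
  by rewrite div1r invr_ge0 ltW// mulr_gt0.
by rewrite mulr_ge0 ?(ltW c0) ?(ltW y0).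
Qed.

Lemma concentration_theta_gt1 (r : R) : 1 < theta -> 3 * (theta - 1) < delta ->
  (omega setT < +oo)%E -> 0 < r ->
  (concentration g nu r <=
   (((theta - 1) * (3 - 3 * theta + delta) / (2 * theta - delta - 1))
      `^ (1 / (1 - 2 * theta + delta)))%:E
   * e_m (2 * (1 - theta) + delta)
       (- (K / 2) * ((theta - 1) / ((2 - theta) * (3 * theta - delta - 2)))
        * xi0 `^ (delta - theta) * fine (omega setT) `^ (1 - theta)
        * r ^+ 2))%E.
Proof.
move=> t1 d3 oT r0; have dt := delta_le_theta; have d0 := delta_gt0; have tl := theta_lt.
(* In these variables delta <= theta reads eps <= kap and delta > 3 (theta - 1) reads kap < 1 -
   eps. *)
pose eps := theta - 1; pose kap := 2 * eps + 1 - delta.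
have epsE : theta = 1 + eps by rewrite /eps; lra.
have kapE : kap = 2 * eps + 1 - delta by [].
have e0 : 0 < eps by rewrite subr_gt0.
have e2 : eps < 2^-1 by rewrite /eps; lra.
have ek : eps <= kap by rewrite /kap /eps; lra.
have k1 : kap < 1 - eps by rewrite /kap /eps; lra.
have k0 : 0 < kap by exact: lt_le_trans ek.
have c0 : 0 < 1 - eps by lra.
have ke0 : 0 < kap + eps by rewrite addr_gt0.
set W := fine (omega setT).
pose tau := K / 4 * r ^+ 2 / (xi0 `^ (1 + eps - delta) * W `^ eps).
pose Y := 2 * eps / ((1 - eps) * (kap + eps)) * tau.
have tau0 : 0 <= tau.
  by rewrite /tau divr_ge0 ?mulr_ge0 ?powR_ge0 ?sqr_ge0// ltW.
have Y0 : 0 <= Y.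
  by rewrite /Y mulr_ge0// divr_ge0 ?mulr_ge0 ?ltW.
have -> : - (K / 2) * ((theta - 1) / ((2 - theta) * (3 * theta - delta - 2)))
    * xi0 `^ (delta - theta) * W `^ (1 - theta) * r ^+ 2 = - Y.
  have E1 : xi0 `^ (delta - theta) = (xi0 `^ (1 + eps - delta))^-1.
    by rewrite -powRN; congr (_ `^ _); rewrite epsE; lra.
  have E2 : W `^ (1 - theta) = (W `^ eps)^-1.
    by rewrite -powRN; congr (_ `^ _); rewrite epsE; lra.
  have E3 : 3 * theta - delta - 2 = kap + eps by rewrite kapE epsE; lra.
  have E4 : 2 - theta = 1 - eps by rewrite epsE; lra.
  rewrite E1 E2 E3 E4 -/eps /Y /tau [X in _ = - (_ * (_ * X))]invfM.
  set u := (xi0 `^ _)^-1; set v := (W `^ _)^-1.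
  by field; rewrite !gt_eqF.
(* Index minus one and argument are both nonpositive here, so the deformed exponential at - Y is 1 +
   kap Y to the power - 1 / kap, with no truncation. *)
have mE : 2 * (1 - theta) + delta - 1 = - kap by rewrite kapE epsE; lra.
have m2 : 2 * (1 - theta) + delta <= 2 by rewrite epsE; lra.
have m1 : 2 * (1 - theta) + delta != 1 by rewrite -subr_eq0 mE oppr_eq0 gt_eqF.
have y0 : 0 < 1 + kap * Y by rewrite ltr_pwDl// mulr_ge0// ltW.
have yE : 1 + (2 * (1 - theta) + delta - 1) * - Y = 1 + kap * Y by rewrite mE mulrNN.
rewrite e_mE ?yE// mE -EFinM.
have -> : 1 - 2 * theta + delta = - kap by rewrite kapE epsE; lra.
have -> : (theta - 1) * (3 - 3 * theta + delta) / (2 * theta - delta - 1) =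
    eps * (1 - eps - kap) / kap.
  by rewrite -/eps; congr (_ * _ / _); rewrite kapE epsE; lra.
set C := _ / kap; have C0 : 0 < C by rewrite /C divr_gt0 ?mulr_gt0//; lra.
rewrite -powRM ?(ltW C0) ?(ltW y0)//.
apply: concentration_le; first exact: powR_ge0.
move=> A mA A2 N1.
have te : theta - 1 <= eps by [].
have e1 : eps <= 1 by lra.
have d1 : delta <= 1 + eps by rewrite -epsE.
have [a [a2 b0 ab]] := entropy_gap_lower_bound te (ltW e0) e1 d1 (or_intror oT) r0 mA A2 N1.
move: b0 ab; set b := 1 - _ => b0 ab; rewrite -/W -/tau => L.
have b1 : b <= 1 by lra.
have a1 : a <= 1 by lra.
have Z1 : 1 <= b `^ (- kap) by rewrite powRN_ge1// ltW.
have G1 := entropy_gap_large_le epsE kapE e0 e2 ek k1 a2 a1.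
have G2 := entropy_gap_small_le epsE kapE e0 e2 ek k1 b0 b1.
have T : tau <= (b `^ (- kap) - 1) / kap + 2 / (1 - eps).
  apply: le_trans L _; apply: le_trans (lerD G1 G2) _.
  by rewrite addrC -addrA -mulr2n mulr_natl.
have := coefficient_theta_gt1 e0 e2 ek k1 Z1 T; rewrite -/Y -/C => CZ.
have bE : b = (b `^ (- kap)) `^ (1 / - kap).
  by rewrite -powRrM div1r divff ?oppr_eq0 ?gt_eqF// powRr1// ltW.
rewrite [leLHS]bE (_ : 1 / - kap = - (1 / kap)); last by rewrite invrN mulrN.
have Cy0 : 0 < C * (1 + kap * Y) by rewrite mulr_gt0.
have b_gt0 : 0 < b `^ (- kap) by rewrite powR_gt0.
rewrite ![_ `^ - (1 / kap)]powRN lef_pV2 ?posrE ?(powR_gt0 _ Cy0) ?(powR_gt0 _ b_gt0)//.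
by rewrite ge0_ler_powR ?nnegrE ?(ltW Cy0) ?(ltW b_gt0)// div1r invr_ge0 ltW.
Qed.

End Estimates.

Theorem theorem7p9 (R : realType) (n : nat) (M : ptopologicalType)
    (g : riemannianStructure (R := R) n M)
    (f : M -> R) (vol omega : {measure set (borel M) -> \bar R})
    (phi : R -> R) (Psi : M -> R) (nu : probability (borel M) R)
    (K xi0 : R)
    (n_ge2 : (2 <= n)%N)
    (M_complete_connected : complete_connected_manifold g)
    (f_smooth : smooth_function g f)
    (volP : is_riemannian_volume g vol)
    (omegaP : has_density vol omega (fun x => (expR (- f x))%:E))
    (phiP : phi_function phi)
    (Psi_continuous : continuous Psi)
    (nuP : has_density omega nu (sigma phi Psi))
    (adm : admissible n omega phi Psi)
    (nu_ac : nu `<< omega)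
    (K_gt0 : 0 < K)
    (hess : Hess_ge g (relative_entropy omega phi Psi) K)
    (sigma_bounded : ('N[omega]_(+oo)[sigma phi Psi] < +oo)%E)
    (xi0_ge1 : 1 <= xi0)
    (xi0_ge_sigma : ('N[omega]_(+oo)[sigma phi Psi] <= xi0%:E)%E) :
  let theta := fine (theta_phi phi) in
  let delta := fine (delta_phi phi) in
  let alpha := concentration g nu in
  [/\ (theta < 1 -> 0 < delta -> forall r : R, 0 < r ->
        (((delta * (1 - theta) / ((1 - delta) * (2 - delta)))
            `^ (1 / (1 - delta)))%:E
         * e_m (2 - delta) (K / 4 * xi0 `^ (delta - 1) * r ^+ 2)
         <= (alpha r)^-1)%E),
      (1 < theta < 3 / 2 -> 3 * (theta - 1) < delta ->
        (omega setT < +oo)%E -> forall r : R, 0 < r ->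
        (alpha r <=
         (((theta - 1) * (3 - 3 * theta + delta) / (2 * theta - delta - 1))
            `^ (1 / (1 - 2 * theta + delta)))%:E
         * e_m (2 * (1 - theta) + delta)
             (- (K / 2) * ((theta - 1) / ((2 - theta) * (3 * theta - delta - 2)))
              * xi0 `^ (delta - theta) * fine (omega setT) `^ (1 - theta)
              * r ^+ 2))%E) &
      (theta = 1 -> 1 / 2 < delta -> forall r : R, 0 < r ->
        (e_m (3 - 2 * delta) (- 2 / (3 - 2 * delta))
         * e_m (3 - 2 * delta) (K / 4 * xi0 `^ (delta - 1) * r ^+ 2)
         <= (alpha r)^-1)%E)].
Proof.
have [_ _ M_connected _] := M_complete_connected.
have [phi1 [N_cases N2] [PsiL _] int_h int_ln] := adm.
have [th [de [thetaP deltaP de0 det th32]]] := admissible_exponents phiP n_ge2 (conj N_cases N2).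
rewrite thetaP deltaP /= in PsiL *; split.
- move=> t1 d0 r r0.
  by apply: (concentration_theta_lt1 M_connected phiP phi1 Psi_continuous PsiL nuP int_h int_ln thetaP deltaP).
- move=> /andP[t1 t2] d3 oT r r0.
  apply: (concentration_theta_gt1 M_connected phiP phi1 Psi_continuous PsiL nuP int_h int_ln thetaP deltaP) => //.
  by apply: lt_trans d3; rewrite mulr_gt0// subr_gt0.
- move=> t1 d2 r r0.
  apply: (concentration_theta_eq1 M_connected phiP phi1 Psi_continuous PsiL nuP int_h int_ln thetaP deltaP) => //.
  by apply: lt_trans d2; rewrite divr_gt0.
Qed.
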